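(* Let $X=l_1\oplus Z$, where $Z$ is a separable Banach space. Then for any countable ordinal $\alpha\ge 1$ and any Banach space $Y$ whose dual $Y^*$ contains closed separable norming subspaces of infinite codimension, there exists an isomorphic embedding $T:Y\to X^*$ such that $(T(Y))_{(\alpha)}\neq (T(Y))_{(\alpha+1)}=X^*$. Conversely, the dual $Y^*$ of any total subspace $Y\subset X^*$ contains closed separable norming subspaces of infinite codimension.
   Context: ''Subspace'' means linear subspace (closedness is stated when required). A subspace $M\subset X^*$ is total if for every $0\ne x\in X$ there is $f\in M$ with $f(x)\ne 0$. A subspace $M$ of the dual $Y^*$ of a normed space $Y$ is norming if there is $c>0$ such that $\sup_{f\in S(M)}|f(y)|\ge c\|y\|$ for all $y\in Y$, where $S(M)$ is the unit sphere of $M$. An isomorphic embedding is a bounded linear operator that is an isomorphism (linear homeomorphism) onto its image. Weak$^*$ sequential closures: for a subspace $M\subset X^*$, $M_{(1)}$ is the set of all limits of weak$^*$ convergent sequences from $M$. Setting $M_{(0)}=M$, for an ordinal $\alpha\ge 1$ the weak$^*$ sequential closure of order $\alpha$ is defined by transfinite recursion as $M_{(\alpha)}=\bigcup_{\beta<\alpha}(M_{(\beta)})_{(1)}$. *)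

(* Defs.v *)
From HB Require Import structures.
From mathcomp Require Import all_boot all_order all_algebra.
From mathcomp Require Import all_classical wochoice all_reals.
From mathcomp Require Import topology normedtype sequences.

Set Implicit Arguments.
Unset Strict Implicit.
Unset Printing Implicit Defensive.

Import Order.TTheory GRing.Theory Num.Theory.
Import numFieldNormedType.Exports.

Local Open Scope classical_set_scope.
Local Open Scope ring_scope.

Section Dual.
Context {R : realType} (V : normedModType R).

Definition dual_pred : {pred V -> R^o} := mem [set f | linear f /\ continuous f].

Lemma dual_submod_closed : submod_closed dual_pred.
Proof.
split.
  rewrite inE; split; last by move=> x; exact: cvg_cst.
  by move=> a x y; rewrite /= [LHS]/GRing.zero/= scaler0 addr0.
move=> a f g; rewrite !inE => -[lf cf] [lg cg]; split.
  move=> b x y; rewrite !fctE lf lg !scalerDr !scalerA mulrC -!addrA.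
  by congr (_ + _); rewrite addrCA.
by move=> x; apply: cvgD; [apply: cvgZl_tmp; exact: cf|exact: cg].
Qed.

HB.instance Definition _ :=
  GRing.isSubmodClosed.Build R (V -> R^o) dual_pred dual_submod_closed.

Record dual := Dual { dual_fun :> V -> R^o; dual_funP : dual_fun \in dual_pred }.

HB.instance Definition _ := [isSub for dual_fun].
HB.instance Definition _ := [Choice of dual by <:].
HB.instance Definition _ := [SubChoice_isSubLmodule of dual by <:].

Definition opnorm (f : dual) : R := sup [set `|f x| | x in [set x | `|x| <= 1]].

Lemma dual_linear (f : dual) : linear f.
Proof. by have := dual_funP f; rewrite inE => -[]. Qed.

Lemma dual_continuous (f : dual) : continuous f.
Proof. by have := dual_funP f; rewrite inE => -[]. Qed.

HB.instance Definition _ (f : dual) :=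
  GRing.isLinear.Build R V R^o *:%R f (dual_linear f).

Lemma opnorm_has_sup (f : dual) :
  has_sup [set `|f x| | x in [set x | `|x| <= 1]].
Proof.
split; first by exists `|f 0|, 0 => //=; rewrite normr0.
have /linear_bounded_continuous/bounded_funP/(_ 1)[M fM] := @dual_continuous f.
by exists M => _ [x /= x1 <-]; exact: fM.
Qed.

Lemma le_opnorm (f : dual) x : `|x| <= 1 -> `|f x| <= opnorm f.
Proof.
by move=> x1; apply: (ub_le_sup (proj2 (opnorm_has_sup f))); exists x.
Qed.

Lemma opnorm_le (f : dual) (c : R) :
  (forall x, `|x| <= 1 -> `|f x| <= c) -> opnorm f <= c.
Proof.
move=> fc; apply: ge_sup; first exact: (proj1 (opnorm_has_sup f)).
by move=> _ [x /= x1 <-]; exact: fc.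
Qed.

Lemma opnorm_ge0 (f : dual) : 0 <= opnorm f.
Proof. by apply: le_trans (le_opnorm f (x := 0) _); rewrite ?normr0. Qed.

Lemma opnormD (f g : dual) : opnorm (f + g) <= opnorm f + opnorm g.
Proof.
apply: opnorm_le => x x1; apply: le_trans (ler_normD _ _) _.
by apply: lerD; exact: le_opnorm.
Qed.

Let opnormZ_le (a : R) (f : dual) : opnorm (a *: f) <= `|a| * opnorm f.
Proof.
apply: opnorm_le => x x1; rewrite [X in `|X|](_ : _ = a * f x) // normrM.
by apply: ler_wpM2l => //; exact: le_opnorm.
Qed.

Lemma opnormZ (a : R) (f : dual) : opnorm (a *: f) = `|a| * opnorm f.
Proof.
apply/eqP; rewrite eq_le opnormZ_le /=.
have [->|a0] := eqVneq a 0; first by rewrite normr0 mul0r opnorm_ge0.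
have := opnormZ_le a^-1 (a *: f).
by rewrite scalerA mulVf // scale1r normfV ler_pdivlMl ?normr_gt0.
Qed.

Lemma opnorm0_eq0 (f : dual) : opnorm f = 0 -> f = 0.
Proof.
move=> f0; apply/val_inj/funext => x /=.
have [->|x0] := eqVneq x 0; first by rewrite linear0.
have : `|f (`|x|^-1 *: x)| <= 0.
  rewrite -f0; apply: le_opnorm.
  by rewrite normrZ normfV normr_id mulVf ?normr_eq0.
rewrite linearZ normr_le0 scaler_eq0 invr_eq0 normr_eq0 (negbTE x0) /=.
by move/eqP.
Qed.

HB.instance Definition _ :=
  Lmodule_isNormed.Build R dual opnormD opnormZ opnorm0_eq0.

End Dual.

Section EllOne.
Variable R : realType.

Definition l1_pred : {pred nat -> R^o} :=
  mem [set u : nat -> R^o | cvgn (series (fun n => `|u n| : R))].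

Lemma l1_seriesD (u v : nat -> R^o) : u \in l1_pred -> v \in l1_pred ->
  u + v \in l1_pred /\
  limn (series (fun n => `|(u + v) n| : R)) <=
  limn (series (fun n => `|u n| : R)) + limn (series (fun n => `|v n| : R)).
Proof.
rewrite !inE /= => cu cv.
have cuv := is_cvg_seriesD cu cv.
have le_uv n : `|(u + v) n| <= ((fun n => `|u n|) + (fun n => `|v n| : R)) n.
  exact: ler_normD.
have c : cvgn (series (fun n => `|(u + v) n| : R)).
  by apply: (series_le_cvg _ _ le_uv cuv) => n; rewrite ?addr_ge0.
by split => //; rewrite -lim_seriesD //; exact: lim_series_le.
Qed.

Lemma l1_seriesZ (a : R) (u : nat -> R^o) : u \in l1_pred ->
  a *: u \in l1_pred /\
  limn (series (fun n => `|(a *: u) n| : R)) =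
  `|a| * limn (series (fun n => `|u n| : R)).
Proof.
rewrite !inE /= => cu.
have -> : (fun n => `|(a *: u) n|) = `|a| *: (fun n => `|u n| : R^o).
  by apply/funext => n; rewrite [LHS]normrM.
by split; [exact: is_cvg_seriesZ|exact: lim_seriesZ].
Qed.

Lemma l1_submod_closed : submod_closed l1_pred.
Proof.
split.
  rewrite inE /= (_ : series _ = fun=> 0); first exact: is_cvg_cst.
  by apply/funext => n; rewrite /series /= big1 // => i _; rewrite normr0.
move=> a u v /(l1_seriesZ a)[au _] v1.
by have [] := l1_seriesD au v1.
Qed.

HB.instance Definition _ :=
  GRing.isSubmodClosed.Build R (nat -> R^o) l1_pred l1_submod_closed.

Record l1 := L1 { l1_seq :> nat -> R^o; l1_seqP : l1_seq \in l1_pred }.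

HB.instance Definition _ := [isSub for l1_seq].
HB.instance Definition _ := [Choice of l1 by <:].
HB.instance Definition _ := [SubChoice_isSubLmodule of l1 by <:].

Definition l1_norm (u : l1) : R := limn (series (fun n => `|u n| : R)).

Lemma l1_normD (u v : l1) : l1_norm (u + v) <= l1_norm u + l1_norm v.
Proof. by have [] := l1_seriesD (l1_seqP u) (l1_seqP v). Qed.

Lemma l1_normZ (a : R) (u : l1) : l1_norm (a *: u) = `|a| * l1_norm u.
Proof. by have [] := l1_seriesZ a (l1_seqP u). Qed.

Lemma l1_norm0_eq0 (u : l1) : l1_norm u = 0 -> u = 0.
Proof.
move=> u0; apply/val_inj/funext => n /=; apply/normr0_eq0/eqP.
rewrite eq_le normr_ge0 andbT -u0.
have cu : cvgn (series (fun n => `|u n| : R)) by have := l1_seqP u; rewrite inE.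
have nd : nondecreasing_seq (series (fun n => `|u n| : R)).
  by apply/nondecreasing_seqP => k; rewrite !seriesEnat /= big_nat_recr //= lerDl.
apply: le_trans (nondecreasing_cvgn_le nd cu n.+1).
by rewrite seriesEnat /= big_nat_recr //= lerDr sumr_ge0.
Qed.

HB.instance Definition _ :=
  Lmodule_isNormed.Build R l1 l1_normD l1_normZ l1_norm0_eq0.

End EllOne.

Section SubspaceType.
Context {R : realType} {V : normedModType R} (S : submodClosed V).

Definition subspace_type : Type := {x : V | x \in S}.

HB.instance Definition _ := SubChoice.on subspace_type.
HB.instance Definition _ := [SubChoice_isSubLmodule of subspace_type by <:].

Definition subspace_norm (x : subspace_type) : R := `|val x|.

Lemma subspace_normD x y :
  subspace_norm (x + y) <= subspace_norm x + subspace_norm y.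
Proof. exact: ler_normD. Qed.

Lemma subspace_normZ (a : R) x :
  subspace_norm (a *: x) = `|a| * subspace_norm x.
Proof. exact: normrZ. Qed.

Lemma subspace_norm0_eq0 x : subspace_norm x = 0 -> x = 0.
Proof. by move=> /normr0_eq0 x0; exact: val_inj. Qed.

HB.instance Definition _ := Lmodule_isNormed.Build R subspace_type
  subspace_normD subspace_normZ subspace_norm0_eq0.

End SubspaceType.

Definition separable_set {T : topologicalType} (A : set T) :=
  exists2 D : set T, countable D & D `<=` A /\ A `<=` closure D.

Definition finite_codim {R : realType} {V : lmodType R} (M : set V) :=
  exists (n : nat) (e : 'I_n -> V), forall x, exists a : 'I_n -> R,
    M (x - \sum_i a i *: e i).

Definition isomorphic_embedding {R : realType} {V W : normedModType R}
    (T : {linear V -> W}) :=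
  continuous T /\
  exists2 S : W -> V, cancel T S & {within range T, continuous S}.

Section SubspacesOfTheDual.
Context {R : realType} {V : normedModType R}.
Implicit Type M : set (dual V).

Definition total_set M :=
  forall x : V, x != 0 -> exists2 f : dual V, M f & f x != 0.

(* If M has no unit vector, [sup set0 = 0] forces V to be trivial. *)
Definition norming M := exists2 c : R, 0 < c &
  forall x : V,
    c * `|x| <= sup [set `|f x| | f in [set f : dual V | M f /\ `|f| = 1]].

Definition wstar_seq_closure M : set (dual V) :=
  [set f | exists2 g : nat -> dual V, (forall n, M (g n)) &
           forall x, g n x @[n --> \oo] --> f x].

End SubspacesOfTheDual.

Definition has_separable_norming_subspace {R : realType} (V : normedModType R) :=
  exists M : submodClosed (dual V),
    [/\ closed [set` M], separable_set [set` M], norming [set` M] &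
        ~ finite_codim [set` M]].

(* Ordinals are represented by well-ordered types, each standing for its order
   type; the ordinals below it are the order types of its initial segments. *)
Record wellOrder := WellOrder {
  wo_sort :> eqType;
  wo_le : rel wo_sort;
  wo_leP : well_order wo_le
}.

Lemma wo_le_anti (A : wellOrder) : antisymmetric (@wo_le A).
Proof.
move=> a b; apply: (@wo_chain_antisymmetric A (@wo_le A) predT) => //.
by move=> B _; exact: wo_leP.
Qed.

Definition wo_lt (A : wellOrder) (a b : A) : Prop := (a != b) && wo_le a b.

Lemma wo_lt_wf (A : wellOrder) : well_founded (@wo_lt A).
Proof.
move=> a; apply: contrapT => na.
have [|z [[zP zmin] _]] := @wo_leP A (mem [set x | ~ Acc (@wo_lt A) x]).
  by exists a; rewrite inE.
move: zP; rewrite inE /=; apply; constructor => y /andP[yz le_yz].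
apply: contrapT => ny.
have le_zy : wo_le z y by apply: zmin; rewrite inE.
by move: yz; rewrite (@wo_le_anti A y z) ?eqxx ?le_yz.
Qed.

Definition osucc_le (A : wellOrder) : rel (option A) := fun a b =>
  match a, b with
  | Some a, Some b => wo_le a b
  | _, None => true
  | None, Some _ => false
  end.

Lemma osucc_leP (A : wellOrder) : well_order (@osucc_le A).
Proof.
apply: antisymmetric_well_order.
  by move=> [a|] [b|] //= ab; congr Some; exact: wo_le_anti.
move=> B [b Bb].
have [[a Ba]|nB] := pselect (exists a, Some a \in B).
  have [|z [[zB zmin] _]] := @wo_leP A [pred a | Some a \in B].
    by exists a.
  by exists (Some z); split=> // -[x|] //=; exact: zmin.
exists None; case: b Bb => [b Bb|Bb]; first by case: nB; exists b.
by split=> // -[x Bx|//]; case: nB; exists x.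
Qed.

Definition osucc (A : wellOrder) : wellOrder := WellOrder (@osucc_leP A).

Section TransfiniteClosure.
Context {R : realType} {V : normedModType R} (M : set (dual V)).

(* One stage of the recursion: [I] indexes the ordinals below the current one
   and [N] the closures of those orders; an empty [I] is the ordinal 0. *)
Definition wsc_rec (I : Type) (N : I -> set (dual V)) : set (dual V) :=
  if pselect (inhabited I) then \bigcup_i wstar_seq_closure (N i) else M.

(* [wsc_lt a] is the closure whose order is the order type of {b | b < a}. *)
Definition wsc_lt (A : wellOrder) : A -> set (dual V) :=
  Fix (@wo_lt_wf A) (fun=> set (dual V)) (fun a N =>
    wsc_rec (fun b : {b | wo_lt b a} => N (sval b) (proj2_sig b))).

Lemma wsc_ltE (A : wellOrder) (a : A) :
  wsc_lt a = wsc_rec (fun b : {b | wo_lt b a} => wsc_lt (sval b)).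
Proof.
rewrite {1}/wsc_lt Fix_eq // => {}a N N' NN'.
by congr wsc_rec; apply/funext => b; exact: NN'.
Qed.

Definition wsc (A : wellOrder) : set (dual V) := wsc_rec (@wsc_lt A).

End TransfiniteClosure.

(* Main.v *)
(* Embedding. Let U be a closed separable norming subspace of V* of infinite
   codimension, (w_m, G_m) a biorthogonal system with G_m vanishing on U, and u_m
   norming functionals in U. With weights s_m decreasing fast, the operator
     T y = sum_m u_m(y) e_2m* + s_m w_m(y) phi_m
   is an embedding for every sequence phi_m in X*. Helly's theorem yields bounded
   y_k that tend to 0 on the u_j and on which w_j tends to delta_jm, so every
   phi_m lies in the first weak* sequential closure of T(V). Hence the order can
   be prescribed by a countable family phi. It is chosen along the tree of finite
   sequences, labelled by ordinals at most alpha that decrease towards the leaves: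
   a node s = j :: t has a functional jump s, the indicator of the first indices
   in the coordinate sequence (fan) of its parent t, and phi_s is
   2^-j jump s plus the indicator of the fan of s. In all closures of order at
   most the label of s the coordinates along the fan of s converge to
   2^j times the jump at s, so this jump is at most 2^-j times the norm; one step
   later jump s itself is reached, because the jumps of the children, already
   available, cut off the fan.

   Converse. Let j : X -> Y* be the evaluation map; it is injective and its image
   of the unit ball is norming. If there are biorthogonal h_n in Y*, F_n in Y**
   with |F_n o j| |h_n| small, then j - sum_n (F_n o j) h_n is a small perturbation
   of j with values in the common kernel of the F_n, and the closure of its range
   is the required subspace. If the construction of such a system stops, then
   j(X) has finite codimension, j is bounded below, Y* is separable, and a
   subspace of l1 of infinite codimension, cut out along differences of unit
   vectors tending to 0 pointwise on Y, is still norming. *)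
Require Import Defs.
From HB Require Import structures.
From mathcomp Require Import all_boot all_order all_algebra.
From mathcomp Require Import all_classical all_reals.
From mathcomp Require Import topology normedtype sequences.
From mathcomp Require Import ring lra.
From mathcomp Require wochoice.

Set Implicit Arguments.
Unset Strict Implicit.
Unset Printing Implicit Defensive.

Import Order.TTheory GRing.Theory Num.Theory.
Import numFieldNormedType.Exports.
Local Open Scope classical_set_scope.
Local Open Scope ring_scope.

(** The even coordinates of l1 carry the u_m, which make T bounded below whatever the phi_m are; the
    odd ones are left to the tree. The factor 2^-j in phi_s sets the price of a jump: in a low
    closure a jump of size r at s forces the limit 2^j r along the fan of s, so a norm bound keeps r
    small. The tie is undone only by cutting the fan of s at some k, and this cut is the jump of the
    child k :: s. Hence each jump waits for those of its children, and labels cofinal below that of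
    the parent make the wait as long as the label prescribes. At order alpha all coordinate
    functionals are available, and one more limit gives X*; but a functional whose jumps along the
    root sequence all have modulus 1 is still missing, since weak* convergent sequences are bounded
    and the jumps of their members decay.

    In the converse Y is any total subspace and may be incomplete. Completeness is used for X, l1
    and Y* only, in the form of summing geometric series, and Hahn-Banach is applied to a seminorm
    on Y* that measures both the norm and the representation by elements of X. *)

(** * The Hahn-Banach theorem for a seminorm *)

Section HahnBanach.
Context {R : realType} {V : lmodType R} (p : V -> R).
Hypothesis pD : forall x y, p (x + y) <= p x + p y.
Hypothesis pZ : forall a x, p (a *: x) = `|a| * p x.

Let p0 : p 0 = 0.
Proof. by rewrite -(scale0r 0) pZ normr0 mul0r. Qed.

Let pN x : p (- x) = p x.
Proof. by rewrite -scaleN1r pZ normrN1 mul1r. Qed.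

(** The graph of a partial linear functional below [p]. Single-valuedness is a consequence of the
    bound, by [dominated_fun]. *)
Let dominated (G : set (V * R)) :=
  (forall a g h, G g -> G h -> G (a *: g.1 + h.1, a * g.2 + h.2)) /\
  (forall g, G g -> g.2 <= p g.1).

Let dominated_fun G x r s : dominated G -> G (x, r) -> G (x, s) -> r = s.
Proof.
move=> [lG dG] Gr Gs.
have := dG _ (lG (-1) _ _ Gr Gs); have := dG _ (lG (-1) _ _ Gs Gr).
by rewrite /= !scaleN1r !addNr p0; lra.
Qed.

(** The value [c] at [x] has to lie between all [r - p (u - x)] and all [p (u + x) - r];
    subadditivity separates the two families, and [c] is the supremum of the lower one. Other
    multiples of [x] follow by scaling. *)
Let dominated_extend G x : dominated G -> G (0, 0) ->
  exists c, forall u r t, G (u, r) -> r + t * c <= p (u + t *: x).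
Proof.
move=> [lG dG] G0.
have key u r u' r' : G (u, r) -> G (u', r') -> r - p (u - x) <= p (u' + x) - r'.
  move=> Gu Gu'; have /= := dG _ (lG 1 _ _ Gu Gu').
  rewrite scale1r mul1r => /le_trans h.
  have := h _ (lexx _); have := pD (u - x) (u' + x).
  by rewrite addrACA addNr addr0; lra.
pose A := [set s | exists u r, G (u, r) /\ s = r - p (u - x)].
have supA : has_sup A.
  split; first by exists (0 - p (0 - x)), 0, 0.
  by exists (p (0 + x) - 0) => _ [u [r [Gu ->]]]; exact: key.
have ubA u r : G (u, r) -> r - p (u - x) <= sup A.
  by move=> Gu; apply: (ub_le_sup (proj2 supA)); exists u, r.
have leA u r : G (u, r) -> sup A <= p (u + x) - r.
  move=> Gu; apply: ge_sup; first exact: (proj1 supA).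
  by move=> _ [u' [r' [Gu' ->]]]; exact: key.
exists (sup A) => u r t Gu.
have Gs a : G (a *: u, a * r) by have := lG a _ _ Gu G0; rewrite /= !addr0.
have [t0|t0|->] := ltrgtP t 0; last by rewrite mul0r scale0r !addr0; exact: dG Gu.
- have := ubA _ _ (Gs (- t)^-1).
  have -> : (- t)^-1 *: u - x = (- t)^-1 *: (u + t *: x).
    by rewrite scalerDr scalerA invrN mulNr mulVf ?ltr0_neq0 // scaleN1r.
  rewrite pZ ger0_norm ?invr_ge0; last lra.
  rewrite -mulrBr mulrC ler_pdivrMr; last lra.
  by lra.
- have := leA _ _ (Gs t^-1).
  have -> : t^-1 *: u + x = t^-1 *: (u + t *: x).
    by rewrite scalerDr scalerA mulVf ?gt_eqF // scale1r.
  rewrite pZ ger0_norm ?invr_ge0; last lra.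
  rewrite -mulrBr mulrC ler_pdivlMr; last lra.
  by lra.
Qed.

Theorem seminorm_hahn_banach v : exists f : V -> R^o,
  [/\ linear f, forall x, `|f x| <= p x & f v = p v].
Proof.
pose G0 := [set g : V * R | exists a, g = (a *: v, a * p v)].
have p_ge0 x : 0 <= p x.
  by have := pD x (- x); rewrite addrN p0 pN; lra.
have domG0 : dominated (set0 `|` G0).
  rewrite set0U; split.
    move=> a _ _ [b ->] [c ->]; exists (a * b + c).
    by rewrite /= scalerA -scalerDl mulrA -mulrDl.
  by move=> _ [a ->] /=; rewrite pZ ler_wpM2r // ler_norm.
(* The condition bears on the union of [G] with the line [G0], so that the empty union of the empty
   chain satisfies it too. *)
have [F PF tF|G [domG maxG]] := @Zorn_bigcup _ [set G | dominated (G `|` G0)].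
  have [[G FG]|F0] := pselect (exists G, F G); last first.
    rewrite /= (_ : \bigcup_(X in F) X = set0) //.
    by rewrite -subset0 => g [G FG _]; apply: F0; exists G.
  split.
    have upper g h : (\bigcup_(X in F) X `|` G0) g ->
        (\bigcup_(X in F) X `|` G0) h ->
        exists2 H, F H & (H `|` G0) g /\ (H `|` G0) h.
      move=> [[A FA Ag]|G0g] [[B FB Bh]|G0h].
      - have [AB|BA] := tF _ _ FA FB.
          by exists B => //; split; left => //; exact: AB.
        by exists A => //; split; left => //; exact: BA.
      - by exists A => //; split; [left|right].
      - by exists B => //; split; [right|left].
      - by exists G => //; split; right.
    move=> a g h Hg Hh; have [H FH [Hg' Hh']] := upper _ _ Hg Hh.
    have [lH _] := PF _ FH; have [K|K] := lH a _ _ Hg' Hh'; last by right.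
    by left; exists H.
  move=> g [[A FA Ag]|G0g].
    by apply: (proj2 (PF _ FA)); left.
  by apply: (proj2 domG0); right.
have G00 : (G `|` G0) (0, 0) by right; exists 0; rewrite scale0r mul0r.
have total x : exists r, (G `|` G0) (x, r).
  apply: contrapT => nx; have [c xc] := dominated_extend x domG G00.
  pose H := [set g | exists u r t, (G `|` G0) (u, r) /\
                                   g = (u + t *: x, r + t * c)].
  have GH : G `|` G0 `<=` H.
    by move=> [u r] Gu; exists u, r, 0; rewrite scale0r mul0r !addr0.
  have HE : H `|` G0 = H.
    by apply/setUidPl => g G0g; apply: GH; right.
  apply: (maxG H).
    split; first by move=> g Gg; apply: GH; left.
    move=> HG; apply: nx; exists c; left; apply: HG.
    by exists 0, 0, 1; rewrite scale1r mul1r !add0r.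
  rewrite /= HE; split.
    move=> a _ _ [u [r [t [Gu ->]]]] [u' [r' [t' [Gu' ->]]]].
    exists (a *: u + u'), (a * r + r'), (a * t + t'); split.
      exact: (proj1 domG _ _ _ Gu Gu').
    rewrite /= !scalerDr scalerDl -scalerA; congr (_, _); last by ring.
    by rewrite addrACA.
  by move=> _ [u [r [t [Gu ->]]]] /=; exact: xc.
have [f fG] := choice total.
have uniq x r : (G `|` G0) (x, r) -> f x = r.
  by move=> h; apply: (dominated_fun domG (fG x) h).
have lf : linear f.
  by move=> a x y; apply: uniq; exact: (proj1 domG a _ _ (fG x) (fG y)).
exists f; split=> //.
  move=> x; rewrite ler_norml lerNl; apply/andP; split.
    have -> : - f x = f (- x).
      apply/esym/uniq.
      by have := proj1 domG (-1) _ _ (fG x) G00; rewrite /= !addr0 scaleN1r mulN1r.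
    by rewrite -(pN x); exact: (proj2 domG _ (fG _)).
  exact: (proj2 domG _ (fG x)).
by apply: uniq; right; exists 1; rewrite scale1r mul1r.
Qed.

End HahnBanach.

(** * Limits in epsilon form and geometric sums *)

Section Limits.
Context {R : realType}.

Lemma cvgn_leP (V : normedModType R) (u : nat -> V) (l : V) :
  u @ \oo --> l <->
  forall e, 0 < e -> exists N, forall n, (N <= n)%N -> `|u n - l| <= e.
Proof.
split=> [/cvgrPdist_le ul e /ul[N _ uN]|h]; last first.
  by apply/cvgrPdist_le => e /h[N hN]; exists N => // n /=; rewrite distrC; exact: hN.
by exists N => n Nn; rewrite distrC; exact: uN.
Qed.

Lemma exp_half_gt0 n : 0 < (2^-1 : R) ^+ n.
Proof. by rewrite exprn_gt0 // invr_gt0. Qed.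

Lemma exp_half_small (C e : R) : 0 < e ->
  exists N, forall n, (N <= n)%N -> C * 2^-1 ^+ n <= e.
Proof.
move=> e0; have h : (2^-1 : R) ^+ n @[n --> \oo] --> 0.
  by apply: cvg_expr; rewrite ger0_norm //; lra.
have e1 : 0 < e / (`|C| + 1) by rewrite divr_gt0 // ltr_wpDl.
have [N hN] := (proj1 (cvgn_leP _ _) h) _ e1.
exists N => n /hN; rewrite subr0 ger0_norm; last by rewrite ltW ?exp_half_gt0.
have := exp_half_gt0 n; set t := _ ^+ n => t0.
rewrite ler_pdivlMr ?ltr_wpDl //; apply: le_trans.
rewrite mulrC ler_wpM2l ?ltW //; have := ler_norm C; lra.
Qed.

Lemma sum_exp_half_le n : \sum_(0 <= i < n) (2^-1 : R) ^+ i <= 2.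
Proof.
have -> : \sum_(0 <= i < n) (2^-1 : R) ^+ i = 2 - 2 * 2^-1 ^+ n.
  elim: n => [|n IH]; first by rewrite big_geq // expr0; ring.
  by rewrite big_nat_recr //= IH exprS; field.
by have := exp_half_gt0 n; lra.
Qed.

Lemma sum_exp_half_tail_le m n : \sum_(m <= i < n) (2^-1 : R) ^+ i <= 2 * 2^-1 ^+ m.
Proof.
rewrite -{1}[m]add0n big_addn.
under eq_bigr => i _ do rewrite exprD.
by rewrite -mulr_suml; apply: ler_wpM2r; rewrite ?sum_exp_half_le // ltW ?exp_half_gt0.
Qed.

End Limits.

(** * Functionals, linear subspaces and their closures *)

Section DualBasics.
Context {R : realType} {V : normedModType R}.
Implicit Types (f g : dual V).

Lemma dual_le f x : `|f x| <= `|f| * `|x|.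
Proof.
have [->|x0] := eqVneq x 0; first by rewrite linear0 !normr0 mulr0.
have : `|f (`|x|^-1 *: x)| <= `|f|.
  by apply: le_opnorm; rewrite normrZ normfV normr_id mulVf ?normr_eq0.
rewrite linearZ normrZ normfV normr_id mulrC ler_pdivrMr ?normr_gt0 //.
Qed.

Lemma dual_norm_le f c : (forall x, `|x| <= 1 -> `|f x| <= c) -> `|f| <= c.
Proof. exact: opnorm_le. Qed.

Lemma dual_norm_le_mul f c : 0 <= c -> (forall x, `|f x| <= c * `|x|) -> `|f| <= c.
Proof.
move=> c0 fc; apply: dual_norm_le => x x1; apply: le_trans (fc x) _.
by rewrite -[leRHS]mulr1 ler_wpM2l.
Qed.

Lemma ex_dual (f : V -> R^o) (c : R) : linear f -> (forall x, `|f x| <= c * `|x|) ->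
  exists g : dual V, forall x, g x = f x.
Proof.
move=> lf fc.
pose F : {linear V -> R^o} := HB.pack f (GRing.isLinear.Build _ _ _ _ f lf).
have cf : continuous F.
  apply/linear_bounded_continuous/bounded_funP => r; exists (`|c| * r) => x xr.
  apply: le_trans (fc x) _; apply: le_trans (ler_wpM2r (normr_ge0 _) (ler_norm c)) _.
  by rewrite ler_wpM2l.
have fP : f \in @dual_pred R V by rewrite inE.
by exists (Dual fP).
Qed.

Lemma dualD f g x : (f + g) x = f x + g x. Proof. by []. Qed.
Lemma dualZ a f x : (a *: f) x = a * f x. Proof. by []. Qed.
Lemma dualB f g x : (f - g) x = f x - g x. Proof. by []. Qed.
Lemma dual0 x : (0 : dual V) x = 0. Proof. by []. Qed.

Lemma dual_sum (I : Type) (r : seq I) (P : pred I) (F : I -> dual V) x :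
  (\sum_(i <- r | P i) F i) x = \sum_(i <- r | P i) F i x.
Proof.
elim/big_rec2: _ => [|i a b _ <-]; [exact: dual0|exact: dualD].
Qed.

Lemma dual_ext f g : (forall x, f x = g x) -> f = g.
Proof. by move=> fg; apply/val_inj/funext. Qed.

End DualBasics.

Section Subspaces.
Context {R : realType} {V : normedModType R}.

Lemma ex_submodClosed (A : set V) : A 0 ->
  (forall a x y, A x -> A y -> A (a *: x + y)) ->
  exists M : submodClosed V, [set` M] = A.
Proof.
move=> A0 AL; pose P : {pred V} := mem A.
have cP : submod_closed P.
  split; first by rewrite inE.
  by move=> a x y; rewrite !inE; exact: AL.
pose M : submodClosed V := HB.pack P (GRing.isSubmodClosed.Build R V P cP).
exists M; apply/seteqP; split=> x /=; by rewrite inE.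
Qed.

Lemma closure_leP (A : set V) x :
  closure A x <-> forall e, 0 < e -> exists2 y, A y & `|y - x| <= e.
Proof.
split=> [cx e e0|h].
  have [y [Ay]] := cx _ (nbhsx_ballx x e e0).
  rewrite -ball_normE /= => xy; exists y => //; rewrite distrC; exact: ltW.
move=> B /nbhs_ballP[e /= e0 eB]; have [|y Ay xy] := h (e / 2).
  by rewrite divr_gt0.
exists y; split=> //; apply: eB; rewrite -ball_normE /= distrC.
by apply: le_lt_trans xy _; rewrite ltr_pdivrMr // ltr_pMr // ltr1n.
Qed.

Lemma closure_lin (A : set V) : A 0 ->
  (forall a x y, A x -> A y -> A (a *: x + y)) ->
  forall a x y, closure A x -> closure A y -> closure A (a *: x + y).
Proof.
move=> A0 AL a x y /closure_leP cx /closure_leP cy; apply/closure_leP => e e0.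
have a0 : 0 < `|a| + 1 by rewrite ltr_wpDl.
have [|x' Ax xx'] := cx (e / 2 / (`|a| + 1)); first by rewrite !divr_gt0.
have [|y' Ay yy'] := cy (e / 2); first by rewrite divr_gt0.
exists (a *: x' + y'); first exact: AL.
rewrite opprD addrACA -scalerBr [e]splitr.
apply: le_trans (ler_normD _ _) _; apply: lerD => //.
rewrite normrZ; move: xx'; rewrite ler_pdivlMr // mulrC; apply: le_trans.
by rewrite ler_wpM2r // lerDl.
Qed.

(* A functional of a biorthogonal system has to vanish on any combination of
   [n.+1] of the [h i] that lies in [M]. *)
Lemma biorthogonal_infinite_codim (M : set V) (h : nat -> V) (F : nat -> V -> R^o) :
  M 0 -> (forall a x y, M x -> M y -> M (a *: x + y)) ->
  (forall k, linear (F k)) -> (forall k x, M x -> F k x = 0) ->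
  (forall i j, F i (h j) = (i == j)%:R) -> ~ finite_codim M.
Proof.
move=> M0 ML lF FM Fh [n [e eM]].
have [a aM] := choice (fun k : 'I_n.+1 => eM (h k)).
pose A : 'M[R]_(n.+1, n) := \matrix_(k, i) a k i.
have /rowV0Pn[c cA c0] : kermx A != 0.
  rewrite kermx_eq0 /row_free neq_ltn; apply/orP; left.
  by rewrite ltnS rank_leq_col.
have {cA}cA : c *m A = 0 by apply/sub_kermxP.
have sumM (I : seq 'I_n.+1) (x : 'I_n.+1 -> V) : (forall i, M (x i)) ->
    M (\sum_(i <- I) c 0 i *: x i).
  move=> Mx; elim: I => [|i I IH]; first by rewrite big_nil.
  by rewrite big_cons; exact: ML.
have Mh : M (\sum_k c 0 k *: h k).
  rewrite (_ : \sum_k _ = \sum_k c 0 k *: (h k - \sum_i a k i *: e i)); first exact: sumM.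
  apply/eqP; rewrite -subr_eq0 -sumrB; apply/eqP.
  under eq_bigr => k _ do rewrite -scalerBr opprB addrCA subrr addr0 scaler_sumr.
  rewrite exchange_big big1 //= => i _.
  under eq_bigr => k _ do rewrite scalerA.
  rewrite -scaler_suml (_ : \sum_k _ = 0) ?scale0r //.
  by have /matrixP/(_ 0 i) := cA; rewrite !mxE => {2}<-; apply: eq_bigr => k _; rewrite mxE.
move/eqP: c0; apply; apply/rowP => k; rewrite mxE.
pose G : {linear V -> R^o} := HB.pack (F k) (GRing.isLinear.Build _ _ _ _ (F k) (lF k)).
have Gh j : G (h j) = (k == j :> nat)%:R by exact: Fh.
have <- : G (\sum_k c 0 k *: h k) = c 0 k; last exact: (FM k).
rewrite linear_sum (bigD1 k) //.
have -> : \sum_(i < n.+1 | true && (i != k)) G (c 0 i *: h i) = 0.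
  apply: big1 => j jk; rewrite linearZ Gh (_ : (k == j :> nat) = false).
    exact: mulr0.
  by rewrite eq_sym; exact: negbTE.
by rewrite [LHS]addr0 linearZ Gh eqxx; exact: mulr1.
Qed.

End Subspaces.

(** * Infinite biorthogonal systems by dependent choice *)

Definition biorthogonal {R : realType} {E : normedModType R}
    (n : nat) (h : nat -> E) (F : nat -> dual E) :=
  forall i j, (i < n)%N -> (j < n)%N -> F i (h j) = (i == j)%:R.

(** A state holds a length and two total sequences of which only the entries below the length count.
    Later states never alter these entries, so reading entry [n] from state [n.+1] gives the
    infinite system. *)
Lemma biorthogonal_sequence {R : realType} {E : normedModType R}
    (P : nat -> E -> dual E -> Prop) :
  (forall n h F, biorthogonal n h F -> (forall i, (i < n)%N -> P i (h i) (F i)) ->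
   exists (h' : E) (F' : dual E),
     [/\ forall i, (i < n)%N -> F i h' = 0, forall i, (i < n)%N -> F' (h i) = 0,
         F' h' = 1 & P n h' F']) ->
  exists (h : nat -> E) (F : nat -> dual E),
    (forall i j, F i (h j) = (i == j)%:R) /\ forall n, P n (h n) (F n).
Proof.
move=> step.
pose good (p : nat * ((nat -> E) * (nat -> dual E))) := biorthogonal p.1 p.2.1 p.2.2 /\
  forall i, (i < p.1)%N -> P i (p.2.1 i) (p.2.2 i).
pose S := {p | good p}.
pose upd (T : Type) n (h : nat -> T) x i := if i == n then x else h i.
have stepS (s : S) : exists t : S, exists x f, [/\ (sval t).1 = (sval s).1.+1,
    (sval t).2 = (upd _ (sval s).1 (sval s).2.1 x, upd _ (sval s).1 (sval s).2.2 f)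
    & P (sval s).1 x f].
  case: s => [[n [h F]] /= [b PhF]]; have [x [f [h1 h2 h3 h4]]] := step _ _ _ b PhF.
  have b' : good (n.+1, (upd _ n h x, upd _ n F f)).
    split=> [i j|i] /=; rewrite !ltnS /upd.
      rewrite (leq_eqVlt i) (leq_eqVlt j) => /predU1P[->|ltin] /predU1P[->|ltjn].
      - by rewrite !eqxx h3.
      - by rewrite eqxx (ltn_eqF ltjn) gtn_eqF // h2.
      - by rewrite eqxx (ltn_eqF ltin) h1.
      - by rewrite (ltn_eqF ltin) (ltn_eqF ltjn) b.
    rewrite leq_eqVlt => /predU1P[->|ltin]; first by rewrite eqxx.
    by rewrite (ltn_eqF ltin); exact: PhF.
  by exists (exist good _ b'), x, f.
have [next nextP] := choice stepS.
have b0 : good (0%N, (fun _ => 0, fun _ => 0)) by [].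
pose s0 : S := exist good _ b0.
pose s n := iter n next s0.
have s1 n : (sval (s n)).1 = n.
  by elim: n => //= n IH; have [x [f [-> _ _]]] := nextP (s n); rewrite IH.
have stable n m : (n < m)%N ->
    (sval (s m)).2.1 n = (sval (s n.+1)).2.1 n /\
    (sval (s m)).2.2 n = (sval (s n.+1)).2.2 n.
  elim: m => // m IH; rewrite ltnS leq_eqVlt => /predU1P[->//|nm].
  have [<- <-] := IH nm; rewrite [s m.+1]/=.
  have [x [f [_ -> _]]] := nextP (s m); rewrite /= /upd s1.
  by rewrite ltn_eqF.
exists (fun n => (sval (s n.+1)).2.1 n), (fun n => (sval (s n.+1)).2.2 n); split.
  move=> i j; have [li lj] := (leq_maxl i.+1 j.+1, leq_maxr i.+1 j.+1).
  have [_ <-] := stable _ _ li; have [<- _] := stable _ _ lj.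
  by apply: (proj1 (svalP (s (maxn i.+1 j.+1)))); rewrite s1.
move=> n; have [x [f [_ /= -> Pxf]]] := nextP (s n).
by rewrite s1 in Pxf; rewrite /= /upd s1 eqxx.
Qed.

(** * Norm estimates and completeness of l1 *)

Section EllOneTheory.
Context {R : realType}.
Implicit Types (u v : l1 R) (a : nat -> R).

Lemma l1_predP a (C : R) : (forall N, \sum_(0 <= i < N) `|a i| <= C) ->
  (a : nat -> R^o) \in @l1_pred R.
Proof.
move=> aC; rewrite inE; apply: nondecreasing_is_cvgn.
  by apply/nondecreasing_seqP => k; rewrite !seriesEnat /= big_nat_recr //= lerDl.
by exists C => _ [N _ <-]; rewrite seriesEnat; exact: aC.
Qed.

Lemma l1_cvg u : cvgn (series (fun n => `|u n| : R)).
Proof. by have := l1_seqP u; rewrite inE. Qed.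

Lemma l1_norm_ge u N : \sum_(0 <= i < N) `|u i| <= `|u|.
Proof.
have nd : nondecreasing_seq (series (fun n => `|u n| : R)).
  by apply/nondecreasing_seqP => k; rewrite !seriesEnat /= big_nat_recr //= lerDl.
by have := nondecreasing_cvgn_le nd (@l1_cvg u) N; rewrite seriesEnat.
Qed.

Lemma l1_norm_le u C : (forall N, \sum_(0 <= i < N) `|u i| <= C) -> `|u| <= C.
Proof.
move=> uC; apply: limr_le; first exact: (@l1_cvg u).
by apply: nearW => N; rewrite seriesEnat; exact: uC.
Qed.

Lemma l1B u v i : (u - v) i = u i - v i. Proof. by []. Qed.

Lemma l1_sum (I : Type) (r : seq I) (P : pred I) (F : I -> l1 R) i :
  (\sum_(j <- r | P j) F j) i = \sum_(j <- r | P j) F j i.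
Proof. by elim/big_rec2: _ => // j a b _ <-. Qed.

Lemma l1_coord_le u i : `|u i| <= `|u|.
Proof.
apply: le_trans (l1_norm_ge u i.+1).
by rewrite big_nat_recr //= lerDr sumr_ge0.
Qed.

Lemma l1_injective_sum_le u (s : nat -> nat) N : injective s ->
  \sum_(0 <= i < N) `|u (s i)| <= `|u|.
Proof.
move=> s_inj; pose M := (\max_(i < N) s i).+1.
apply: le_trans (l1_norm_ge u M).
rewrite -(big_map s xpredT (fun i => `|u i|)).
have sub : {subset [seq s i | i <- index_iota 0 N] <= index_iota 0 M}.
  move=> k /mapP[i]; rewrite mem_index_iota => /andP[_ iN] ->.
  rewrite mem_index_iota ltnS /=; exact: (leq_bigmax (F := fun i : 'I_N => s i) (Ordinal iN)).
have us : uniq [seq s i | i <- index_iota 0 N].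
  by rewrite map_inj_uniq // iota_uniq.
rewrite [leRHS](bigID (mem [seq s i | i <- index_iota 0 N])) /=.
rewrite -[leLHS]addr0; apply: lerD; last exact: sumr_ge0.
have P : perm_eq [seq s i | i <- index_iota 0 N]
    (seq.filter (mem [seq s i | i <- index_iota 0 N]) (index_iota 0 M)).
  apply: uniq_perm => //; first by rewrite filter_uniq // iota_uniq.
  by move=> k; rewrite mem_filter /=; have [/sub ->|] := boolP (k \in map _ _).
by rewrite (perm_big _ P) big_filter.
Qed.

(** Coordinates are 1-Lipschitz, hence converge. On each finite block the Cauchy estimate passes to
    the coordinatewise limit [a]; these block estimates show both that [a] is summable and that [F]
    converges to it in norm. *)
Lemma l1_complete (F : set_system (l1 R)) : ProperFilter F -> cauchy F -> cvg F.
Proof.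
move=> PF cF.
have small e : 0 < e -> exists2 A, F A & forall u v, A u -> A v -> `|u - v| <= e.
  move=> e0; have /cauchy_ballP/(_ _ e0) := cF.
  move=> [[A B] /= [FA FB] AB]; exists (A `&` B); first exact: filterI.
  move=> u v [Au _] [_ Bv]; have := AB (u, v) (conj Au Bv).
  by rewrite /= -ball_normE /= => /ltW.
have coord i : exists r : R, (fun u => u i : R) @ F --> r.
  suff : cvg ((fun u => u i : R) @ F) by move=> h; exists (lim ((fun u => u i : R) @ F)).
  apply/cauchy_cvgP/cauchy_ballP => e e0.
  have [A FA hA] := small _ (divr_gt0 e0 (ltr0n R 2)).
  pose f (u : l1 R) : R := u i.
  have FA' : F (f @^-1` (f @` A)) by apply: filterS FA => u Au; exists u.
  exists (f @` A, f @` A); first by split; exact: FA'.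
  move=> [_ _] /= [[u Au <-] [v Av <-]].
  rewrite -ball_normE /= (le_lt_trans (l1_coord_le (u - v) i)) //.
  by apply: le_lt_trans (hA _ _ Au Av) _; rewrite ltr_pdivrMr // ltr_pMr // ltr1n.
have [a aP] := choice coord.
have key A e : F A -> (forall u v, A u -> A v -> `|u - v| <= e) ->
    forall u, A u -> forall N, \sum_(0 <= i < N) `|u i - a i| <= e.
  move=> FA hA u Au N; apply/ler_addgt0Pr => d d0.
  (* Each of the [N] coordinates may be off by this much, for a total of at most [d]; [N.+1] avoids
     a division by zero. *)
  have d1 : 0 < d / (N.+1)%:R by rewrite divr_gt0.
  have near_a : F [set v : l1 R | forall i : 'I_N, `|a i - v i| <= d / (N.+1)%:R].
    apply: (@filter_forall _ _ (fun (i : 'I_N) (v : l1 R) => `|a i - v i| <= d / (N.+1)%:R)) => i; have /cvgrPdist_le := aP i; exact.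
  have [v [Av va]] := filter_ex (filterI FA near_a).
  apply: (@le_trans _ _ (\sum_(0 <= i < N) `|(u - v) i| + \sum_(0 <= i < N) d / N.+1%:R)).
    rewrite -big_split /= !big_mkord; apply: ler_sum => i _.
    rewrite (_ : u i - a i = u i - v i - (a i - v i)); last by ring.
    by apply: le_trans (ler_normB _ _) _; apply: lerD; [rewrite -l1B|exact: va].
  apply: lerD; first exact: le_trans (l1_norm_ge _ _) (hA _ _ Au Av).
  rewrite sumr_const_nat subn0 -[_ *+ N]mulr_natr -mulrA; apply: ler_piMr; first exact: ltW.
  by rewrite mulrC ler_pdivrMr // mul1r ler_nat.
have [A FA hA] := small 1 ltr01; have [u0 Au0] := filter_ex FA.
have al1 : (a : nat -> R^o) \in @l1_pred R.
  apply: (@l1_predP _ (1 + `|u0|)) => N.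
  apply: (@le_trans _ _ (\sum_(0 <= i < N) `|u0 i - a i| + \sum_(0 <= i < N) `|u0 i|)).
    rewrite -big_split; apply: ler_sum => i _.
    have := ler_normB (u0 i) (u0 i - a i); rewrite subKr addrC; exact.
  apply: lerD; last exact: l1_norm_ge.
  exact: (key _ _ FA hA _ Au0 N).
apply: (cvgP (L1 al1)); apply/cvgrPdist_le => e e0.
have [B FB hB] := small _ e0; apply: (filterS _ FB) => u Bu.
rewrite distrC; apply: l1_norm_le => N; exact: (key _ _ FB hB _ Bu N).
Qed.

HB.instance Definition _ := Uniform_isComplete.Build (l1 R) l1_complete.

End EllOneTheory.


(** * Pointwise convergent series of functionals; completeness for geometric series *)

Section SeriesOfFunctionals.
Context {R : realType}.

Lemma cvgn_dist_le (V : normedModType R) (u : nat -> V) (l c : V) (b : R) N :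
  u @ \oo --> l -> (forall n, (N <= n)%N -> `|u n - c| <= b) -> `|l - c| <= b.
Proof.
move=> /cvgn_leP ul uc; apply/ler_addgt0Pr => e /ul[M hM].
have [MN NM] := (leq_maxl M N, leq_maxr M N).
rewrite (_ : l - c = (u (maxn M N) - c) - (u (maxn M N) - l)); last first.
  by rewrite opprB [RHS]addrC addrA subrK.
by apply: le_trans (ler_normB _ _) _; apply: lerD; [exact: uc|exact: hM].
Qed.

Lemma cvgn_unique (u : nat -> R) (l l' : R) :
  u @ \oo --> l -> u @ \oo --> l' -> l = l'.
Proof. by move=> ul ul'; apply: (cvg_unique _ ul ul'). Qed.

Lemma abs_series_cvg (a : nat -> R) (C : R) :
  (forall N, \sum_(0 <= i < N) `|a i| <= C) ->
  exists l : R, (fun N => \sum_(0 <= i < N) a i) @ \oo --> l.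
Proof.
move=> aC; have /normed_cvg ca : cvgn [normed series (a : nat -> R^o)].
  apply: nondecreasing_is_cvgn.
    by apply/nondecreasing_seqP => k; rewrite /= !seriesEnat /= big_nat_recr //= lerDl.
  by exists C => _ [N _ <-]; rewrite /= seriesEnat; exact: aC.
exists (limn (series (a : nat -> R^o))).
by rewrite (_ : (fun N => _) = series (a : nat -> R^o)) //; apply/funext => N; rewrite seriesEnat.
Qed.

(** Summability is only asked pointwise, so the series may diverge in norm. This is how functionals
    on l1 with bounded, non-vanishing coefficients arise. *)
Lemma ex_dual_series (V : normedModType R) (f : nat -> dual V) (C : R) :
  (forall x N, \sum_(0 <= i < N) `|f i x| <= C * `|x|) ->
  exists g : dual V,
    (forall x, (fun N => \sum_(0 <= i < N) f i x : R) @ \oo --> (g x : R)) /\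
    forall x, `|g x| <= C * `|x|.
Proof.
move=> fC; have [g gP] := choice (fun x => abs_series_cvg (fC x)).
have lg : linear (g : V -> R^o).
  move=> a x y; apply: (cvgn_unique (gP _)).
  rewrite (_ : (fun N => _) = (fun N => a * \sum_(0 <= i < N) f i x + \sum_(0 <= i < N) f i y)).
    by apply: cvgD; [apply: cvgMr; exact: gP|exact: gP].
  apply/funext => N; rewrite mulr_sumr -big_split; apply: eq_bigr => i _.
  exact: linearP.
have gC x : `|g x| <= C * `|x|.
  rewrite -[g x]subr0; apply: (@cvgn_dist_le R^o _ _ _ _ 0 (gP x)) => n _.
  by rewrite subr0; apply: le_trans (ler_norm_sum _ _ _) (fC x n).
by have [h hE] := ex_dual lg gC; exists h; split=> x; rewrite hE.
Qed.

(** The form in which completeness is used below. It holds for complete spaces and for all duals,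
    passes to products, and comes with the rate of convergence. *)
Definition geometric_complete (V : normedModType R) :=
  forall (u : nat -> V) (C : R), (forall n, `|u n| <= C * 2^-1 ^+ n) ->
  exists l, forall N, `|l - \sum_(0 <= i < N) u i| <= 2 * C * 2^-1 ^+ N.

Lemma geometric_sum_le (V : normedModType R) (u : nat -> V) (C : R) M N :
  (forall n, `|u n| <= C * 2^-1 ^+ n) -> (N <= M)%N ->
  `|\sum_(0 <= i < M) u i - \sum_(0 <= i < N) u i| <= 2 * C * 2^-1 ^+ N.
Proof.
move=> uC NM; have C0 : 0 <= C by have := le_trans (normr_ge0 _) (uC 0%N); rewrite expr0 mulr1.
rewrite (big_cat_nat (leq0n N) NM) /= [X in X - _]addrC addrK.
apply: le_trans (ler_norm_sum _ _ _) _.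
apply: le_trans (ler_sum _ (fun i _ => uC i)) _.
rewrite -mulr_sumr mulrAC mulrC; apply: ler_wpM2r => //.
exact: sum_exp_half_tail_le.
Qed.

Lemma complete_geometric_complete (V : completeNormedModType R) : geometric_complete V.
Proof.
move=> u C uC; have C0 : 0 <= C by have := le_trans (normr_ge0 _) (uC 0%N); rewrite expr0 mulr1.
have /normed_cvg cu : cvgn [normed series u].
  apply: nondecreasing_is_cvgn.
    by apply/nondecreasing_seqP => k; rewrite /= !seriesEnat /= big_nat_recr //= lerDl.
  exists (2 * C) => _ [N _ <-]; rewrite /= seriesEnat /=.
  apply: le_trans (ler_sum _ (fun i _ => uC i)) _.
  by rewrite -mulr_sumr mulrC; apply: ler_wpM2r => //; exact: sum_exp_half_le.
exists (limn (series u)) => N; apply: (cvgn_dist_le (N := N) cu) => n Nn.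
by rewrite seriesEnat; exact: geometric_sum_le.
Qed.

Lemma dual_geometric_complete (V : normedModType R) : geometric_complete (dual V).
Proof.
move=> f C fC; have C0 : 0 <= C by have := le_trans (normr_ge0 _) (fC 0%N); rewrite expr0 mulr1.
have fxC x n : `|f n x| <= C * `|x| * 2^-1 ^+ n.
  rewrite mulrAC; apply: le_trans (dual_le _ _) _; exact: ler_wpM2r.
have [|g [gl gC]] := @ex_dual_series V f (2 * C).
  move=> x N; apply: le_trans (ler_sum _ (fun i _ => fxC x i)) _.
  rewrite -mulr_sumr mulrC -mulrA; apply: ler_wpM2r; first exact: mulr_ge0.
  exact: sum_exp_half_le.
exists g => N; apply: dual_norm_le_mul.
  by rewrite !mulr_ge0 // ltW // exp_half_gt0.
move=> x; rewrite dualB dual_sum (_ : _ * `|x| = 2 * (C * `|x|) * 2^-1 ^+ N); last by ring.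
apply: (@cvgn_dist_le R^o _ _ _ _ N (gl x)) => n Nn.
exact: (@geometric_sum_le R^o _ _ _ _ (fxC x)).
Qed.

Lemma prod_norm_le (V W : normedModType R) (x : V * W) c :
  `|x| <= c <-> `|x.1| <= c /\ `|x.2| <= c.
Proof. by rewrite prod_normE ge_max; split=> [/andP|[-> ->]]. Qed.

Lemma prod_geometric_complete (V W : normedModType R) :
  geometric_complete V -> geometric_complete W -> geometric_complete (V * W)%type.
Proof.
move=> cV cW u C uC.
have [l lP] := cV (fst \o u) C (fun n => proj1 (proj1 (prod_norm_le _ _) (uC n))).
have [m mP] := cW (snd \o u) C (fun n => proj2 (proj1 (prod_norm_le _ _) (uC n))).
exists (l, m) => N; apply/prod_norm_le.
have -> : \sum_(0 <= i < N) u i = (\sum_(0 <= i < N) (u i).1, \sum_(0 <= i < N) (u i).2).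
  by elim/big_rec3: _ => // i a b c _ ->; case: (u i).
by split; [exact: lP|exact: mP].
Qed.

End SeriesOfFunctionals.

(** * Unit vectors of l1 and functionals on the sum of l1 and Z *)

Section EllOneBasis.
Context {R : realType}.

Definition l1_basis_seq (i : nat) : nat -> R^o := fun n => (n == i)%:R.

Lemma l1_basis_seq_sum i N : \sum_(0 <= k < N) `|l1_basis_seq i k| <= 1.
Proof.
suff -> : \sum_(0 <= k < N) `|l1_basis_seq i k| = (i < N)%:R by rewrite lern1 leq_b1.
elim: N => [|N IH]; first by rewrite big_geq.
rewrite big_nat_recr //= IH /l1_basis_seq normr_nat -natrD; congr (_%:R).
by rewrite ltnS eq_sym; case: ltngtP.
Qed.

Lemma l1_basis_seqP i : l1_basis_seq i \in @l1_pred R.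
Proof. exact: l1_predP (l1_basis_seq_sum i). Qed.

Definition l1_basis i : l1 R := L1 (l1_basis_seqP i).

Lemma l1_basis_norm i : `|l1_basis i| <= 1.
Proof. by apply: l1_norm_le => N; exact: l1_basis_seq_sum. Qed.

Lemma l1_truncE (a : nat -> R) N k :
  (\sum_(0 <= i < N) a i *: l1_basis i) k = if (k < N)%N then a k else 0.
Proof.
rewrite l1_sum; elim: N => [|N IH]; first by rewrite big_geq.
rewrite big_nat_recr //= IH ltnS.
have -> : (a N *: l1_basis_seq N) k = a N * (k == N)%:R by [].
by have [kN|Nk|->] := ltngtP k N; rewrite ?mulr0 ?addr0 ?mulr1 ?add0r.
Qed.

Lemma l1_trunc_cvg (u : l1 R) :
  (fun N => \sum_(0 <= i < N) u i *: l1_basis i) @ \oo --> u.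
Proof.
apply/cvgn_leP => e e0.
have /cvgn_leP/(_ _ e0)[N hN] : series (fun n => `|u n| : R) @ \oo --> `|u|.
  exact: (@l1_cvg R u).
exists N => n /hN; rewrite seriesEnat distrC => hn; rewrite distrC.
apply: l1_norm_le => M; apply: le_trans hn.
under eq_bigr => i _ do rewrite l1B l1_truncE.
apply: le_trans (ler_norm _); rewrite lerBrDl.
apply: (@le_trans _ _ (\sum_(0 <= i < maxn n M) `|u i|)); last exact: l1_norm_ge.
rewrite (big_cat_nat (leq0n n) (leq_maxl n M)) /= lerD2l.
have [nM|Mn] := leqP n M; last first.
  rewrite big_nat_cond big1 ?sumr_ge0 // => i /andP[/andP[_ iM] _].
  by rewrite (ltn_trans iM Mn) subrr normr0.
rewrite (big_cat_nat (leq0n n) nM) /= big_nat_cond big1 ?add0r => [|i /andP[/andP[_ i_n] _]]; last first.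
  by rewrite i_n subrr normr0.
rewrite le_eqVlt; apply/orP; left; apply/eqP; apply: eq_big_nat => i /andP[ni _].
by rewrite ltnNge ni subr0.
Qed.

End EllOneBasis.

Section EllOneProduct.
Context {R : realType} {Z : normedModType R}.
Let X : normedModType R := (l1 R * Z)%type.
Implicit Types (x : X) (psi : dual X).

Lemma prod_fst_le x : `|x.1| <= `|x|.
Proof. by have /prod_norm_le[] := lexx `|x|. Qed.

Lemma prod_snd_le x : `|x.2| <= `|x|.
Proof. by have /prod_norm_le[] := lexx `|x|. Qed.

Lemma ex_coord i : exists c : dual X, forall x, c x = x.1 i.
Proof.
apply: (@ex_dual R X (fun x => x.1 i) 1); first by move=> a x y.
by move=> x; rewrite mul1r; exact: le_trans (l1_coord_le _ _) (prod_fst_le x).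
Qed.

Definition coord i : dual X := projT1 (cid (ex_coord i)).

Lemma coordE i x : coord i x = x.1 i.
Proof. by rewrite /coord; case: cid. Qed.

Definition unit_vec i : X := (l1_basis i, 0).

Lemma unit_vec_norm i : `|unit_vec i| <= 1.
Proof. by apply/prod_norm_le; rewrite /= normr0 ler01 l1_basis_norm. Qed.

(** The bound by [x.1] alone also makes [g] vanish on the summand [Z]. *)
Lemma ex_linf_dual (a : nat -> R) (C : R) : (forall i, `|a i| <= C) ->
  exists g : dual X,
    [/\ forall x, (fun N => \sum_(0 <= i < N) a i * x.1 i) @ \oo --> (g x : R),
        forall i, g (unit_vec i) = a i & forall x, `|g x| <= C * `|x.1|].
Proof.
move=> aC; have C0 : 0 <= C by exact: le_trans (aC 0%N).
have bound x N : \sum_(0 <= i < N) `|a i * x.1 i| <= C * `|x.1|.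
  apply: (@le_trans _ _ (\sum_(0 <= i < N) C * `|x.1 i|)).
    by apply: ler_sum => i _; rewrite normrM; apply: ler_wpM2r.
  by rewrite -mulr_sumr; apply: ler_wpM2l => //; exact: l1_norm_ge.
have [|g [gP gC]] := @ex_dual_series R X (fun i => a i *: coord i) C.
  move=> x N; under eq_bigr => i _ do rewrite dualZ coordE.
  by apply: le_trans (bound x N) _; apply: ler_wpM2l => //; exact: prod_fst_le.
have gP' x : (fun N => \sum_(0 <= i < N) a i * x.1 i) @ \oo --> (g x : R).
  by have := gP x; under eq_fun => N do under eq_bigr => i _ do rewrite dualZ coordE.
exists g; split=> //.
  move=> i; apply: (cvgn_unique (gP' _)); apply/cvgn_leP => e e0.
  exists i.+1 => n i_n; rewrite (bigD1_seq i) ?iota_uniq ?mem_index_iota //=.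
  rewrite /l1_basis_seq eqxx mulr1 big1 ?addr0 ?subrr ?normr0 ?ltW // => k ki.
  by rewrite (negbTE ki) mulr0.
move=> x; rewrite -[g x]subr0; apply: (@cvgn_dist_le R R^o _ _ _ _ 0 (gP' x)) => n _.
by rewrite subr0; apply: le_trans (ler_norm_sum _ _ _) (bound x n).
Qed.

Lemma dual_l1_expand psi x :
  (fun N => \sum_(0 <= i < N) psi (unit_vec i) * x.1 i + psi (0, x.2)) @ \oo -->
  (psi x : R).
Proof.
have E N : \sum_(0 <= i < N) psi (unit_vec i) * x.1 i + psi (0, x.2) =
    psi (\sum_(0 <= i < N) x.1 i *: l1_basis i, x.2).
  transitivity (psi ((\sum_(0 <= i < N) x.1 i *: l1_basis i, 0) + (0, x.2))); last first.
    by congr (psi _); congr (_, _); rewrite /= ?addr0 ?add0r.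
  rewrite linearD; congr (_ + _).
  have -> : (\sum_(0 <= i < N) x.1 i *: l1_basis i, 0 : Z) =
      \sum_(0 <= i < N) x.1 i *: unit_vec i.
    elim/big_rec2: _ => // i u v _ <-; congr (_, _); by rewrite /= scaler0 addr0.
  rewrite linear_sum; apply: eq_bigr => i _; rewrite linearZ mulrC //.
under eq_fun => N do rewrite E.
apply/cvgn_leP => e e0.
have e1 : 0 < e / (`|psi| + 1) by rewrite divr_gt0 // ltr_wpDl.
have /cvgn_leP/(_ _ e1)[M hM] := @l1_trunc_cvg R x.1.
exists M => n /hM; set t := \sum_(0 <= i < n) _ => ht.
rewrite -linearB; apply: le_trans (dual_le _ _) _.
have -> : (t, x.2) - x = (t - x.1, 0) by congr (_, _); rewrite /= ?subrr.
apply: (@le_trans _ _ (`|psi| * (e / (`|psi| + 1)))).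
  by apply: ler_wpM2l => //; apply/prod_norm_le; split=> /=; [exact: ht|rewrite normr0 ltW].
rewrite mulrCA; apply: ler_piMr; first exact: ltW.
by rewrite ler_pdivrMr ?ltr_wpDl // mul1r lerDl.
Qed.

End EllOneProduct.

(** * Finite combinations, successive approximation, a quotient seminorm *)

Section Combinations.
Context {R : realType}.

Lemma dual_comb (V : normedModType R) (f : dual V) (c : nat -> R) (h : nat -> V) n :
  f (\sum_(0 <= k < n) c k *: h k) = \sum_(0 <= k < n) c k * f (h k).
Proof. by rewrite linear_sum; apply: eq_bigr => k _; exact: linearZ. Qed.

Lemma sum_delta_mul (c : nat -> R) n i : (i < n)%N ->
  \sum_(0 <= k < n) c k * (i == k)%:R = c i.
Proof.
move=> i_n; rewrite (bigD1_seq i) ?iota_uniq ?mem_index_iota //=.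
rewrite eqxx mulr1 big1 ?addr0 // => k ki.
by rewrite eq_sym (negbTE ki) mulr0.
Qed.

Lemma sum_delta_scale (V : lmodType R) (h : nat -> V) n i : (i < n)%N ->
  \sum_(0 <= k < n) (k == i)%:R *: h k = h i.
Proof.
move=> i_n; rewrite (bigD1_seq i) ?iota_uniq ?mem_index_iota //=.
rewrite eqxx scale1r big1 ?addr0 // => k ki.
by rewrite (negbTE ki) scale0r.
Qed.

Lemma le_sum_nonneg (a : nat -> R) n i : (forall k, 0 <= a k) -> (i < n)%N ->
  a i <= \sum_(0 <= k < n) a k.
Proof.
move=> a0 i_n; rewrite (bigD1_seq i) ?iota_uniq ?mem_index_iota //= lerDl.
exact: sumr_ge0.
Qed.

End Combinations.

Section ApproximateSurjections.
Context {R : realType} {W E : normedModType R} (J : {linear W -> E}) (L : R).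
Hypothesis J_le : forall w, `|J w| <= L * `|w|.

Lemma approx_onto_exact (K : R) : 0 <= K -> geometric_complete W ->
  (forall e, exists w, `|e - J w| <= `|e| / 2 /\ `|w| <= K * `|e|) ->
  forall e, exists w, e = J w /\ `|w| <= 2 * K * `|e|.
Proof.
move=> K0 cW /choice[s sP] e.
pose r := fix r k := if k is k'.+1 then r k' - J (s (r k')) else e.
have rE k : r k = e - J (\sum_(0 <= i < k) s (r i)).
  elim: k => [|k IH]; first by rewrite big_geq // linear0 subr0.
  by rewrite big_nat_recr // linearD /= {1}IH opprD addrA.
have r_le k : `|r k| <= `|e| * 2^-1 ^+ k.
  elim: k => [|k IH]; first by rewrite expr0 mulr1.
  rewrite exprSr mulrA; apply: le_trans (proj1 (sP (r k))) _.
  by apply: ler_wpM2r; rewrite ?invr_ge0.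
have s_le k : `|s (r k)| <= (K * `|e|) * 2^-1 ^+ k.
  apply: le_trans (proj2 (sP (r k))) _; rewrite -mulrA.
  exact: ler_wpM2l.
have [w wP] := cW _ _ s_le; exists w; split; last first.
  by have := wP 0%N; rewrite big_geq // subr0 expr0 mulr1 -mulrA.
apply/eqP; rewrite -subr_eq0 -normr_eq0 eq_le normr_ge0 andbT.
apply/ler_addgt0Pr => d d0; rewrite add0r.
have [N] := exp_half_small (`|e| + `|L| * (2 * (K * `|e|))) d0.
move=> /(_ N (leqnn _)); apply: le_trans.
have -> : e - J w = r N - J (w - \sum_(0 <= i < N) s (r i)).
  by rewrite rE linearB opprB addrA subrK.
apply: le_trans (ler_normB _ _) _; rewrite mulrDl; apply: lerD; first exact: r_le.
apply: le_trans (J_le _) _; rewrite -mulrA.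
apply: le_trans (ler_wpM2r (normr_ge0 _) (ler_norm L)) _.
exact: ler_wpM2l.
Qed.

End ApproximateSurjections.

Section QuotientSeminorm.
Context {R : realType} {W E : normedModType R} (J : {linear W -> E}) (q : W -> R) (A : R).
Hypothesis A0 : 0 <= A.
Hypothesis q0 : forall w, 0 <= q w.
Hypothesis qD : forall v w, q (v + w) <= q v + q w.
Hypothesis qZ : forall a w, q (a *: w) = `|a| * q w.

(** For a seminorm [q] and nonnegative [A], this is the largest seminorm that is at most [A] times
    the norm on [E] and at most [q] along [J]. A functional dominated by it inherits both bounds. *)
Definition quotient_seminorm (e : E) : R := inf [set A * `|e - J w| + q w | w in setT].
Local Notation p := quotient_seminorm.

Let has_inf_p e : has_inf [set A * `|e - J w| + q w | w in setT].
Proof.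
split; first by exists (A * `|e - J 0| + q 0), 0.
by exists 0 => _ [w _ <-]; rewrite addr_ge0 // mulr_ge0.
Qed.

Lemma quotient_seminorm_le e w : p e <= A * `|e - J w| + q w.
Proof. by apply: ge_inf; [exact: (proj2 (has_inf_p e))|exists w]. Qed.

Lemma quotient_seminorm_lt e c : p e < c -> exists w, A * `|e - J w| + q w < c.
Proof. by move=> /(inf_lt (proj1 (has_inf_p e)))[_ [w _ <-]]; exists w. Qed.

Lemma quotient_seminorm_ge0 e : 0 <= p e.
Proof.
apply: lb_le_inf; first exact: (proj1 (has_inf_p e)).
by move=> _ [w _ <-]; rewrite addr_ge0 // mulr_ge0.
Qed.

Lemma quotient_seminormD e f : p (e + f) <= p e + p f.
Proof.
apply/ler_addgt0Pr => d d0.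
have [v hv] : exists v, A * `|e - J v| + q v < p e + d / 2.
  by apply: quotient_seminorm_lt; rewrite ltrDl divr_gt0.
have [w hw] : exists w, A * `|f - J w| + q w < p f + d / 2.
  by apply: quotient_seminorm_lt; rewrite ltrDl divr_gt0.
have := quotient_seminorm_le (e + f) (v + w).
have -> : e + f - J (v + w) = (e - J v) + (f - J w) by rewrite linearD opprD addrACA.
have := ler_wpM2l A0 (ler_normD (e - J v) (f - J w)); have := qD v w.
lra.
Qed.

Let quotient_seminormZ_le a e : p (a *: e) <= `|a| * p e.
Proof.
have [->|a0] := eqVneq a 0.
  rewrite normr0 mul0r scale0r; apply: le_trans (quotient_seminorm_le 0 0) _.
  by rewrite linear0 subrr normr0 mulr0 add0r -(scale0r 0) qZ normr0 mul0r.
rewrite mulrC -ler_pdivrMr ?normr_gt0 //; apply: lb_le_inf; first exact: (proj1 (has_inf_p e)).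
move=> _ [w _ <-]; rewrite ler_pdivrMr ?normr_gt0 //.
apply: le_trans (quotient_seminorm_le (a *: e) (a *: w)) _.
by rewrite linearZ -scalerBr normrZ qZ; lra.
Qed.

Lemma quotient_seminormZ a e : p (a *: e) = `|a| * p e.
Proof.
apply/eqP; rewrite eq_le quotient_seminormZ_le /=.
have [->|a0] := eqVneq a 0.
  by rewrite normr0 mul0r; exact: quotient_seminorm_ge0.
have := quotient_seminormZ_le a^-1 (a *: e).
by rewrite scalerA mulVf // scale1r normfV ler_pdivlMl ?normr_gt0.
Qed.

Lemma quotient_seminorm_functional e : exists f : dual E,
  [/\ f e = p e, forall x, `|f x| <= A * `|x| & forall w, `|f (J w)| <= q w].
Proof.
have [f [lf fp fe]] := seminorm_hahn_banach quotient_seminormD quotient_seminormZ e.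
have fA x : `|f x| <= A * `|x|.
  apply: le_trans (fp x) _; apply: le_trans (quotient_seminorm_le x 0) _.
  by rewrite linear0 subr0 -(scale0r 0) qZ normr0 mul0r addr0.
have [g gE] := ex_dual lf fA; exists g; split=> [|x|w]; rewrite gE //.
apply: le_trans (fp _) _; apply: le_trans (quotient_seminorm_le _ w) _.
by rewrite subrr normr0 mulr0 add0r.
Qed.

End QuotientSeminorm.

(** * Extending a finite biorthogonal system, or covering the space *)

Section Extension.
Context {R : realType} {X E : normedModType R} (j : {linear X -> E}).
Hypothesis j_le : forall x, `|j x| <= `|x|.
Variables (n : nat) (h : nat -> E) (F : nat -> dual E).
Hypothesis bhF : biorthogonal n h F.

Let W : normedModType R := (X * l1 R)%type.
(** The factor l1 stands in for n-tuples of coefficients; only its first [n] coordinates enter. *)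
Let Jf (w : W) := j w.1 + \sum_(0 <= i < n) w.2 i *: h i.

Let Jf_linear : linear Jf.
Proof.
move=> a v w; rewrite /Jf /= linearP scalerDr addrACA; congr (_ + _).
rewrite scaler_sumr -big_split; apply: eq_bigr => i _; rewrite scalerA.
exact: (scalerDl (h i) (a * v.2 i) (w.2 i)).
Qed.

HB.instance Definition _ := GRing.isLinear.Build _ _ _ _ Jf Jf_linear.

Let Jf_le w : `|Jf w| <= (1 + \sum_(0 <= i < n) `|h i|) * `|w|.
Proof.
apply: le_trans (ler_normD _ _) _; rewrite mulrDl mul1r; apply: lerD.
  by apply: le_trans (j_le _) _; have /prod_norm_le[] := lexx `|w|.
rewrite mulr_suml; apply: le_trans (ler_norm_sum _ _ _) _.
apply: ler_sum => i _; rewrite normrZ mulrC; apply: ler_wpM2l => //.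
by apply: le_trans (l1_coord_le _ _) _; have /prod_norm_le[] := lexx `|w|.
Qed.

Let proj e := e - \sum_(0 <= i < n) F i e *: h i.

Let F_comb i (c : nat -> R) : (i < n)%N -> F i (\sum_(0 <= k < n) c k *: h k) = c i.
Proof.
move=> i_n; rewrite dual_comb -[RHS](sum_delta_mul c i_n).
by apply: eq_big_nat => k /andP[_ kn]; rewrite bhF.
Qed.

Let F_proj i e : (i < n)%N -> F i (proj e) = 0.
Proof. by move=> i_n; rewrite linearB /= F_comb // subrr. Qed.

(* If the seminorm [p e = inf (A |e - J w| + |w.1|)] is small at every point,
   every point is half-way approximated by some [J w] with [w] controlled, and
   iterating makes [J] onto; otherwise Hahn-Banach for [p] gives the new pair. *)
Lemma biorthogonal_extension (eps : R) : 0 < eps -> geometric_complete X ->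
  (exists (h' : E) (F' : dual E),
     [/\ forall i, (i < n)%N -> F i h' = 0, forall i, (i < n)%N -> F' (h i) = 0,
         F' h' = 1 & forall x, `|h'| * `|F' (j x)| <= eps * `|x|]) \/
  (exists K : R, 0 <= K /\ forall e, exists (x : X) (c : nat -> R),
     [/\ e = j x + \sum_(0 <= i < n) c i *: h i, `|x| <= K * `|e| &
         forall i, `|c i| <= K * `|e|]).
Proof.
move=> eps0 cX.
pose K1 := 1 + \sum_(0 <= i < n) `|F i| * `|h i|.
have K1_gt0 : 0 < K1 by rewrite ltr_pwDl // sumr_ge0 // => i _; exact: mulr_ge0.
have proj_le e : `|proj e| <= K1 * `|e|.
  apply: le_trans (ler_normB _ _) _; rewrite mulrDl mul1r lerD2l mulr_suml.
  apply: le_trans (ler_norm_sum _ _ _) _; apply: ler_sum => i _.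
  rewrite normrZ mulrAC; apply: ler_wpM2r => //; exact: dual_le.
(* With this value, [A] times the distance from [e] to [Jf w] being at most [K1 / eps] times the
   norm of [e] makes that distance at most half the norm of [e]. *)
pose A := 2 * K1 / eps.
have A_gt0 : 0 < A by rewrite divr_gt0 // mulr_gt0.
(* The coefficients are left out of [q], so a functional bounded by [q] along [Jf] vanishes on all
   [h i] with [i < n]. *)
pose q (w : W) := `|w.1|.
have qD v w : q (v + w) <= q v + q w by exact: ler_normD.
have qZ a w : q (a *: w) = `|a| * q w by exact: normrZ.
have q0 w : 0 <= q w by exact: normr_ge0.
pose p := quotient_seminorm Jf q A.
have comb_W (c : nat -> R) : Jf (0, \sum_(0 <= i < n) c i *: l1_basis i) =
    \sum_(0 <= i < n) c i *: h i.
  rewrite /Jf /= linear0 add0r; apply: eq_big_nat => i /andP[_ i_n].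
  by rewrite l1_truncE i_n.
have [[e [e0 pe]]|small] := pselect (exists e, 0 < `|proj e| /\ `|proj e| <= eps * p e).
  left; have pe0 : 0 < p e.
    by have := lt_le_trans e0 pe; rewrite pmulr_rgt0.
  have [f [fe fA fJ]] := quotient_seminorm_functional Jf (ltW A_gt0) q0 qD qZ e.
  have fh (c : nat -> R) : f (\sum_(0 <= i < n) c i *: h i) = 0.
    apply/eqP; rewrite -normr_le0 -comb_W; apply: le_trans (fJ _) _.
    by rewrite /q /= normr0.
  exists (proj e), ((p e)^-1 *: f); split.
  - by move=> i; exact: F_proj.
  - move=> i i_n; rewrite dualZ (_ : f (h i) = 0) ?mulr0 //.
    by rewrite -(fh (fun k => (k == i)%:R)) sum_delta_scale.
  - by rewrite dualZ linearB /= fh subr0 fe mulVf // gt_eqF.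
  - move=> x; rewrite dualZ normrM normfV (ger0_norm (ltW pe0)) mulrA.
    have -> : j x = Jf (x, 0) by rewrite /Jf /= big1 ?addr0 // => i _; exact: scale0r.
    apply: ler_pM => //.
      by rewrite mulr_ge0 // invr_ge0 ltW.
    by rewrite ler_pdivrMr.
right; pose K2 := K1 / eps; have K2_gt0 : 0 < K2 by rewrite divr_gt0.
have sumF0 : 0 <= \sum_(0 <= i < n) `|F i| by exact: sumr_ge0.
(* The coefficients of the approximant are the values of the [F i] at its combination of the [h i],
   which has norm at most [2 + K2] times that of [e]. *)
pose K := K2 + (2 + K2) * \sum_(0 <= i < n) `|F i|.
have K0 : 0 <= K by rewrite /K; nra.
have step e : exists w : W, `|e - Jf w| <= `|e| / 2 /\ `|w| <= (K * n%:R + K) * `|e|.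
  suff [x [c [h1 h2 h3]]] : exists x (c : nat -> R),
      [/\ `|e - (j x + \sum_(0 <= i < n) c i *: h i)| <= `|e| / 2,
          `|x| <= K * `|e| & forall i, (i < n)%N -> `|c i| <= K * `|e| ].
    exists (x, \sum_(0 <= i < n) c i *: l1_basis i); split.
      apply: le_trans h1; rewrite /Jf /= le_eqVlt; apply/orP; left; apply/eqP.
      congr (`|_ - (_ + _)|); apply: eq_big_nat => i /andP[_ i_n].
      by rewrite l1_truncE i_n.
    rewrite mulrDl; apply/prod_norm_le; split => /=.
      by apply: le_trans h2 _; rewrite lerDr !mulr_ge0.
    rewrite -[leLHS]addr0; apply: lerD; last by rewrite mulr_ge0.
    apply: le_trans (ler_norm_sum _ _ _) _.
    apply: (@le_trans _ _ (\sum_(0 <= i < n) K * `|e|)); last first.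
      by rewrite sumr_const_nat subn0 -[_ *+ n]mulr_natr mulrAC.
    rewrite !big_nat; apply: ler_sum => i /andP[_ i_n].
    rewrite normrZ -[leRHS]mulr1; apply: ler_pM => //; last exact: l1_basis_norm.
    exact: h3.
  have [pr0|pr0] := eqVneq (proj e) 0.
    exists 0, (fun i => F i e); split.
    - by rewrite linear0 add0r -/(proj e) pr0 normr0 divr_ge0.
    - by rewrite normr0 mulr_ge0.
    - move=> i i_n; apply: le_trans (dual_le _ _) _; apply: ler_wpM2r => //.
      have := le_sum_nonneg (fun k => normr_ge0 (F k)) i_n.
      rewrite /K; nra.
  have pe : p e < eps^-1 * `|proj e|.
    rewrite ltNge; apply/negP => hp; apply: small; exists e.
    by rewrite normr_gt0; split => //; rewrite -ler_pdivrMl.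
  have [w hw] := quotient_seminorm_lt (ltW A_gt0) q0 pe.
  have hw' : A * `|e - Jf w| + q w < K2 * `|e|.
    apply: lt_le_trans hw _; have einv : 0 <= eps^-1 by rewrite invr_ge0 ltW.
    by have := ler_wpM2l einv (proj_le e); rewrite /K2; lra.
  have res : `|e - Jf w| <= `|e| / 2.
    have : A * `|e - Jf w| <= K2 * `|e| by have := q0 w; lra.
    have -> : A = 2 * K2 by rewrite /A /K2 mulrA.
    rewrite -mulrA mulrCA ler_pM2l //; lra.
  have wK2 : `|w.1| <= K2 * `|e|.
    have : 0 <= A * `|e - Jf w| by apply: mulr_ge0 => //; exact: ltW.
    by move: hw'; rewrite /q; lra.
  have K2K : K2 <= K by rewrite /K; nra.
  exists w.1, (fun i => w.2 i); split => //.
    by apply: le_trans wK2 _; exact: ler_wpM2r.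
  move=> i i_n; rewrite -[X in `|X|](F_comb (fun i => w.2 i) i_n).
  apply: le_trans (dual_le _ _) _.
  have Fi := le_sum_nonneg (fun k => normr_ge0 (F k)) i_n.
  have eta : `|\sum_(0 <= i < n) w.2 i *: h i| <= (2 + K2) * `|e|.
    have -> : \sum_(0 <= i < n) w.2 i *: h i = e - (e - Jf w) - j w.1.
      by rewrite /Jf opprB addrCA subrr addr0 addrAC subrr add0r.
    apply: le_trans (ler_normB _ _) _; rewrite mulrDl; apply: lerD; last first.
      by apply: le_trans (j_le _) _.
    apply: le_trans (ler_normB _ _) _; have := normr_ge0 e; lra.
  apply: le_trans (ler_pM (normr_ge0 _) (normr_ge0 _) Fi eta) _.
  rewrite mulrA; apply: ler_wpM2r => //; rewrite mulrC /K; lra.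
have cW : geometric_complete W.
  by apply: prod_geometric_complete => //; exact: complete_geometric_complete.
have K'0 : 0 <= K * n%:R + K by rewrite addr_ge0 // mulr_ge0.
exists (2 * (K * n%:R + K)); split; first by rewrite mulr_ge0.
move=> e; have [w [eE wK]] := approx_onto_exact Jf_le K'0 cW step e.
have /prod_norm_le[w1 w2] := wK.
exists w.1, (fun i => w.2 i); split => // i.
exact: le_trans (l1_coord_le _ _) w2.
Qed.

End Extension.

(** * Separability through dense sequences *)

Lemma countable_seq (T : Type) (D : set T) (d : T) : D d -> countable D ->
  exists s : nat -> T, (forall n, D (s n)) /\ forall x, D x -> exists n, s n = x.
Proof.
move=> Dd /countable_injP[f f_inj].
have /choice[s sP] : forall n, exists y,
    D y /\ ((exists2 x, D x & f x = n) -> f y = n).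
  move=> n.
  have [[x Dx fx]|no] := pselect (exists2 x, D x & f x = n); first by exists x.
  by exists d; split.
exists s; split=> [n|x Dx]; first exact: (proj1 (sP n)).
exists (f x); have [Ds] := sP (f x); move=> /(_ (ex_intro2 _ _ x Dx erefl)).
by apply: f_inj; rewrite inE.
Qed.

Section DenseSequences.
Context {R : realType}.

Definition dense_seq (V : normedModType R) (A : set V) (s : nat -> V) :=
  (forall n, A (s n)) /\ forall x, A x -> forall e, 0 < e -> exists n, `|s n - x| <= e.

Lemma dense_seq_separable (V : normedModType R) (A : set V) s :
  dense_seq A s -> separable_set A.
Proof.
move=> [As ds]; exists (range s).
  by apply: sub_countable (countableP [set: nat]); exact: card_image_le.
split=> [_ [n _ <-]//|x Ax]; apply/closure_leP => e e0.
by have [n hn] := ds x Ax e e0; exists (s n); first by exists n.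
Qed.

Lemma separable_dense_seq (V : normedModType R) (A : set V) :
  separable_set A -> A !=set0 -> exists s, dense_seq A s.
Proof.
move=> [D cD [DA AD]] [a Aa].
have [d Dd _] := proj1 (closure_leP _ _) (AD _ Aa) 1 ltr01.
have [s [Ds sD]] := countable_seq Dd cD.
exists s; split=> [n|x Ax e e0]; first exact: DA.
have [y Dy yx] := proj1 (closure_leP _ _) (AD _ Ax) e e0.
by have [n sn] := sD y Dy; exists n; rewrite sn.
Qed.

Lemma countable_dense_seq (V : normedModType R) (A : set V) (T : countType) (s : T -> V) :
  T -> (forall t, A (s t)) ->
  (forall x, A x -> forall e, 0 < e -> exists t, `|s t - x| <= e) ->
  exists s', dense_seq A s'.
Proof.
move=> t0 As ds; exists (fun n => s (odflt t0 (unpickle n))); split=> // x Ax e e0.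
by have [t ht] := ds x Ax e e0; exists (pickle t); rewrite pickleK.
Qed.

Lemma exp_half_nat (e : R) : 0 < e -> exists n : nat, (2^-1 : R) ^+ n <= e.
Proof.
by move=> /(exp_half_small 1)[n /(_ n (leqnn n))]; rewrite mul1r; exists n.
Qed.

(** In each ball with centre [s n] and radius [2^-1 ^+ k] that meets [B] a point of [B] is chosen,
    and [b] otherwise. These countably many points are dense in [B]. *)
Lemma dense_seq_subset (V : normedModType R) (A B : set V) s : dense_seq A s ->
  B `<=` A -> B !=set0 -> exists s', dense_seq B s'.
Proof.
move=> [As ds] BA [b Bb].
have /choice[t tP] : forall p : nat * nat, exists y, B y /\
    ((exists2 x, B x & `|s p.1 - x| <= 2^-1 ^+ p.2) -> `|s p.1 - y| <= 2^-1 ^+ p.2).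
  move=> p.
  have [[x Bx hx]|no] := pselect (exists2 x, B x & `|s p.1 - x| <= 2^-1 ^+ p.2).
    by exists x.
  by exists b; split.
apply: (countable_dense_seq (s := t)) => [|p|x Bx e e0].
- exact: (0%N, 0%N).
- exact: (proj1 (tP p)).
have [k hk] := exp_half_nat (divr_gt0 e0 (ltr0n R 2)).
have [n hn] := ds x (BA _ Bx) _ (exp_half_gt0 k).
exists (n, k); have [_ /(_ (ex_intro2 _ _ x Bx hn)) ht] := tP (n, k).
rewrite (_ : t _ - x = (s n - x) - (s n - t (n, k))); last by rewrite opprB [RHS]addrC addrA subrK.
by apply: le_trans (ler_normB _ _) _; move: hn ht => /=; lra.
Qed.

Lemma dense_seq_image (V W : normedModType R) (f : V -> W) (L : R) s :
  (forall x y, `|f x - f y| <= L * `|x - y|) -> dense_seq setT s ->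
  dense_seq (range f) (f \o s).
Proof.
move=> fL [_ ds]; split=> [n|_ [x _ <-] e e0]; first by exists (s n).
have L0 : 0 < `|L| + 1 by rewrite ltr_wpDl.
have [n hn] := ds x I _ (divr_gt0 e0 L0); exists n => /=.
apply: le_trans (fL _ _) _; apply: (@le_trans _ _ ((`|L| + 1) * `|s n - x|)).
  by apply: ler_wpM2r => //; have := ler_norm L; lra.
by move: hn; rewrite ler_pdivlMr // mulrC.
Qed.

Lemma dense_seq_closure (V : normedModType R) (A : set V) s : dense_seq A s ->
  dense_seq (closure A) s.
Proof.
move=> [As ds]; split=> [n|x cx e e0]; first exact: subset_closure (As n).
have e2 : 0 < e / 2 by rewrite divr_gt0.
have [y Ay yx] := proj1 (closure_leP _ _) cx _ e2.
have [n hn] := ds y Ay _ e2; exists n.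
rewrite -(subrKA y) [e]splitr; apply: le_trans (ler_normD _ _) _; exact: lerD.
Qed.

Lemma dense_seq_prod (V W : normedModType R) s t :
  dense_seq [set: V] s -> dense_seq [set: W] t ->
  exists u, dense_seq [set: (V * W)%type] u.
Proof.
move=> [_ ds] [_ dt].
apply: (countable_dense_seq (s := fun p : nat * nat => (s p.1, t p.2))) => //.
  exact: (0%N, 0%N).
move=> x _ e e0; have [n hn] := ds x.1 I e e0; have [m hm] := dt x.2 I e e0.
by exists (n, m); apply/prod_norm_le.
Qed.

Lemma l1_dense_seq : exists s, dense_seq [set: l1 R] s.
Proof.
pose s (r : seq rat) : l1 R :=
  \sum_(0 <= i < size r) (ratr (nth 0 r i) : R) *: l1_basis i.
apply: (countable_dense_seq (s := s)) => //; first exact: [::].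
move=> u _ e e0; have e2 : 0 < e / 2 by rewrite divr_gt0.
have /cvgn_leP/(_ _ e2)[N /(_ N (leqnn N)) hN] := @l1_trunc_cvg R u.
have d0 : 0 < e / 2 / (N.+1)%:R by rewrite divr_gt0.
have /choice[q qP] : forall i, exists q : rat, `|ratr q - u i| <= e / 2 / (N.+1)%:R.
  move=> i.
  move: d0; set d := e / 2 / _ => d0.
  have /rat_in_itvoo[q] : u i - d < u i + d by lra.
  rewrite in_itv /= => /andP[q1 q2]; exists q; rewrite ler_norml.
  by apply/andP; split; lra.
exists (mkseq q N); rewrite /s size_mkseq.
rewrite -(subrKA (\sum_(0 <= i < N) u i *: l1_basis i)) [e]splitr.
apply: le_trans (ler_normD _ _) _; apply: lerD => //.
rewrite -sumrB; apply: le_trans (ler_norm_sum _ _ _) _.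
apply: (@le_trans _ _ (\sum_(0 <= i < N) e / 2 / (N.+1)%:R)); last first.
  rewrite sumr_const_nat subn0 -[_ *+ N]mulr_natr -mulrA; apply: ler_piMr; first exact: ltW.
  by rewrite mulrC ler_pdivrMr // mul1r ler_nat.
rewrite !big_nat; apply: ler_sum => i /andP[_ iN].
rewrite nth_mkseq // -scalerBl normrZ -[leRHS]mulr1.
by apply: ler_pM => //; exact: l1_basis_norm.
Qed.

End DenseSequences.

(** * Norming subspaces; functionals vanishing on a closed subspace *)

Section NormingSets.
Context {R : realType} {V : normedModType R}.

Lemma dual_norm_attained (f : dual V) (c : R) : c < `|f| ->
  exists x, `|x| <= 1 /\ c < `|f x|.
Proof.
move=> cf; apply: contrapT => nx.
suff : `|f| <= c by rewrite leNgt cf.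
apply: dual_norm_le => x x1; rewrite leNgt; apply/negP => cx; apply: nx.
by exists x.
Qed.

(** Lets the witnesses have any norm up to [C]; normalizing them costs the factor [C]. *)
Lemma norming_intro (M : set (dual V)) (c C : R) : 0 < c -> 0 < C ->
  (forall a f, M f -> M (a *: f)) ->
  (forall v, v != 0 -> exists2 f, M f & `|f| <= C /\ c * `|v| <= `|f v|) ->
  norming M.
Proof.
move=> c0 C0 MZ hM; exists (c / C); first by rewrite divr_gt0.
(* At 0 there may be no unit vector in [M] at all; the supremum is then that of the empty set, which
   is 0. *)
move=> v; have [->|v0] := eqVneq v 0.
  rewrite normr0 mulr0; have [[g Mg]|no] := pselect (exists f, M f /\ `|f| = 1).
    apply: ub_le_sup; first by exists 0 => _ [f _ <-]; rewrite linear0 normr0.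
    by exists g => //; exact: (etrans (congr1 _ (linear0 g)) (normr0 _)).
  have -> : [set `|f 0| | f in [set f : dual V | M f /\ `|f| = 1]] = set0; last by rewrite sup0.
  by rewrite -subset0 => t [f Mf _]; apply: no; exists f.
have [f Mf [fC fv]] := hM v v0.
have f0 : 0 < `|f|.
  have : 0 < `|f v| by apply: lt_le_trans fv; rewrite mulr_gt0 // normr_gt0.
  by rewrite !normr_gt0; apply: contraNneq => ->; rewrite dual0 eqxx.
suff h : c / C * `|v| <= `|(`|f|^-1 *: f) v|.
  apply: (le_trans h).
  apply: ub_le_sup.
    exists `|v| => _ [g [_ g1] <-]; apply: le_trans (dual_le _ _) _.
    by rewrite g1 mul1r.
  exists (`|f|^-1 *: f) => //; split; first exact: MZ.
  by rewrite normrZ normfV normr_id mulVf // gt_eqF.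
rewrite dualZ normrM normfV normr_id mulrC mulrA.
apply: (@le_trans _ _ (c * `|v| / `|f|)); last by rewrite [leRHS]mulrC ler_wpM2r // invr_ge0.
rewrite [`|v| * c]mulrC ler_pM2l ?mulr_gt0 ?normr_gt0 // lef_pV2 ?posrE //.
Qed.

(** For [q = 0] and [A = 1] the quotient seminorm is the distance to [C], which is positive at [x]
    because [C] is closed. *)
Lemma closed_subspace_functional (C : set V) (x : V) : C 0 ->
  (forall a x y, C x -> C y -> C (a *: x + y)) -> closed C -> ~ C x ->
  exists f : dual V, f x = 1 /\ forall y, C y -> f y = 0.
Proof.
move=> C0 CL clC nCx; have [M MC] := ex_submodClosed C0 CL.
pose J : {linear subspace_type M -> V} := \val.
have [f [fx _ fJ]] := @quotient_seminorm_functional _ _ _ J (fun=> 0) 1 ler01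
  (fun=> lexx 0) (fun _ _ => eq_ind _ (fun t => 0 <= t) (lexx 0) _ (esym (addr0 0)))
  (fun a _ => esym (mulr0 `|a|)) x.
have px : 0 < quotient_seminorm J (fun=> 0) 1 x.
  rewrite lt_neqAle quotient_seminorm_ge0 // andbT; apply/eqP => p0.
  apply: nCx; apply: clC; apply/closure_leP => e e0.
  have [w] : exists w, 1 * `|x - J w| + 0 < e by apply: quotient_seminorm_lt; rewrite -?p0.
  rewrite mul1r addr0 => hw; exists (J w); last by rewrite distrC ltW.
  by rewrite -MC; exact: (svalP w).
exists ((quotient_seminorm J (fun=> 0) 1 x)^-1 *: f); split.
  by rewrite dualZ fx mulVf // gt_eqF.
move=> y; rewrite -MC => Cy; have := fJ (exist _ y Cy : subspace_type M).
by rewrite normr_le0 dualZ => /eqP ->; rewrite mulr0.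
Qed.

End NormingSets.

(** * Converse, first case: an infinite biorthogonal system *)

Section InfiniteBiorthogonalSystem.
Context {R : realType} {X V : normedModType R} (j : {linear X -> dual V}).
Hypothesis j_le : forall x, `|j x| <= `|x|.
Hypothesis j_norming : forall (v : V) c, c < `|v| -> exists x, `|x| <= 1 /\ c < `|j x v|.
Variable s : nat -> X.
Hypothesis dense_s : dense_seq [set: X] s.
Variables (h : nat -> dual V) (F : nat -> dual (dual V)).
Hypothesis biorth : forall i k, F i (h k) = (i == k)%:R.
Hypothesis small : forall n x, `|h n| * `|F n (j x)| <= 8^-1 * 2^-1 ^+ n * `|x|.

(* [corr x] is the sum of the [F n (j x) *: h n]; subtracting it from [j x]
   annihilates all the [F n] and is a small perturbation of [j]. *)
Let corr_ex x : exists l : dual V, forall N,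
  `|l - \sum_(0 <= i < N) F i (j x) *: h i| <= 2 * (8^-1 * `|x|) * 2^-1 ^+ N.
Proof.
apply: dual_geometric_complete => n; rewrite normrZ mulrC.
by apply: le_trans (small n x) _; rewrite mulrAC.
Qed.

Let corr x : dual V := projT1 (cid (corr_ex x)).

Let corrP x N :
  `|corr x - \sum_(0 <= i < N) F i (j x) *: h i| <= 2 * (8^-1 * `|x|) * 2^-1 ^+ N.
Proof. by rewrite /corr; case: cid. Qed.

Let small_eq0 (W : normedModType R) (w : W) C N0 :
  (forall N, (N0 <= N)%N -> `|w| <= C * 2^-1 ^+ N) -> w = 0.
Proof.
move=> wC; apply/eqP; rewrite -normr_le0; apply/ler_addgt0Pr => e e0; rewrite add0r.
have [N /(_ _ (leq_maxr N0 N))] := exp_half_small C e0; apply: le_trans.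
by apply: wC; exact: leq_maxl.
Qed.

Let corr_linear : linear corr.
Proof.
move=> a x y; apply/eqP; rewrite -subr_eq0; apply/eqP.
apply: (@small_eq0 _ _ (2 * (8^-1 * `|a *: x + y|) + (`|a| * (2 * (8^-1 * `|x|)) +
  2 * (8^-1 * `|y|))) 0%N) => N _.
pose S z := \sum_(0 <= i < N) F i (j z) *: h i.
have SE : S (a *: x + y) = a *: S x + S y.
  rewrite /S scaler_sumr -big_split; apply: eq_bigr => i _.
  by rewrite /= !linearP scalerDl scalerA.
have -> : corr (a *: x + y) - (a *: corr x + corr y) =
    (corr (a *: x + y) - S (a *: x + y)) - (a *: (corr x - S x) + (corr y - S y)).
  have -> : a *: (corr x - S x) + (corr y - S y) =
      (a *: corr x + corr y) - S (a *: x + y).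
    by rewrite SE scalerBr opprD addrACA.
  by rewrite opprB addrA subrK.
apply: le_trans (ler_normB _ _) _; rewrite mulrDl; apply: lerD; first exact: corrP.
apply: le_trans (ler_normD _ _) _; rewrite mulrDl; apply: lerD; last exact: corrP.
by rewrite normrZ -mulrA; apply: ler_wpM2l => //; exact: corrP.
Qed.

Let A x := j x - corr x.

Let A_linear a x y : A (a *: x + y) = a *: A x + A y.
Proof. by rewrite /A corr_linear linearP scalerBr opprD addrACA. Qed.

Let corr_le x : `|corr x| <= `|x| / 4.
Proof. by have := corrP x 0; rewrite big_geq // subr0 expr0; lra. Qed.

Let F_A k x : F k (A x) = 0.
Proof.
apply: (@small_eq0 R^o _ (`|F k| * (2 * (8^-1 * `|x|))) k.+1) => N kN.
have FS : F k (\sum_(0 <= i < N) F i (j x) *: h i) = F k (j x).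
  rewrite dual_comb -[RHS](sum_delta_mul (fun i => F i (j x)) kN).
  by apply: eq_bigr => i _; rewrite biorth.
have -> : F k (A x) = - F k (corr x - \sum_(0 <= i < N) F i (j x) *: h i).
  transitivity (F k (j x) - F k (corr x)); first exact: linearB.
  by rewrite -FS [in RHS]linearB opprB.
rewrite normrN -mulrA; apply: le_trans (dual_le _ _) _.
by apply: ler_wpM2l => //; exact: corrP.
Qed.

Let M := closure (range A).

Let range_A_lin a f g : range A f -> range A g -> range A (a *: f + g).
Proof. by move=> [x _ <-] [y _ <-]; exists (a *: x + y); rewrite ?A_linear. Qed.

Let A0 : A 0 = 0.
Proof. by have := A_linear (-1) 0 0; rewrite scaler0 addr0 scaleN1r addNr. Qed.

Let range_A0 : range A 0. Proof. by exists 0 => //; exact: A0. Qed.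

Let F_M k f : M f -> F k f = 0.
Proof.
move=> /closure_leP cf; apply/eqP; rewrite -normr_le0; apply/ler_addgt0Pr => e e0; rewrite add0r.
have Fk0 : 0 < `|F k| + 1 by rewrite ltr_wpDl.
have [_ [x _ <-] xf] := cf _ (divr_gt0 e0 Fk0).
have -> : F k f = - F k (A x - f) by rewrite linearB /= F_A sub0r opprK.
rewrite normrN; apply: le_trans (dual_le _ _) _.
apply: (@le_trans _ _ ((`|F k| + 1) * `|A x - f|)).
  by apply: ler_wpM2r => //; rewrite lerDl.
by move: xf; rewrite ler_pdivlMr // mulrC.
Qed.

(** The bounds in [small] sum to a quarter of the norm of [x]. A point of the unit ball with value
    above 3/4 of the norm of [v] under [j] thus keeps half of it under [A], while [A x] has norm at
    most 5/4. *)
Lemma perturbed_range_norming : has_separable_norming_subspace V.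
Proof.
have [N NM] := ex_submodClosed (subset_closure range_A0) (closure_lin range_A0 range_A_lin).
exists N; rewrite NM; split.
- exact: closed_closure.
- have AL x y : `|A x - A y| <= (5 / 4) * `|x - y|.
    have -> : A x - A y = A (x - y).
      by have := A_linear (-1) y x; rewrite !scaleN1r ![- _ + _]addrC => ->.
    apply: le_trans (ler_normB _ _) _.
    by have := j_le (x - y); have := corr_le (x - y); lra.
  exact: dense_seq_separable (dense_seq_closure (dense_seq_image AL dense_s)).
- apply: (@norming_intro _ _ _ 2^-1 2); rewrite ?invr_gt0 //.
    move=> a f Mf; have := @closure_lin _ _ _ range_A0 range_A_lin a _ _ Mf (subset_closure range_A0).
    by rewrite addr0.
  move=> v; rewrite -normr_gt0 => v0.
  have v1 : 3 / 4 * `|v| < `|v| by lra.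
  have [x [x1 jx]] := j_norming v1.
  exists (A x); first by apply: subset_closure; exists x.
  have c1 := corr_le x; have c2 := j_le x; split.
    by apply: le_trans (ler_normB _ _) _; lra.
  have c3 : `|corr x v| <= 4^-1 * `|v|.
    apply: le_trans (dual_le _ _) _; apply: ler_wpM2r => //; lra.
  have := lerB_normD (j x v) (- corr x v); rewrite normrN => c4.
  have -> : A x v = j x v - corr x v by [].
  lra.
- apply: (@biorthogonal_infinite_codim _ _ _ h F) => //.
  + exact: subset_closure range_A0.
  + exact: closure_lin range_A0 range_A_lin.
  + by move=> k; exact: dual_linear.
Qed.

End InfiniteBiorthogonalSystem.

(** * Converse, second case: reduction to a direct sum *)

Section MinimalCover.
Context {R : realType} {X E : normedModType R} (j : {linear X -> E}).
Hypothesis j_inj : forall x, j x = 0 -> x = 0.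

Definition covers (n : nat) (h : nat -> E) (K : R) :=
  0 <= K /\ forall e, exists (x : X) (c : nat -> R),
    [/\ e = j x + \sum_(0 <= i < n) c i *: h i, `|x| <= K * `|e| &
        forall i, `|c i| <= K * `|e|].

(** The relation expresses [h k] by [j x0] and the other vectors, so [h k] can be eliminated; [K']
    accounts for the substitution, and [bump k] renumbers the remaining vectors. *)
Lemma covers_remove n h K x0 c0 k : covers n.+1 h K -> (k < n.+1)%N -> c0 k != 0 ->
  j x0 = \sum_(0 <= i < n.+1) c0 i *: h i ->
  exists h' K', covers n h' K'.
Proof.
move=> [K0 hK] kn ck jx0; pose ik : 'I_n.+1 := Ordinal kn.
pose b i := bump k i.
have split_sum (c : nat -> R) : \sum_(0 <= i < n.+1) c i *: h i =
    c k *: h k + \sum_(0 <= i < n) c (b i) *: h (b i).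
  by rewrite !big_mkord (bigD1_ord ik).
pose S := \sum_(0 <= i < n.+1) `|c0 i|.
have S0 : 0 <= S by exact: sumr_ge0.
pose K' := K * (1 + (`|x0| + S) / `|c0 k|).
have iv : 0 <= `|c0 k|^-1 by rewrite invr_ge0.
exists (h \o b), K'; split; first by rewrite /K' mulr_ge0 // addr_ge0 // mulr_ge0 // addr_ge0.
move=> e; have [x [c [eE xK cK]]] := hK e.
have Ke : 0 <= K * `|e| by exact: mulr_ge0.
have tK : `|c k / c0 k| <= K * `|e| * `|c0 k|^-1.
  by rewrite normrM normfV; apply: ler_wpM2r.
pose t := c k / c0 k.
have hk : c k *: h k = t *: (j x0 - \sum_(0 <= i < n) c0 (b i) *: h (b i)).
  by rewrite jx0 split_sum addrK scalerA divfK.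
exists (x + t *: x0), (fun i => if (i < n)%N then c (b i) - t * c0 (b i) else 0); split.
- have -> : j (x + t *: x0) = j x + t *: j x0 by rewrite linearD linearZ.
  rewrite {1}eE split_sum hk scalerBr -!addrA; congr (_ + (_ + _)).
  rewrite scaler_sumr -sumrN -big_split; apply: eq_big_nat => i /andP[_ ->] /=.
  by rewrite scalerBl scalerA addrC.
- apply: le_trans (ler_normD _ _) _; rewrite normrZ.
  have := ler_wpM2r (normr_ge0 x0) tK; rewrite -/t /K' => h1.
  have : 0 <= K * `|e| * `|c0 k|^-1 * S by rewrite !mulr_ge0.
  by lra.
- move=> i; case: ifP => i_n; last by rewrite normr0 /K' !mulr_ge0 // addr_ge0 // mulr_ge0 // addr_ge0.
  have bn : (b i < n.+1)%N by have := ltn_ord (lift ik (Ordinal i_n)).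
  have cS := le_sum_nonneg (fun i => normr_ge0 (c0 i)) bn.
  apply: le_trans (ler_normB _ _) _; rewrite normrM.
  have h1 := ler_pM (normr_ge0 _) (normr_ge0 _) tK cS.
  have h2 := cK (b i).
  have : 0 <= K * `|e| * `|c0 k|^-1 * `|x0| by rewrite !mulr_ge0.
  by move: h1; rewrite -/t -/S /K'; lra.
Qed.

(** Take [n] least. A relation with a nonzero coefficient would allow a removal, against minimality,
    and one with zero coefficients forces [x = 0] by injectivity. *)
Lemma minimal_cover : (exists n h K, covers n h K) ->
  exists n h K, covers n h K /\
    forall x c, j x = \sum_(0 <= i < n) c i *: h i -> x = 0.
Proof.
move=> [n0 [h0 [K0 hK0]]].
have exP : exists n, `[< exists h K, covers n h K >].
  by exists n0; apply/asboolP; exists h0, K0.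
have [n /asboolP[h [K hK]] nmin] := ex_minnP exP.
exists n, h, K; split=> // x c jx; apply: contrapT => x0.
have [[k kn ck]|no] := pselect (exists2 k, (k < n)%N & c k != 0); last first.
  apply: x0; apply: j_inj; rewrite jx big_nat big1 // => i /andP[_ i_n].
  have [->|ci] := eqVneq (c i) 0; first by rewrite scale0r.
  by case: no; exists i.
case: n => [|n] in hK nmin jx kn *; first by [].
have [h' [K' hK']] := covers_remove hK kn ck jx.
have : (n < n)%N by apply: nmin; apply/asboolP; exists h', K'.
by rewrite ltnn.
Qed.

End MinimalCover.

(** * Nearly equal terms by pigeonhole; vectors spanning a space with separable dual *)

Section Pigeonhole.
Context {R : realType}.

Lemma truncn_close (a b : R) : 0 <= a -> 0 <= b ->
  Num.truncn a = Num.truncn b -> `|a - b| <= 1.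
Proof.
move=> a0 b0 ab.
have /andP[a1 a2] := truncn_itv a0; have /andP[b1 b2] := truncn_itv b0.
rewrite ab in a1 a2; rewrite -natr1 in a2 b2; rewrite ler_norml.
by apply/andP; split; lra.
Qed.

(** The first [i] sequences map each index to a cell of side [1 / k.+1] in a cube; two indices
    beyond [N] share a cell because the cells are finite in number. *)
Lemma bounded_pigeonhole (a : nat -> nat -> R) (i k N : nat) :
  (forall l n, `|a l n| <= 1) ->
  exists p q, [/\ (N <= p)%N, (p < q)%N &
    forall l, (l < i)%N -> `|a l p - a l q| <= (k.+1%:R)^-1].
Proof.
move=> a1.
(* [(a l n + 1) * k.+1] lies between 0 and [m], so its integer part takes at most [m.+1] values. *)
pose m := (2 * k.+1)%N.
pose cell (n : nat) : {ffun 'I_i -> 'I_m.+1} :=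
  [ffun l : 'I_i => inord (Num.truncn ((a l n + 1) * k.+1%:R))].
pose T := {ffun 'I_i -> 'I_m.+1}.
have [p [q [pq cpq]]] : exists p q : 'I_(#|T|).+1, (p < q)%N /\ cell (N + p)%N = cell (N + q)%N.
  pose f (x : 'I_(#|T|).+1) := cell (N + x)%N.
  have /injectivePn : ~~ injectiveb f.
    apply/negP => /injectiveP/leq_card; rewrite card_ord ltnn //.
  move=> [x [y xy fxy]]; have [lt_xy|lt_yx|] := ltngtP x y.
  - by exists x, y.
  - by exists y, x.
  - by move/val_inj => E; rewrite E eqxx in xy.
exists (N + p)%N, (N + q)%N; split; [exact: leq_addr|by rewrite ltn_add2l|].
move=> l li; have /ffunP/(_ (Ordinal li)) := cpq; rewrite !ffunE /=.
have pos n : 0 <= (a l n + 1) * k.+1%:R.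
  by apply: mulr_ge0 => //; have := a1 l n; rewrite ler_norml => /andP[]; lra.
have bnd n : (Num.truncn ((a l n + 1) * k.+1%:R) < m.+1)%N.
  rewrite ltnS -(@ler_nat R); apply: le_trans (proj1 (andP (truncn_itv (pos n)))) _.
  rewrite natrM; apply: ler_wpM2r => //.
  by have := a1 l n; rewrite ler_norml => /andP[]; lra.
move=> /(congr1 (@nat_of_ord _)); rewrite !inordK // => /(truncn_close (pos _) (pos _)).
rewrite -mulrBl normrM normr_nat => h.
rewrite -[leRHS]mul1r ler_pdivlMr //; apply: le_trans h.
by rewrite opprD addrACA subrr addr0.
Qed.

Lemma injective_unbounded (s : nat -> nat) N : injective s -> exists l, (N <= s l)%N.
Proof.
move=> s_inj; apply: contrapT => no.
have lt l : (s l < N)%N by rewrite ltnNge; apply/negP => h; apply: no; exists l.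
have : injective (fun x : 'I_N.+1 => Ordinal (lt x)).
  by move=> x y /(congr1 val) /= /s_inj /val_inj.
by move/leq_card; rewrite !card_ord ltnn.
Qed.

End Pigeonhole.

(** Each [v m] nearly attains half the norm of [e m]. A nonzero functional vanishing on [C] would be
    close to some [e m], which would then be too small at [v m]. *)
Lemma separable_dual_vectors {R : realType} {V : normedModType R} (e : nat -> dual V) :
  dense_seq [set: dual V] e ->
  exists v : nat -> V, (forall m, `|v m| <= 1) /\
    forall C : set V, C 0 -> (forall a x y, C x -> C y -> C (a *: x + y)) ->
      closed C -> (forall m, C (v m)) -> C = setT.
Proof.
move=> [_ de].
have /choice[v vP] : forall m, exists v, `|v| <= 1 /\ `|e m| / 2 <= `|e m v|.
  move=> m; have [em0|em0] := eqVneq (e m) 0.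
    by exists 0; rewrite em0 !normr0 mul0r.
  have : `|e m| / 2 < `|e m| by move: em0; rewrite -normr_gt0; lra.
  by move=> /dual_norm_attained[x [x1 /ltW hx]]; exists x.
exists v; split=> [m|C C0 CL clC Cv]; first exact: (proj1 (vP m)).
apply/seteqP; split=> // x _; apply: contrapT => nCx.
have [f [fx fC]] := closed_subspace_functional C0 CL clC nCx.
have f0 : 0 < `|f|.
  rewrite normr_gt0; apply/eqP => f0.
  by move: fx; rewrite f0 dual0 => /esym/eqP; rewrite oner_eq0.
have [m hm] := de f I _ (divr_gt0 f0 (ltr0n R 4)).
have [v1 v2] := vP m.
have : `|e m (v m)| <= `|f| / 4.
  have -> : e m (v m) = (e m - f) (v m) by rewrite dualB fC // subr0.
  apply: le_trans (dual_le _ _) _; have := ler_pM (normr_ge0 _) (normr_ge0 _) hm v1.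
  by rewrite mulr1.
have : `|f| - `|e m| <= `|e m - f|.
  by rewrite distrC; exact: lerB_dist.
lra.
Qed.

(** * Converse, second case: a norming subspace inside the range *)

Section FiniteCodimensionalRange.
Context {R : realType} {Z : completeNormedModType R} {V : normedModType R}.
Let X : normedModType R := (l1 R * Z)%type.
Variable j : {linear X -> dual V}.
Hypothesis j_le : forall x, `|j x| <= `|x|.
Hypothesis j_norming : forall (v : V) c, c < `|v| -> exists x, `|x| <= 1 /\ c < `|j x v|.
Variable s : nat -> X.
Hypothesis dense_s : dense_seq [set: X] s.
Variables (n : nat) (h : nat -> dual V) (K : R).
Hypothesis cov : covers j n h K.
Hypothesis indep : forall x c, j x = \sum_(0 <= i < n) c i *: h i -> x = 0.

Let cX : geometric_complete X.
Proof. by apply: prod_geometric_complete; exact: complete_geometric_complete. Qed.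

Let K0 : 0 <= K. Proof. exact: (proj1 cov). Qed.

Let solve_ex (e : dual V) : exists x : X,
  `|x| <= K * `|e| /\ exists c, e = j x + \sum_(0 <= i < n) c i *: h i.
Proof.
by have [x [c [eE xK _]]] := proj2 cov e; exists x; split=> //; exists c.
Qed.

(** A left inverse of [j] that forgets the combination of the [h i]. By [indep] it does not depend
    on the chosen solution, whence its linearity. *)
Let sol e : X := projT1 (cid (solve_ex e)).

Let solP e : `|sol e| <= K * `|e| /\ exists c, e = j (sol e) + \sum_(0 <= i < n) c i *: h i.
Proof. by rewrite /sol; case: cid. Qed.

Let sol_unique e x c : e = j x + \sum_(0 <= i < n) c i *: h i -> sol e = x.
Proof.
move=> eE; have [_ [d eE']] := solP e; apply/eqP; rewrite -subr_eq0; apply/eqP.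
apply: (indep (c := fun i => c i - d i)).
rewrite linearB /=; have -> : \sum_(0 <= i < n) (c i - d i) *: h i =
    \sum_(0 <= i < n) c i *: h i - \sum_(0 <= i < n) d i *: h i.
  by rewrite -sumrB; apply: eq_bigr => i _; rewrite scalerBl.
apply/eqP; rewrite subr_eq addrAC [_ + j x]addrC -eE; apply/eqP.
by rewrite {2}eE' addrK.
Qed.

Let sol_j x : sol (j x) = x.
Proof.
apply: (sol_unique (c := fun=> 0)).
by rewrite big1 ?addr0 // => i _; rewrite scale0r.
Qed.

Let j_below x : `|x| <= K * `|j x|.
Proof. by rewrite -{1}(sol_j x); exact: (proj1 (solP _)). Qed.

Let sol_linear : linear sol.
Proof.
move=> a e f; have [_ [c eE]] := solP e; have [_ [d fE]] := solP f.
apply: (sol_unique (c := fun i => a * c i + d i)).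
rewrite linearP {1}eE {1}fE scalerDr addrACA; congr (_ + _).
by rewrite scaler_sumr -big_split; apply: eq_bigr => i _; rewrite scalerDl scalerA.
Qed.

Let dual_dense : exists e, dense_seq [set: dual V] e.
Proof.
have [t dt] := @l1_dense_seq R.
have [u du] := dense_seq_prod dense_s dt.
pose J (w : X * l1 R) := j w.1 + \sum_(0 <= i < n) w.2 i *: h i.
have JL w w' : `|J w - J w'| <= (1 + \sum_(0 <= i < n) `|h i|) * `|w - w'|.
  have -> : J w - J w' = j (w - w').1 + \sum_(0 <= i < n) (w - w').2 i *: h i.
    rewrite /J opprD addrACA linearB; congr (_ + _).
    by rewrite -sumrB; apply: eq_bigr => i _; rewrite -scalerBl.
  have /prod_norm_le[w1 w2] := lexx `|w - w'|.
  apply: le_trans (ler_normD _ _) _; rewrite mulrDl mul1r; apply: lerD.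
    exact: le_trans (j_le _) w1.
  apply: le_trans (ler_norm_sum _ _ _) _; rewrite mulr_suml; apply: ler_sum => i _.
  rewrite normrZ mulrC; apply: ler_wpM2l => //.
  exact: le_trans (l1_coord_le _ _) w2.
exists (J \o u); have := dense_seq_image JL du; rewrite (_ : range J = setT) //.
apply/seteqP; split=> // e _; have [_ [c eE]] := solP e.
exists (sol e, \sum_(0 <= i < n) c i *: l1_basis i) => //.
rewrite [RHS]eE /J /=; congr (_ + _); apply: eq_big_nat => i /andP[_ i_n].
by rewrite l1_truncE i_n.
Qed.

Let ev i : V -> R := j (unit_vec i).

Let ev_le i v : `|ev i v| <= `|v|.
Proof.
apply: le_trans (dual_le _ _) _; rewrite -[leRHS]mul1r; apply: ler_wpM2r => //.
exact: le_trans (j_le _) (unit_vec_norm _).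
Qed.

Let evP i a x y : ev i (a *: x + y) = a * ev i x + ev i y.
Proof. exact: dual_linear. Qed.

Let ev0 i : ev i 0 = 0.
Proof. exact: linear0. Qed.

(** [V] has a separable dual, so it is the closed span of some vectors [v l]. The i-th pair is
    chosen by pigeonhole to agree within [1 / i.+1] at the first [i] of them; the vectors where the
    differences tend to 0 form a closed subspace containing all [v l]. *)
Let pairs_ex : exists P Q : nat -> nat,
  [/\ injective P, forall i k, P i <> Q k &
    forall v : V, (fun i => ev (P i) v - ev (Q i) v) @ \oo --> (0 : R)].
Proof.
have [e de] := dual_dense.
have [v [v1 vC]] := separable_dual_vectors de.
(* A state is a stage with its pair of indices. The new pair lies beyond the old one, so all the
   indices are distinct. *)
have step (p : nat * nat * nat) : exists q : nat * nat * nat,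
    [/\ q.1.1 = p.1.1.+1, (p.2 < q.1.2)%N, (q.1.2 < q.2)%N &
     forall l, (l < p.1.1)%N -> `|ev q.1.2 (v l) - ev q.2 (v l)| <= (p.1.1.+1%:R)^-1].
  have [|x [y [xN xy hxy]]] := @bounded_pigeonhole R (fun l n => ev n (v l)) p.1.1 p.1.1 p.2.+1.
    by move=> l m; exact: le_trans (ev_le _ _) (v1 l).
  by exists (p.1.1.+1, x, y).
have [next nextP] := choice step.
pose st i := iter i next (0, 0, 0)%N.
have st1 i : (st i).1.1 = i.
  by elim: i => //= i IH; have [-> _ _ _] := nextP (st i); rewrite IH.
pose P i := (st i.+1).1.2; pose Q i := (st i.+1).2.
have PQ i : (P i < Q i)%N by have [_ _ h3 _] := nextP (st i).
have QP i : (Q i < P i.+1)%N by have [_ h2 _ _] := nextP (st i.+1).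
have Pmono i k : (i < k)%N -> (Q i < P k)%N.
  elim: k => // k IH; rewrite ltnS leq_eqVlt => /predU1P[->//|/IH ik].
  exact: ltn_trans (ltn_trans ik (PQ k)) (QP k).
exists P, Q; split.
- move=> i k Pik; have [ik|ki|//] := ltngtP i k.
    by have := ltn_trans (PQ i) (Pmono _ _ ik); rewrite Pik ltnn.
  by have := ltn_trans (PQ k) (Pmono _ _ ki); rewrite Pik ltnn.
- move=> i k PiQk; have [ik|ki|E] := ltngtP i k.
  + have := ltn_trans (ltn_trans (PQ i) (Pmono _ _ ik)) (PQ k).
    by rewrite PiQk ltnn.
  + by have := Pmono _ _ ki; rewrite PiQk ltnn.
  + by have := PQ i; rewrite PiQk E ltnn.
pose C := [set v : V | (fun i => ev (P i) v - ev (Q i) v) @ \oo --> (0 : R)].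
suff CT : C = setT by move=> x; have : C x by rewrite CT.
apply: vC.
- apply/cvgn_leP => d d0; exists 0%N => k _.
  by rewrite !ev0 !subr0 normr0 ltW.
- move=> a x y /cvgn_leP Cx /cvgn_leP Cy; apply/cvgn_leP => d d0.
  have a0 : 0 < `|a| + 1 by rewrite ltr_wpDl.
  have d2 : 0 < d / 2 by rewrite divr_gt0.
  have [M hM] := Cx _ (divr_gt0 d2 a0); have [N hN] := Cy _ d2.
  exists (maxn M N) => k; rewrite geq_max => /andP[/hM hx /hN hy].
  have -> : ev (P k) (a *: x + y) - ev (Q k) (a *: x + y) - 0 =
    a * (ev (P k) x - ev (Q k) x - 0) + (ev (P k) y - ev (Q k) y - 0).
    by rewrite !evP !subr0 mulrBr opprD addrACA.
  apply: le_trans (ler_normD _ _) _; rewrite normrM [d]splitr; apply: lerD => //.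
  apply: le_trans (ler_wpM2r (normr_ge0 _) (_ : `|a| <= `|a| + 1)) _.
    by rewrite lerDl.
  by rewrite mulrC -ler_pdivlMr.
- apply/closure_id; apply/seteqP; split; first exact: subset_closure.
  move=> x /closure_leP cx; apply/cvgn_leP => d d0.
  have d4 : 0 < d / 4 by rewrite divr_gt0.
  have [y /cvgn_leP Cy yx] := cx _ d4; have [N hN] := Cy _ d4.
  exists N => k /hN; rewrite !subr0 => hk.
  have -> : ev (P k) x - ev (Q k) x = ev (P k) y - ev (Q k) y -
      (ev (P k) (y - x) - ev (Q k) (y - x)).
    have evB i : ev i (y - x) = ev i y - ev i x by exact: linearB.
    by rewrite !evB; ring.
  have := ler_normB (ev (P k) y - ev (Q k) y) (ev (P k) (y - x) - ev (Q k) (y - x)).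
  have := ler_normB (ev (P k) (y - x)) (ev (Q k) (y - x)).
  have := ev_le (P k) (y - x); have := ev_le (Q k) (y - x).
  lra.
- move=> m; apply/cvgn_leP => d d0.
  have [N hN] := exp_half_nat d0.
  exists (maxn m.+1 (2 ^ N)) => k; rewrite geq_max => /andP[mk Nk]; rewrite subr0.
  have [_ _ _ /(_ m)] := nextP (st k); rewrite st1 => /(_ mk) hk.
  apply: le_trans hk _; apply: le_trans hN.
  rewrite exprVn lef_pV2 ?posrE ?exprn_gt0 // -natrX ler_nat.
  exact: leq_trans Nk (leqnSn k).
Qed.

Let trunc (x : X) N : X := \sum_(0 <= i < N) x.1 i *: unit_vec i + (0, x.2).

Let trunc_prod x N : trunc x N = (\sum_(0 <= i < N) x.1 i *: l1_basis i, x.2).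
Proof.
rewrite /trunc (_ : \sum_(0 <= i < N) _ = (\sum_(0 <= i < N) x.1 i *: l1_basis i, 0)).
  by congr (_, _); rewrite /= ?addr0 ?add0r.
elim/big_rec2: _ => // i u w _ ->; congr (_, _).
by rewrite /= scaler0 add0r.
Qed.

Let trunc_le x N : `|trunc x N| <= `|x|.
Proof.
rewrite trunc_prod; apply/prod_norm_le; split; last exact: (@prod_snd_le R Z x).
apply: le_trans (@prod_fst_le R Z x); apply: l1_norm_le => M.
apply: le_trans (l1_norm_ge x.1 M); apply: ler_sum => i _.
by rewrite l1_truncE; case: ifP; rewrite ?normr0.
Qed.

Let trunc_comb (f : dual X) x N : f (trunc x N) =
  \sum_(0 <= i < N) f (unit_vec i) * x.1 i + f (0, x.2).
Proof.
rewrite /trunc linearD; congr (_ + _); rewrite linear_sum.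
by apply: eq_bigr => i _; rewrite linearZ; exact: mulrC.
Qed.

(* [P], [Q] select differences [d i = e_(P i) - e_(Q i)] of unit vectors that
   tend to 0 pointwise on [V], indexed by pairs [(k, l)]; [F k] sums the
   coordinates [P (k, l)] over [l]. Subtracting [F k y] times some late
   [d (k, l)] for each [k] moves [y] into the common kernel of the [F k] and
   hardly changes its value at [v]. *)
Lemma finite_codim_range_norming : has_separable_norming_subspace V.
Proof.
have [P [Q [Pinj PQ dv]]] := pairs_ex.
pose pr (k l : nat) : nat := choice.pickle (k, l).
have pr_inj k l k' l' : pr k l = pr k' l' -> k = k' /\ l = l'.
  by move=> /(pcan_inj choice.pickleK)[-> ->].
(* [own i] is the [k] whose functional [F k] counts the coordinate [i]. There is at most one, since
   [P] and the pairing are injective. *)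
have /choice[own ownP] : forall i, exists o : option nat,
    forall k, (o = Some k) <-> exists l, i = P (pr k l).
  move=> i; have [[k [l ikl]]|no] := pselect (exists k l, i = P (pr k l)).
    exists (Some k) => k'; split=> [[<-]|[l']]; first by exists l.
    by rewrite ikl => /Pinj/pr_inj[-> _].
  by exists None => k; split=> // -[l ikl]; case: no; exists k, l.
pose c k i : R := (own i == Some k)%:R.
have /choice[F FP] : forall k, exists f : dual X,
    (forall i, f (unit_vec i) = c k i) /\ forall z, f (0, z) = 0.
  move=> k; have [|f [_ f1 f2]] := @ex_linf_dual R Z (c k) 1.
    by move=> i; rewrite /c normr_nat lern1 leq_b1.
  exists f; split=> // z; apply/eqP; rewrite -normr_le0.
  by apply: le_trans (f2 _) _; rewrite normr0 mulr0.
pose d i := unit_vec (P i) - unit_vec (Q i) : X.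
have d_le i : `|d i| <= 2.
  apply: le_trans (ler_normB _ _) _.
  by have := @unit_vec_norm R Z (P i); have := @unit_vec_norm R Z (Q i); lra.
have Fd k k' l : F k (d (pr k' l)) = (k == k')%:R.
  rewrite linearB /= !(proj1 (FP k)) /c.
  have -> : own (P (pr k' l)) = Some k' by apply/ownP; exists l.
  rewrite (_ : (own (Q _) == _) = false); last first.
    by apply/eqP => /ownP[l' E]; exact: (PQ _ _ (esym E)).
  rewrite subr0; congr (_%:R : R); congr nat_of_bool.
  by apply/eqP/eqP => [[->]|->].
pose M : set (dual V) := [set f | exists2 x, f = j x & forall k, F k x = 0].
have M0 : M 0 by exists 0 => [|k]; rewrite linear0.
have ML a f g : M f -> M g -> M (a *: f + g).
  move=> [x -> xF] [y -> yF]; exists (a *: x + y) => [|k]; first by rewrite linearP.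
  by rewrite linearP /= xF yF addr0 scaler0.
have [N NM] := ex_submodClosed M0 ML.
exists N; rewrite NM; split.
- apply/closure_id; apply/seteqP; split; first exact: subset_closure.
  move=> f /closure_leP cf.
  (* Closedness: since [j] is bounded below, approximants with a geometric rate have preimages with
     a geometric rate, and these converge in [X] within the common kernel. *)
  have /choice[x xP] : forall k, exists x, [/\ forall i, F i x = 0 & `|j x - f| <= 2^-1 ^+ k].
    by move=> k; have [_ [x -> xF] xf] := cf _ (exp_half_gt0 k); exists x.
  have jxx k : `|j (x k.+1 - x k)| <= 2 * 2^-1 ^+ k.
    have [_ h1] := xP k; have [_] := xP k.+1; rewrite exprS => h2.
    have -> : j (x k.+1 - x k) = (j (x k.+1) - f) - (j (x k) - f).
      by rewrite linearB opprB addrA subrK.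
    have := ler_normB (j (x k.+1) - f) (j (x k) - f).
    by have := exp_half_gt0 (R := R) k; lra.
  have xx k : `|x k.+1 - x k| <= (K * 2) * 2^-1 ^+ k.
    by apply: le_trans (j_below _) _; rewrite -mulrA; apply: ler_wpM2l.
  have [l lP] := cX xx.
  have lx k : `|x 0%N + l - x k| <= 2 * (K * 2) * 2^-1 ^+ k.
    by have := lP k; rewrite telescope_sumr // opprB addrCA addrA.
  exists (x 0%N + l).
    apply/eqP; rewrite -subr_eq0 -normr_le0; apply/ler_addgt0Pr => e e0; rewrite add0r.
    have [k /(_ k (leqnn k))] := exp_half_small (1 + 2 * (K * 2)) e0.
    apply: le_trans; rewrite mulrDl mul1r.
    have -> : f - j (x 0%N + l) = - (j (x k) - f) - j (x 0%N + l - x k).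
      by rewrite [j (_ - _)]linearB !opprB addrA subrK.
    have [_ h1] := xP k.
    apply: le_trans (ler_normB _ _) _; rewrite normrN; apply: lerD => //.
    by apply: le_trans (j_le _) (lx k).
  move=> i; apply/eqP; rewrite -normr_le0; apply/ler_addgt0Pr => e e0; rewrite add0r.
  have [k /(_ k (leqnn k))] := exp_half_small (`|F i| * (2 * (K * 2))) e0.
  apply: le_trans; have -> : F i (x 0%N + l) = F i (x 0%N + l - x k).
    by have [xF _] := xP k; rewrite [RHS]linearB /= xF subr0.
  rewrite -mulrA; apply: le_trans (dual_le _ _) _.
  by apply: ler_wpM2l.
- have jL x y : `|j x - j y| <= 1 * `|x - y| by rewrite mul1r -linearB.
  have MA : M `<=` range j by move=> _ [x -> _]; exists x.
  have [t dt] := dense_seq_subset (dense_seq_image jL dense_s) MA (ex_intro _ 0 M0).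
  exact: dense_seq_separable dt.
(* The corrected vector [y'] has norm at most 1 + 2, and of the value 3/4 at least 1/2 survives the
   correction. *)
- apply: (@norming_intro _ _ _ 4^-1 3); rewrite ?invr_gt0 //.
    by move=> a f Mf; have := ML a f 0 Mf M0; rewrite addr0.
  move=> v; rewrite -normr_gt0 => v0.
  have v1 : 3 / 4 * `|v| < `|v| by lra.
  have [x [x1 jx]] := j_norming v1.
  have [| |psi psiE] := @ex_dual R X (fun x => j x v) `|v|.
  + by move=> a y z; rewrite linearP.
  + move=> y; apply: le_trans (dual_le _ _) _; rewrite mulrC.
    by apply: ler_wpM2l => //; exact: j_le.
  (* Truncation hardly changes the value at [v] and leaves only finitely many [F k] that are nonzero
     at [y], so that the correction is a finite sum. *)
  have [n0 hn0] : exists n0, 3 / 4 * `|v| <= `|psi (trunc x n0)|.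
    have e0 : 0 < `|j x v| - 3 / 4 * `|v| by lra.
    have /cvgn_leP/(_ _ e0)[n0 /(_ n0 (leqnn n0))] := @dual_l1_expand R Z psi x.
    rewrite -trunc_comb => h1; exists n0.
    have := lerB_dist (psi x) (psi (trunc x n0)); rewrite distrC.
    by rewrite !psiE in h1 *; lra.
  set y := trunc x n0 in hn0.
  have Fy k : F k y = \sum_(0 <= i < n0) c k i * x.1 i.
    rewrite trunc_comb (proj2 (FP k)) addr0.
    by apply: eq_bigr => i _; rewrite (proj1 (FP k)).
  pose m := (\max_(i < n0) odflt 0%N (own i)).+1.
  have Fy0 k : (m <= k)%N -> F k y = 0.
    move=> mk; rewrite Fy big_nat big1 // => i /andP[_ i_n].
    rewrite /c (_ : (own i == Some k) = false) ?mul0r //; apply/eqP => oi.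
    have := leq_bigmax (F := fun i : 'I_n0 => odflt 0%N (own i)) (Ordinal i_n).
    by rewrite /= oi /= leqNgt (leq_trans _ mk) // ltnS.
  (* The supports of the [F k] are disjoint, so these values add up to at most the l1 norm of
     [x.1]. *)
  have sumF : \sum_(0 <= k < m) `|F k y| <= 1.
    apply: (@le_trans _ _ (\sum_(0 <= k < m) \sum_(0 <= i < n0) c k i * `|x.1 i|)).
      apply: ler_sum => k _; rewrite Fy; apply: le_trans (ler_norm_sum _ _ _) _.
      by apply: ler_sum => i _; rewrite normrM /c normr_nat.
    rewrite exchange_big; apply: le_trans x1; apply: le_trans (@prod_fst_le R Z x).
    apply: le_trans (l1_norm_ge x.1 n0); apply: ler_sum => i _ /=.
    rewrite -mulr_suml -[leRHS]mul1r; apply: ler_wpM2r => //.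
    rewrite /c; case: (own i) => [k|]; last by rewrite big1.
    have [km|mk] := ltnP k m.
      rewrite (eq_bigr (fun a => 1 * (k == a)%:R)) => [|a _]; last by rewrite mul1r.
      by rewrite (sum_delta_mul (fun=> 1)).
    rewrite big_nat big1 // => a /andP[_ am].
    by rewrite (_ : (Some k == Some a) = false) //; apply/eqP => -[ka]; move: am; rewrite -ka ltnNge mk.
  have /choice[l lP] : forall k, exists l, `|j (d (pr k l)) v| <= 4^-1 * `|v|.
    move=> k; have v4 : 0 < 4^-1 * `|v| by lra.
    have /cvgn_leP/(_ _ v4)[i0 hi0] := dv v.
    have [l hl] : exists l, (i0 <= pr k l)%N.
      by apply: injective_unbounded => l l' /pr_inj[].
    exists l; have := hi0 _ hl; rewrite subr0; rewrite /d linearB; exact.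
  pose y' := y - \sum_(0 <= k < m) F k y *: d (pr k (l k)).
  have y'_le : `|y'| <= 3.
    apply: le_trans (ler_normB _ _) _.
    have h1 : `|y| <= 1 by exact: le_trans (trunc_le _ _) x1.
    suff : `|\sum_(0 <= k < m) F k y *: d (pr k (l k))| <= 2 by lra.
    apply: (@le_trans _ _ (\sum_(0 <= k < m) `|F k y| * 2)); last first.
      by rewrite -mulr_suml; lra.
    apply: le_trans (ler_norm_sum _ _ _) _; apply: ler_sum => k _.
    by rewrite normrZ; apply: ler_wpM2l.
  exists (j y').
    exists y' => // k; rewrite linearB /= dual_comb.
    have [km|mk] := ltnP k m.
      under eq_bigr => a _ do rewrite Fd.
      by rewrite (sum_delta_mul (fun k => F k y)) // subrr.
    rewrite Fy0 // sub0r big_nat big1 ?oppr0 // => a /andP[_ am].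
    by rewrite Fd gtn_eqF ?mulr0 // (leq_trans am mk).
  split; first exact: le_trans (j_le _) y'_le.
  have -> : j y' v = psi y - \sum_(0 <= k < m) F k y * j (d (pr k (l k))) v.
    rewrite -psiE linearB /= dual_comb; congr (_ - _).
    by apply: eq_bigr => k _; rewrite psiE.
  have h1 : `|\sum_(0 <= k < m) F k y * j (d (pr k (l k))) v| <= 4^-1 * `|v|.
    apply: (@le_trans _ _ (\sum_(0 <= k < m) `|F k y| * (4^-1 * `|v|))); last first.
      by rewrite -mulr_suml -[leRHS]mul1r; apply: ler_wpM2r => //; lra.
    apply: le_trans (ler_norm_sum _ _ _) _; apply: ler_sum => k _.
    by rewrite normrM; apply: ler_wpM2l.
  have := lerB_dist (psi y) (\sum_(0 <= k < m) F k y * j (d (pr k (l k))) v).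
  lra.
(* Through the left inverse [sol] the functionals [F k] become linear forms on [dual V] that vanish
   on [M]. *)
- apply: (@biorthogonal_infinite_codim _ _ _ (fun k => j (d (pr k 0%N)))
    (fun k f => F k (sol f))) => //.
  + by move=> k a f g; rewrite sol_linear linearP.
  + by move=> k _ [x -> xF]; rewrite sol_j.
  + by move=> i k; rewrite sol_j Fd.
Qed.

End FiniteCodimensionalRange.

(** * The converse for total subspaces *)

Section TotalSubspaces.
Context {R : realType} {Z : completeNormedModType R}.
Let X : normedModType R := (l1 R * Z)%type.

Lemma prod_l1_dense_seq : separable_set [set: Z] -> exists s, dense_seq [set: X] s.
Proof.
move=> /separable_dense_seq[|t dt]; first by exists 0.
have [u du] := @l1_dense_seq R; exact: dense_seq_prod du dt.
Qed.

(** Whether some finite system covers is decided once for all lengths; if none does,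
    [biorthogonal_extension] yields a new pair at every length, with any prescribed smallness. *)
Lemma total_has_separable_norming_subspace (Y : submodClosed (dual X)) :
  separable_set [set: Z] -> total_set [set` Y] ->
  has_separable_norming_subspace (subspace_type Y).
Proof.
move=> sepZ totY; have [s ds] := prod_l1_dense_seq sepZ.
pose V : normedModType R := subspace_type Y.
pose I : {linear V -> dual X} := \val.
have /choice[j jE] : forall x : X, exists f : dual V, forall v : V, f v = I v x.
  move=> x; apply: (@ex_dual R V (fun v => I v x) `|x|).
    by move=> a v w; rewrite linearP dualD dualZ.
  by move=> v; rewrite mulrC; exact: (dual_le (I v)).
have lj : linear j.
  by move=> a x y; apply: dual_ext => v; rewrite dualD dualZ !jE linearP.
pose J : {linear X -> dual V} := HB.pack j (GRing.isLinear.Build _ _ _ _ j lj).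
have J_le x : `|J x| <= `|x|.
  apply: dual_norm_le_mul => // v; rewrite mulrC.
  by have := dual_le (I v) x; rewrite -jE.
have J_inj x : J x = 0 -> x = 0.
  move=> Jx; apply/eqP; apply: contraT => x0; have [f Yf fx] := totY x x0.
  have := jE x (exist _ f Yf); rewrite -[j x]/(J x) Jx dual0 => fx0.
  have fE : I (exist _ f Yf) = f by [].
  by move: fx; rewrite -fE -fx0 eqxx.
have J_norming (v : V) c : c < `|v| -> exists x, `|x| <= 1 /\ c < `|J x v|.
  move=> cv; have [x [x1 vx]] := @dual_norm_attained R X (I v) c cv.
  by exists x; split=> //; rewrite /= jE.
have cX : geometric_complete X.
  by apply: prod_geometric_complete; exact: complete_geometric_complete.
pose P n (h : dual V) (F : dual (dual V)) :=
  forall x, `|h| * `|F (J x)| <= 8^-1 * 2^-1 ^+ n * `|x|.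
have [[n [h [K hK]]]|ncov] := pselect (exists n h K, covers J n h K).
  have [|n' [h' [K' [cov indep]]]] := minimal_cover J_inj; first by exists n, h, K.
  exact: (finite_codim_range_norming J_le J_norming ds cov indep).
have [n h F bhF _|h [F [bhF small]]] := @biorthogonal_sequence R (dual V) P.
  have e0 : 0 < 8^-1 * 2^-1 ^+ n :> R by rewrite mulr_gt0 ?invr_gt0 ?exp_half_gt0.
  have [|[K [K0 cov]]] := biorthogonal_extension J_le bhF e0 cX; first by [].
  by case: ncov; exists n, h, K.
exact: (perturbed_range_norming J_le J_norming ds bhF small).
Qed.

End TotalSubspaces.

(** * Well orders and fundamental sequences *)

Section WellOrders.
Implicit Type A : wellOrder.

Lemma wo_le_total A (a b : A) : wo_le a b || wo_le b a.
Proof.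
apply: (@wochoice.wo_chainW A (@wo_le A) predT) => //.
by move=> B _; exact: wo_leP.
Qed.

Lemma wo_le_refl A (a : A) : wo_le a a.
Proof. by have := wo_le_total a a; rewrite orbb. Qed.

Lemma wo_le_trans A (a b c : A) : wo_le a b -> wo_le b c -> wo_le a c.
Proof.
move=> ab bc; have [|z [[zP zmin] _]] := @wo_leP A (mem [:: a; b; c]).
  by exists a; rewrite !inE eqxx.
have za : wo_le z a by apply: zmin; rewrite !inE eqxx.
have zb : wo_le z b by apply: zmin; rewrite !inE eqxx orbT.
have zc : wo_le z c by apply: zmin; rewrite !inE eqxx !orbT.
move: zP; rewrite !inE => /or3P[/eqP zE|/eqP zE|/eqP zE]; rewrite zE in za zb zc.
- by [].
- by rewrite (@wo_le_anti A a b) ?ab.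
- by rewrite -(@wo_le_anti A b c) ?bc.
Qed.

Lemma wo_ltNge A (a b : A) : wo_lt a b <-> ~ wo_le b a.
Proof.
split=> [/andP[ab le_ab] le_ba|nba].
  by move: ab; rewrite (@wo_le_anti A a b) ?eqxx ?le_ab.
have := wo_le_total a b; rewrite (negbTE (introN idP nba)) orbF => ab.
by apply/andP; split => //; apply/eqP => E; apply: nba; rewrite E wo_le_refl.
Qed.

Lemma wo_leNgt A (a b : A) : wo_le a b <-> ~ wo_lt b a.
Proof.
split=> [ab /wo_ltNge//|nba]; apply/negPn/negP => nab.
by apply: nba; apply/wo_ltNge/negP.
Qed.

Lemma wo_lt_le A (a b : A) : wo_lt a b -> wo_le a b.
Proof. by case/andP. Qed.

Lemma wo_lt_le_trans A (a b c : A) : wo_lt a b -> wo_le b c -> wo_lt a c.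
Proof.
move=> ab bc; apply/wo_ltNge => ca; move/wo_ltNge: ab; apply.
exact: wo_le_trans bc ca.
Qed.

Lemma wo_lt_trans A (a b c : A) : wo_lt a b -> wo_lt b c -> wo_lt a c.
Proof. by move=> ab /wo_lt_le; exact: wo_lt_le_trans. Qed.

Lemma countable_osucc A : countable [set: A] -> countable [set: osucc A].
Proof.
move=> /countable_injP[f f_inj]; apply/countable_injP.
exists (fun o : osucc A => if o is Some a then (f a).+1 else 0%N).
move=> [a|] [b|] // _ _ [ab]; congr Some; apply: f_inj => //; exact: in_setT.
Qed.

(** Running maxima of an enumeration of the elements below [l]. Successors and limits are treated
    alike: at a successor the sequence is eventually the predecessor. The least element gets the
    constant sequence. *)
Lemma fundamental_sequences A : countable [set: A] ->
  exists fund : A -> nat -> A, forall l,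
    ((exists b, wo_lt b l) -> (forall k, wo_lt (fund l k) l) /\
      forall b, wo_lt b l -> exists K, forall k, (K <= k)%N -> wo_le b (fund l k)) /\
    ((forall b, ~ wo_lt b l) -> forall k, fund l k = l).
Proof.
move=> cA.
suff /choice[fund fundP] : forall l, exists g : nat -> A,
    ((exists b, wo_lt b l) -> (forall k, wo_lt (g k) l) /\
      forall b, wo_lt b l -> exists K, forall k, (K <= k)%N -> wo_le b (g k)) /\
    ((forall b, ~ wo_lt b l) -> forall k, g k = l) by exists fund.
move=> l; have [[b bl]|nb] := pselect (exists b, wo_lt b l); last first.
  by exists (fun=> l); split=> // -[b bl]; case: nb; exists b.
have cl : countable [set c | wo_lt c l].
  by apply: sub_countable cA; exact: subset_card_le.
have [s [sl s_onto]] := @countable_seq _ [set c | wo_lt c l] b bl cl.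
pose g := fix g k := if k is k'.+1 then
  if wo_le (g k') (s k) then s k else g k' else s 0%N.
have gl k : wo_lt (g k) l.
  by elim: k => [|k IH] /=; [exact: sl|case: ifP => _ //; exact: sl].
have g_mono k : wo_le (g k) (g k.+1).
  by rewrite /=; case: ifP => // _; exact: wo_le_refl.
have sg k : wo_le (s k) (g k).
  case: k => [|k] /=; first exact: wo_le_refl.
  case: ifP => [_|h]; first exact: wo_le_refl.
  by have := wo_le_total (g k) (s k.+1); rewrite h.
exists g; split; last by move/(_ b).
move=> _; split=> // c /s_onto[K <-]; exists K.
elim=> [|k IH]; first by rewrite leqn0 => /eqP <-; exact: sg.
rewrite leq_eqVlt => /predU1P[<-|/IH h]; first exact: sg.
exact: wo_le_trans h (g_mono k).
Qed.

End WellOrders.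

(** * Weak* sequential closures of transfinite order *)

Section SequentialClosures.
Context {R : realType} {V : normedModType R}.
Implicit Type M N : set (dual V).

Lemma wstar_seq_closure_incl M : M `<=` wstar_seq_closure M.
Proof. by move=> f Mf; exists (fun=> f) => // x; exact: cvg_cst. Qed.

Lemma wstar_seq_closure_sub M N : M `<=` N ->
  wstar_seq_closure M `<=` wstar_seq_closure N.
Proof. by move=> MN f [g Mg gf]; exists g => // n; exact: MN. Qed.

Lemma wstar_seq_closure_lin M :
  (forall a f g, M f -> M g -> M (a *: f + g)) ->
  forall a f g, wstar_seq_closure M f -> wstar_seq_closure M g ->
    wstar_seq_closure M (a *: f + g).
Proof.
move=> ML a f g [u Mu uf] [v Mv vg]; exists (fun n => a *: u n + v n).
  by move=> n; exact: ML.
move=> x; rewrite dualD dualZ; under eq_fun => n do rewrite dualD dualZ.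
by apply: (@cvgD _ R^o); [apply: (@cvgMr R); exact: uf|exact: vg].
Qed.

Section Transfinite.
Variable M : set (dual V).
Hypothesis M0 : M 0.
Hypothesis ML : forall a f g, M f -> M g -> M (a *: f + g).

Lemma wsc_recP (I : Type) (N : I -> set (dual V)) f :
  wsc_rec M N f <-> (~ inhabited I /\ M f) \/ exists i, wstar_seq_closure (N i) f.
Proof.
rewrite /wsc_rec; case: pselect => [iI|nI]; split.
- by move=> [i _ fi]; right; exists i.
- by move=> [[]//|[i fi]]; exists i.
- by move=> Mf; left.
- by move=> [[]//|[i _]]; case: nI; exists.
Qed.

Lemma wsc_ltP (A : wellOrder) (a : A) f : wsc_lt M a f <->
  ((forall b, ~ wo_lt b a) /\ M f) \/
  exists2 b, wo_lt b a & wstar_seq_closure (wsc_lt M b) f.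
Proof.
rewrite wsc_ltE; split=> [/wsc_recP[[na Mf]|[[b ba] fb]]|h].
- by left; split=> // b ba; apply: na; exists; exists b.
- by right; exists b.
apply/wsc_recP; move: h => [[nb Mf]|[b ba fb]].
- by left; split=> // -[[b ba]]; exact: nb ba.
- by right; exists (exist _ b ba).
Qed.

Lemma wsc_lt_step (A : wellOrder) (a b : A) : wo_lt b a ->
  wstar_seq_closure (wsc_lt M b) `<=` wsc_lt M a.
Proof. by move=> ba f fb; apply/wsc_ltP; right; exists b. Qed.

Lemma wsc_lt_mono (A : wellOrder) (a b : A) : wo_le b a -> wsc_lt M b `<=` wsc_lt M a.
Proof.
move=> ba f fb; have [ab|/wo_leNgt ab] := pselect (wo_lt b a).
  by apply: (wsc_lt_step ab); exact: wstar_seq_closure_incl.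
by rewrite -(@wo_le_anti A b a) // ba.
Qed.

Lemma wsc_lt_base (A : wellOrder) (a : A) : M `<=` wsc_lt M a.
Proof.
elim/(well_founded_ind (@wo_lt_wf A)): a => a IH f Mf; apply/wsc_ltP.
have [[b ba]|nb] := pselect (exists b, wo_lt b a).
  by right; exists b => //; apply: wstar_seq_closure_incl; exact: IH.
by left; split=> // b ba; apply: nb; exists b.
Qed.

Lemma wsc_lt_lin (A : wellOrder) (a : A) c f g :
  wsc_lt M a f -> wsc_lt M a g -> wsc_lt M a (c *: f + g).
Proof.
elim/(well_founded_ind (@wo_lt_wf A)): a => a IH in c f g *.
move=> /wsc_ltP[[na Mf]|[b ba fb]] /wsc_ltP[[na' Mg]|[b' ba' gb']].
- by apply/wsc_ltP; left; split => //; exact: ML.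
- by case: (na b').
- by case: (na' b).
have [d [da bd b'd]] : exists d : A, [/\ wo_lt d a, wo_le b d & wo_le b' d].
  by have /orP[h|h] := wo_le_total b b'; [exists b'|exists b]; split=> //; exact: wo_le_refl.
apply: (wsc_lt_step da); apply: wstar_seq_closure_lin.
- by move=> e u v; exact: IH.
- exact: wstar_seq_closure_sub (wsc_lt_mono bd) _ fb.
- exact: wstar_seq_closure_sub (wsc_lt_mono b'd) _ gb'.
Qed.

Lemma wsc_lt_osucc (A : wellOrder) (a : A) :
  wsc_lt M a = wsc_lt M (Some a : osucc A).
Proof.
elim/(well_founded_ind (@wo_lt_wf A)): a => a IH; apply/seteqP; split=> f /wsc_ltP h.
  apply/wsc_ltP; move: h => [[na Mf]|[b ba fb]].
    by left; split=> // -[b|//] ba; exact: na ba.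
  by right; exists (Some b) => //; rewrite -IH.
apply/wsc_ltP; move: h => [[na Mf]|[[b|//] ba fb]].
  by left; split=> // b ba; exact: (na (Some b) ba).
by right; exists b => //; rewrite IH.
Qed.

(** The order type below the top of [osucc A] is that of [A]. This places the closure of order [A]
    in the same indexed family as all smaller ones, so that induction on labels reaches it. *)
Lemma wsc_osucc_top (A : wellOrder) : wsc M A = wsc_lt M (None : osucc A).
Proof.
apply/seteqP; split=> f h.
  apply/wsc_ltP; move: h => /wsc_recP[[na Mf]|[a fa]].
    by left; split=> // -[b|//] _; apply: na; exists.
  by right; exists (Some a) => //; rewrite -wsc_lt_osucc.
apply/wsc_recP; move: h => /wsc_ltP[[na Mf]|[[b|//] _ fb]].
  by left; split=> // -[a]; exact: (na (Some a) isT).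
by right; exists b; rewrite wsc_lt_osucc.
Qed.

Lemma wsc_osucc_incl (A : wellOrder) :
  wstar_seq_closure (wsc M A) `<=` wsc M (osucc A).
Proof.
by move=> f; rewrite wsc_osucc_top => h; apply/wsc_recP; right; exists None.
Qed.

End Transfinite.
End SequentialClosures.

(** * Helly's theorem for countably many functionals *)

Section Helly.
Context {R : realType} {V : normedModType R}.

(* If the point [(G (f i))_i] were at positive distance from the convex set
   [{(f i v)_i : |v| <= C}], the direction of an almost nearest point would
   define a functional [g] with [C |g| < G g]. *)
Lemma helly_approx (G : dual (dual V)) (n : nat) (f : nat -> dual V) (e : R) :
  0 < e -> exists v, `|v| <= `|G| + 1 /\
    forall i, (i < n)%N -> `|f i v - G (f i)| <= e.
Proof.
move=> e0; have C_gt0 : 0 < `|G| + 1 by rewrite ltr_wpDl.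
have GC : `|G| <= `|G| + 1 by rewrite lerDl.
set C := `|G| + 1 in C_gt0 GC *; clearbody C.
pose D v := \sum_(0 <= i < n) (G (f i) - f i v) ^+ 2.
have D0 v : 0 <= D v by apply: sumr_ge0 => i _; exact: sqr_ge0.
have [[v [vC Dv]]|far] := pselect (exists v, `|v| <= C /\ D v <= e ^+ 2).
  exists v; split=> // i i_n; rewrite distrC.
  have : `|G (f i) - f i v| ^+ 2 <= e ^+ 2.
    rewrite real_normK ?num_real //; apply: le_trans Dv.
    exact: (le_sum_nonneg (fun k => sqr_ge0 (G (f k) - f k v)) i_n).
  by rewrite ler_pXn2r ?nnegrE ?normr_ge0 ?(ltW e0).
pose S := [set D v | v in [set v | `|v| <= C]].
have infS : has_inf S.
  split; first by exists (D 0), 0 => //=; rewrite normr0 ltW.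
  by exists 0 => _ [v _ <-].
pose d := inf S.
have d_gt0 : 0 < d.
  apply: (@lt_le_trans _ _ (e ^+ 2)); first by rewrite exprn_gt0.
  apply: lb_le_inf; first exact: (proj1 infS).
  by move=> _ [v /= vC <-]; rewrite leNgt; apply/negP => /ltW h; apply: far; exists v.
have d_le v : `|v| <= C -> d <= D v.
  by move=> vC; apply: ge_inf; [exact: (proj2 infS)|exists v].
pose B := \sum_(0 <= i < n) (`|f i| * (2 * C)) ^+ 2.
have B0 : 0 <= B by apply: sumr_ge0 => i _; exact: sqr_ge0.
(* A step of length [t] from an almost minimal [v] towards [w] changes [D] by at most
   [- 2 t (g w - g v) + t^2 B]. Since [t * B <= d / 2] and [v] is within [t d / 2] of the infimum,
   [g w - g v] cannot exceed [d / 2]. *)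
pose t := d / (2 * (B + d)).
have Bd : 0 < 2 * (B + d) by lra.
have t_gt0 : 0 < t by rewrite divr_gt0.
have tB : t * (B + d) = d / 2.
  by rewrite /t; field; apply/eqP; lra.
have t1 : t <= 1 by rewrite /t ler_pdivrMr //; lra.
have td : 0 < t * d by exact: mulr_gt0.
clearbody t.
have [v vC Dv] : exists2 v, `|v| <= C & D v < d + t * d / 2.
  have [_ [v vC <-] h] : exists2 y, S y & y < d + t * d / 2.
    by apply: inf_lt; [exact: (proj1 infS)|rewrite -/d; lra].
  by exists v.
pose g : dual V := \sum_(0 <= i < n) (G (f i) - f i v) *: f i.
have g_le w : `|w| <= C -> g w - g v <= d / 2.
  move=> wC; pose u := v + t *: (w - v).
  have uC : `|u| <= C.
    have -> : u = (1 - t) *: v + t *: w.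
      by rewrite /u scalerBr scalerBl scale1r addrAC addrA.
    apply: le_trans (ler_normD _ _) _; rewrite !normrZ.
    have t0' : 0 <= 1 - t by lra.
    rewrite (ger0_norm t0') (ger0_norm (ltW t_gt0)).
    have h1 : (1 - t) * `|v| <= (1 - t) * C by apply: ler_wpM2l => //; lra.
    have h2 : t * `|w| <= t * C by apply: ler_wpM2l => //; lra.
    lra.
  have Du : D u = D v - 2 * t * (g w - g v) +
      t ^+ 2 * \sum_(0 <= i < n) (f i (w - v)) ^+ 2.
    have -> : g w - g v = \sum_(0 <= i < n) (G (f i) - f i v) * f i (w - v).
      rewrite !dual_sum -sumrB; apply: eq_bigr => i _.
      by rewrite !dualZ -mulrBr -linearB.
    rewrite /D !mulr_sumr -sumrN -!big_split; apply: eq_bigr => i _ /=.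
    have -> : f i u = f i v + t * f i (w - v) by rewrite /u linearD linearZ.
    by ring.
  have sB : \sum_(0 <= i < n) (f i (w - v)) ^+ 2 <= B.
    apply: ler_sum => i _; rewrite -(real_normK (num_real (f i (w - v)))).
    rewrite ler_pXn2r ?nnegrE ?mulr_ge0 //; last lra.
    apply: le_trans (dual_le _ _) _; apply: ler_wpM2l => //.
    by apply: le_trans (ler_normB _ _) _; lra.
  have := d_le u uC; rewrite Du => h.
  have h2 : t ^+ 2 * \sum_(0 <= i < n) (f i (w - v)) ^+ 2 <= t * (t * B).
    by rewrite mulrA -expr2; apply: ler_wpM2l => //; exact: sqr_ge0.
  have h3 : t * (2 * (g w - g v)) < t * (d / 2 + t * B).
    by lra.
  by move: h3; rewrite ltr_pM2l //; lra.
have Gg : G g - g v = D v.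
  have -> : G g = \sum_(0 <= i < n) (G (f i) - f i v) * G (f i).
    by rewrite /g (dual_comb G (fun i => G (f i) - f i v)).
  rewrite /g dual_sum -sumrB; apply: eq_bigr => i _.
  by rewrite dualZ; ring.
(* The ball of radius [C] is symmetric, so the one-sided bound on [g] there bounds its norm. As
   [G g] is at least [g v + d], this contradicts the choice of [C]. *)
have Cg : C * `|g| <= g v + d / 2.
  have gv0 : 0 <= g v + d / 2.
    by have := g_le 0 _; rewrite normr0 linear0 => /(_ (ltW C_gt0)); lra.
  rewrite mulrC -ler_pdivlMr //; apply: dual_norm_le => w w1.
  rewrite ler_pdivlMr // mulrC.
  have wC a : `|a| <= 1 -> `|(a * C) *: w| <= C.
    move=> a1; rewrite normrZ normrM (ger0_norm (ltW C_gt0)).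
    have := ler_pM (normr_ge0 _) (normr_ge0 _) a1 w1; rewrite mul1r => h.
    apply: (@le_trans _ _ (1 * C)); last by rewrite mul1r.
    by rewrite mulrAC; apply: ler_wpM2r => //; exact: ltW.
  have [gw|gw] := leP 0 (g w).
    have := g_le _ (wC 1 _); rewrite normr1 => /(_ (lexx _)).
    by rewrite linearZ mul1r /=; rewrite ger0_norm // => h; have := h; rewrite /GRing.scale /=; lra.
  have := g_le _ (wC (-1) _); rewrite normrN1 => /(_ (lexx _)).
  by rewrite linearZ mulN1r /=; rewrite ltr0_norm // /GRing.scale /=; lra.
have : G g <= C * `|g|.
  apply: le_trans (ler_norm _) _; apply: le_trans (dual_le _ _) _.
  exact: ler_wpM2r.
by have := d_le v vC; lra.
Qed.

Lemma goldstine_sequence (G : dual (dual V)) (f : nat -> dual V) :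
  exists y : nat -> V, (forall k, `|y k| <= `|G| + 1) /\
    forall i, (fun k => f i (y k) : R) @ \oo --> (G (f i) : R).
Proof.
have /choice[y yP] : forall k, exists v, `|v| <= `|G| + 1 /\
    forall i, (i < k)%N -> `|f i v - G (f i)| <= 2^-1 ^+ k.
  by move=> k; apply: helly_approx; exact: exp_half_gt0.
exists y; split=> [k|i]; first exact: (proj1 (yP k)).
apply/cvgn_leP => e e0; have [N hN] := exp_half_small 1 e0.
exists (maxn N i.+1) => k; rewrite geq_max => /andP[/hN Nk ik].
by apply: le_trans (proj2 (yP k) i ik) _; rewrite mul1r in Nk.
Qed.

End Helly.

(** * A weak* sequentially dense sequence in the dual of a separable space *)

Section WeakStarDensity.
Context {R : realType}.

Lemma bounded_dense_cvg (V : normedModType R) (g : nat -> dual V) (f : dual V)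
    (s : nat -> V) (C : R) : (forall k, `|g k| <= C) -> dense_seq [set: V] s ->
  (forall m, (fun k => g k (s m) : R) @ \oo --> (f (s m) : R)) ->
  forall x, (fun k => g k x : R) @ \oo --> (f x : R).
Proof.
move=> gC [_ ds] gs x; apply/cvgn_leP => e e0.
pose D := `|C| + `|f| + 1.
have D0 : 0 < D by rewrite /D; have := normr_ge0 C; have := normr_ge0 f; lra.
have e2 : 0 < e / 2 by rewrite divr_gt0.
have [m hm] := ds x I _ (divr_gt0 e2 D0).
have /cvgn_leP/(_ _ e2)[N hN] := gs m; exists N => k /hN hk.
have -> : g k x - f x = g k (s m) - f (s m) - (g k - f) (s m - x).
  rewrite dualB; have -> : g k (s m - x) = g k (s m) - g k x by exact: linearB.
  have -> : f (s m - x) = f (s m) - f x by exact: linearB.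
  by ring.
apply: le_trans (ler_normB _ _) _; rewrite [e]splitr; apply: lerD => //.
apply: le_trans (dual_le _ _) _.
apply: (@le_trans _ _ (D * `|s m - x|)); last by move: hm; rewrite ler_pdivlMr // mulrC.
apply: ler_wpM2r => //; apply: le_trans (ler_normB _ _) _.
have := gC k; have := ler_norm C; rewrite /D; lra.
Qed.

(** A cell prescribes an integer bound on the norm and rational approximate values at finitely many
    points of a dense sequence. There are countably many cells, and one functional is chosen in each
    nonempty one; the bound on the norm turns convergence on the dense sequence into convergence
    everywhere. *)
Lemma weakstar_dense_sequence (V : normedModType R) : separable_set [set: V] ->
  exists b : nat -> dual V, forall psi : dual V, exists d : nat -> nat,
    forall x, (fun k => b (d k) x : R) @ \oo --> (psi x : R).
Proof.
move=> /separable_dense_seq[|s ds]; first by exists 0.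
pose cell (t : nat * nat * seq rat) (psi : dual V) := `|psi| <= t.1.1%:R /\
  forall m, (m < t.1.2)%N -> `|psi (s m) - ratr (nth 0 t.2 m)| <= 2^-1 ^+ t.1.2.
have /choice[b bP] : forall t, exists g, (exists psi, cell t psi) -> cell t g.
  move=> t; have [[psi h]|no] := pselect (exists psi, cell t psi); first by exists psi.
  by exists 0.
exists (fun n => b (odflt (0%N, 0%N, [::]) (choice.unpickle n))) => psi.
have [r hr] : exists r : nat, `|psi| <= r%:R.
  by exists (Num.truncn `|psi|).+1; rewrite ltW // truncnS_gt.
have /choice[q qP] : forall p : nat * nat, exists q : rat,
    `|psi (s p.2) - ratr q| <= 2^-1 ^+ p.1.
  move=> p; have := exp_half_gt0 (R := R) p.1; set d := _ ^+ _ => d0.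
  have /rat_in_itvoo[q] : psi (s p.2) - d < psi (s p.2) + d by lra.
  rewrite in_itv /= => /andP[q1 q2]; exists q; rewrite ler_norml.
  by apply/andP; split; lra.
pose t k := (r, k, mkseq (fun m => q (k, m)) k).
have ht k : cell (t k) (b (t k)).
  apply: bP; exists psi; split=> //= m mk; rewrite nth_mkseq //.
  exact: (qP (k, m)).
exists (fun k => choice.pickle (t k)).
apply: (@bounded_dense_cvg _ _ _ s r%:R _ ds) => [k|m].
  by rewrite choice.pickleK; exact: (proj1 (ht k)).
apply/cvgn_leP => e e0; have [N hN] := exp_half_small 2 e0.
exists (maxn N m.+1) => k; rewrite geq_max => /andP[/hN h mk].
rewrite choice.pickleK /=; apply: le_trans h.
have [_ /(_ m mk)] := ht k; rewrite /= nth_mkseq // => h1.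
have h2 := qP (k, m); move: h1 h2 => /=; set c := ratr _ => h1 h2.
have -> : b (t k) (s m) - psi (s m) = (b (t k) (s m) - c) - (psi (s m) - c) by ring.
by apply: le_trans (ler_normB _ _) _; lra.
Qed.

End WeakStarDensity.

(** * A biorthogonal system annihilating a closed subspace *)

Section Annihilators.
Context {R : realType} {E : normedModType R} (U : submodClosed E).

Lemma biorthogonal_annihilating : closed [set` U] -> ~ finite_codim [set` U] ->
  exists (w : nat -> E) (G : nat -> dual E),
    (forall i k, G i (w k) = (i == k)%:R) /\
    forall n u, [set` U] u -> G n u = 0.
Proof.
move=> clU infU.
have U0 : [set` U] 0 by exact: rpred0.
have UL a x y : [set` U] x -> [set` U] y -> [set` U] (a *: x + y).
  by move=> /= Ux Uy; rewrite rpredD // rpredZ.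
apply: (@biorthogonal_sequence R E (fun _ _ F => forall u, [set` U] u -> F u = 0)).
move=> n h F bhF FU.
pose proj x := x - \sum_(0 <= i < n) F i x *: h i.
have projL a x y : proj (a *: x + y) = a *: proj x + proj y.
  rewrite /proj scalerBr addrACA -opprD; congr (_ - _).
  rewrite scaler_sumr -big_split; apply: eq_bigr => i _.
  by rewrite linearP scalerDl scalerA.
have projU u : [set` U] u -> proj u = u.
  move=> Uu; rewrite /proj big_nat big1 ?subr0 // => i /andP[_ i_n].
  by rewrite FU // scale0r.
have projh k : (k < n)%N -> proj (h k) = 0.
  move=> kn; rewrite /proj (_ : \sum_(0 <= i < n) _ = h k) ?subrr //.
  rewrite -[RHS](sum_delta_scale h kn); apply: eq_big_nat => i /andP[_ i_n].
  by rewrite bhF.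
have F_proj k x : (k < n)%N -> F k (proj x) = 0.
  move=> kn; rewrite linearB /= (dual_comb _ (fun i => F i x)).
  rewrite -[X in X - _](sum_delta_mul (fun i => F i x) kn) -sumrB big_nat big1 // => i /andP[_ i_n].
  by rewrite bhF // subrr.
(* This is the sum of [U] and the span of the [h i]. It is closed because [proj] is bounded, and
   proper because [U] has infinite codimension, so a functional vanishing on it exists. *)
pose C := [set x | [set` U] (proj x)].
have C0 : C 0 by rewrite /C /= projU.
have CL a x y : C x -> C y -> C (a *: x + y).
  by move=> Cx Cy; rewrite /C /= projL; exact: UL.
pose K := 1 + \sum_(0 <= i < n) `|F i| * `|h i|.
have K_gt0 : 0 < K by rewrite ltr_pwDl // sumr_ge0 // => i _; exact: mulr_ge0.
have proj_le x : `|proj x| <= K * `|x|.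
  apply: le_trans (ler_normB _ _) _; rewrite mulrDl mul1r lerD2l mulr_suml.
  apply: le_trans (ler_norm_sum _ _ _) _; apply: ler_sum => i _.
  by rewrite normrZ mulrAC; apply: ler_wpM2r => //; exact: dual_le.
have clC : closed C.
  apply/closure_id; apply/seteqP; split; first exact: subset_closure.
  move=> x /closure_leP cx; apply: clU; apply/closure_leP => e e0.
  have [y Cy yx] := cx _ (divr_gt0 e0 K_gt0); exists (proj y); first exact: Cy.
  have -> : proj y - proj x = proj (y - x).
    by have := projL (-1) x y; rewrite !scaleN1r ![- _ + _]addrC => ->.
  by apply: le_trans (proj_le _) _; move: yx; rewrite ler_pdivlMr // mulrC.
have [w nCw] : exists w, ~ C w.
  apply: contrapT => all_C; apply: infU; exists n, (fun i => h i) => x.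
  exists (fun i => F i x); apply: contrapT => nx; apply: all_C; exists x.
  by rewrite /C /= /proj big_mkord.
have [f [fw fC]] := closed_subspace_functional C0 CL clC nCw.
have fh i : (i < n)%N -> f (h i) = 0.
  by move=> i_n; apply: fC; rewrite /C /= projh.
exists (proj w), f; split=> //.
- by move=> i; exact: F_proj.
- rewrite linearB /= (dual_comb _ (fun i => F i w)) big_nat big1 ?subr0 // => i /andP[_ i_n].
  by rewrite fh // mulr0.
- by move=> u Uu; apply: fC; rewrite /C /= projU.
Qed.

End Annihilators.

(** * Dominated convergence for series *)

Section Tannery.
Context {R : realType}.

Lemma cvgn_sum (a : nat -> nat -> R) (l : nat -> R) N :
  (forall j, (fun k => a k j) @ \oo --> l j) ->
  (fun k => \sum_(0 <= j < N) a k j) @ \oo --> \sum_(0 <= j < N) l j.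
Proof.
move=> al; elim: N => [|N IH].
  rewrite big_geq //; under eq_fun => k do rewrite big_geq //.
  exact: cvg_cst.
rewrite big_nat_recr //=; under eq_fun => k do rewrite big_nat_recr //=.
by apply: (@cvgD _ R^o).
Qed.

Lemma dominated_series_cvg (a : nat -> nat -> R) (b l S : nat -> R) (L B : R) :
  (forall k j, `|a k j| <= b j) -> (forall N, \sum_(0 <= j < N) b j <= B) ->
  (forall j, (fun k => a k j) @ \oo --> l j) ->
  (forall k, (fun N => \sum_(0 <= j < N) a k j) @ \oo --> S k) ->
  (fun N => \sum_(0 <= j < N) l j) @ \oo --> L ->
  S @ \oo --> L.
Proof.
move=> ab bB al aS lL; apply/cvgn_leP => e e0.
have b0 j : 0 <= b j by exact: le_trans (ab 0%N j).
have [beta bb] : exists beta : R, (fun N => \sum_(0 <= j < N) b j) @ \oo --> beta.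
  apply: (@abs_series_cvg R b B) => N.
  by under eq_bigr => j _ do rewrite ger0_norm //.
have e8 : 0 < e / 8 by rewrite divr_gt0.
have /cvgn_leP/(_ _ e8)[N1 h1] := bb; have /cvgn_leP/(_ _ e8)[N2 h2] := lL.
pose N := maxn N1 N2.
have tail k : `|S k - \sum_(0 <= j < N) a k j| <= e / 4.
  apply: (cvgn_dist_le (N := N) (aS k)) => M NM.
  rewrite (big_cat_nat (leq0n N) NM) /= [X in X - _]addrC addrK.
  apply: le_trans (ler_norm_sum _ _ _) _.
  apply: (@le_trans _ _ (\sum_(N <= j < M) b j)); first exact: ler_sum.
  have := h1 N (leq_maxl _ _); have := h1 M (leq_trans (leq_maxl _ _) NM).
  rewrite (big_cat_nat (leq0n N) NM) /= !ler_norml => /andP[_ p1] /andP[p2 _].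
  lra.
have /cvgn_leP/(_ _ e8)[K hK] := @cvgn_sum a l N al; exists K => k /hK hk.
have -> : S k - L = (S k - \sum_(0 <= j < N) a k j) +
    (\sum_(0 <= j < N) a k j - \sum_(0 <= j < N) l j) + (\sum_(0 <= j < N) l j - L) by ring.
apply: le_trans (ler_normD _ _) _.
have := ler_normD (S k - \sum_(0 <= j < N) a k j)
  (\sum_(0 <= j < N) a k j - \sum_(0 <= j < N) l j).
have := tail k; have := h2 N (leq_maxr _ _); lra.
Qed.

End Tannery.

(** * The embedding attached to a sequence of functionals *)

Section Embedding.
Context {R : realType} {Z V : normedModType R}.
Let X : normedModType R := (l1 R * Z)%type.
Variables (u w : nat -> dual V) (phi : nat -> dual X) (c : R).
Hypothesis c0 : 0 < c.
Hypothesis u_le : forall m, `|u m| <= 2.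
Hypothesis u_norming : forall y, y != 0 -> exists m, c * `|y| <= `|u m y|.

(** Chosen so that the [phi] part of the operator has norm at most [c / 2], half of what the [u m]
    provide from below. The added ones keep the denominator positive. *)
Definition weight m : R :=
  c / 4 * 2^-1 ^+ m / ((1 + `|w m|) * (1 + `|phi m|)).

Lemma weight_gt0 m : 0 < weight m.
Proof.
have h1 : 0 < 1 + `|w m| by have := normr_ge0 (w m); lra.
have h2 : 0 < 1 + `|phi m| by have := normr_ge0 (phi m); lra.
apply: divr_gt0; last exact: mulr_gt0.
by apply: mulr_gt0 (exp_half_gt0 m); rewrite divr_gt0.
Qed.

Lemma weight_le m y x : `|weight m * w m y * phi m x| <= c / 4 * 2^-1 ^+ m * `|y| * `|x|.
Proof.
have hw : 0 < 1 + `|w m| by have := normr_ge0 (w m); lra.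
have hp : 0 < 1 + `|phi m| by have := normr_ge0 (phi m); lra.
rewrite -mulrA normrM (gtr0_norm (weight_gt0 m)) normrM.
have h1 : `|w m y| <= (1 + `|w m|) * `|y|.
  by apply: le_trans (dual_le _ _) _; apply: ler_wpM2r => //; rewrite lerDr.
have h2 : `|phi m x| <= (1 + `|phi m|) * `|x|.
  by apply: le_trans (dual_le _ _) _; apply: ler_wpM2r => //; rewrite lerDr.
have := ler_pM (normr_ge0 _) (normr_ge0 _) h1 h2.
move/(ler_wpM2l (ltW (weight_gt0 m))); move=> /le_trans; apply.
rewrite /weight le_eqVlt; apply/orP; left; apply/eqP.
by field; apply/andP; split; apply/eqP; lra.
Qed.

Let term y m : dual X := u m y *: coord m.*2 + (weight m * w m y) *: phi m.

Let termE y m x : term y m x = u m y * x.1 m.*2 + weight m * w m y * phi m x.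
Proof. by rewrite /term dualD !dualZ coordE. Qed.

Let phi_sum_le y x N :
  \sum_(0 <= m < N) `|weight m * w m y * phi m x| <= c / 2 * `|y| * `|x|.
Proof.
apply: (@le_trans _ _ (\sum_(0 <= m < N) 2^-1 ^+ m * (c / 4 * `|y| * `|x|))).
  apply: ler_sum => m _; apply: le_trans (weight_le m y x) _.
  by rewrite le_eqVlt; apply/orP; left; apply/eqP; ring.
rewrite -mulr_suml.
have h : 0 <= c / 4 * `|y| * `|x| by rewrite !mulr_ge0 ?invr_ge0 ?(ltW c0).
by have := ler_wpM2r h (@sum_exp_half_le R N); lra.
Qed.

Let even_sum_le (x : X) N : \sum_(0 <= m < N) `|x.1 m.*2| <= `|x|.
Proof.
apply: le_trans (prod_fst_le x).
by apply: (l1_injective_sum_le _ (s := double)) => a b /double_inj.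
Qed.

Let term_sum_le y x N : \sum_(0 <= m < N) `|term y m x| <= (2 + c / 2) * `|y| * `|x|.
Proof.
apply: (@le_trans _ _ (\sum_(0 <= m < N) (`|x.1 m.*2| * (2 * `|y|)) +
    \sum_(0 <= m < N) `|weight m * w m y * phi m x|)).
  rewrite -big_split; apply: ler_sum => m _; rewrite termE.
  apply: le_trans (ler_normD _ _) _; apply: lerD => //.
  rewrite normrM mulrC; apply: ler_wpM2l => //; apply: le_trans (dual_le _ _) _.
  exact: ler_wpM2r.
rewrite -mulr_suml.
have y0 : 0 <= 2 * `|y| by rewrite mulr_ge0.
have := ler_wpM2r y0 (even_sum_le x N); have := phi_sum_le y x N; lra.
Qed.

Let T_ex y : exists g : dual X,
  (forall x, (fun N => \sum_(0 <= m < N) term y m x : R) @ \oo --> (g x : R)) /\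
  forall x, `|g x| <= (2 + c / 2) * `|y| * `|x|.
Proof. exact: ex_dual_series (term_sum_le y). Qed.

Let T y : dual X := projT1 (cid (T_ex y)).

Let T_cvg y x : (fun N => \sum_(0 <= m < N) term y m x : R) @ \oo --> (T y x : R).
Proof. by rewrite /T; case: cid => g [gl gb]; exact: gl. Qed.

Let T_le y x : `|T y x| <= (2 + c / 2) * `|y| * `|x|.
Proof. by rewrite /T; case: cid => g [gl gb]; exact: gb. Qed.

Let T_linear : linear T.
Proof.
move=> a y z; apply: dual_ext => x; rewrite dualD dualZ.
apply: (@cvgn_unique R _ _ _ (@T_cvg (a *: y + z) x)).
rewrite (_ : (fun N => _) = (fun N => a * \sum_(0 <= m < N) term y m x +
    \sum_(0 <= m < N) term z m x)).
  by apply: (@cvgD _ R^o); [apply: (@cvgMr R)|]; exact: T_cvg.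
apply/funext => N; rewrite mulr_sumr -big_split; apply: eq_bigr => m _.
transitivity (a * term y m x + term z m x); last by [].
have lin_r (f : dual V) : f (a *: y + z) = a * f y + f z by exact: dual_linear.
by rewrite !termE !lin_r; ring.
Qed.

(** The lower bound comes from the even unit vectors, where the [u m] are read off. On odd ones only
    the [phi] part is seen, with a tail uniform in the coordinate. For the last clause, the images
    of [y k] divided by the weight tend to [phi m] term by term, and dominated convergence
    applies. *)
Lemma ex_embedding : exists T : {linear V -> dual X},
  [/\ forall y, `|T y| <= (2 + c / 2) * `|y|,
      forall y, c / 2 * `|y| <= `|T y|,
      forall y i N, odd i ->
        `|T y (unit_vec i) - \sum_(0 <= m < N) weight m * w m y * phi m (unit_vec i)|
          <= c / 2 * 2^-1 ^+ N * `|y| &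
      forall (y : nat -> V) (B : R) m, (forall k, `|y k| <= B) ->
        (forall j, (fun k => u j (y k) : R) @ \oo --> (0 : R)) ->
        (forall j, (fun k => w j (y k) : R) @ \oo --> ((m == j)%:R : R)) ->
        wstar_seq_closure (range T) (phi m)].
Proof.
pose T' : {linear V -> dual X} := HB.pack T (GRing.isLinear.Build _ _ _ _ T T_linear).
exists T'; split.
- move=> y; apply: dual_norm_le_mul; last exact: T_le.
  by apply: mulr_ge0 => //; have := ltW c0; lra.
- move=> y; have [->|y0] := eqVneq y 0; first by rewrite normr0 mulr0.
  have [m hm] := u_norming y0.
  have x1 := @unit_vec_norm R Z m.*2.
  have Tm : `|T y (unit_vec m.*2)| <= `|T y|.
    apply: le_trans (dual_le _ _) _; rewrite -[leRHS]mulr1; exact: ler_wpM2l.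
  rewrite -[T' y]/(T y); apply: le_trans Tm.
  suff h : `|T y (unit_vec m.*2) - u m y| <= c / 2 * `|y|.
    have := lerB_dist (u m y) (T y (unit_vec m.*2)); rewrite distrC.
    by move: h hm; lra.
  apply: (cvgn_dist_le (N := m.+1) (@T_cvg y _)) => M mM.
  have -> : \sum_(0 <= i < M) term y i (unit_vec m.*2) - u m y =
      \sum_(0 <= i < M) weight i * w i y * phi i (unit_vec m.*2).
    apply/eqP; rewrite subr_eq addrC; apply/eqP.
    rewrite -(sum_delta_mul (fun i => u i y) mM) -big_split.
    apply: eq_bigr => i _; rewrite termE /=; congr (_ * _ + _).
    by rewrite /l1_basis_seq (inj_eq double_inj) eq_sym.
  apply: le_trans (ler_norm_sum _ _ _) _; apply: le_trans (phi_sum_le _ _ _) _.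
  rewrite -[leRHS]mulr1; apply: ler_wpM2l => //.
  by rewrite !mulr_ge0 ?invr_ge0 ?(ltW c0).
- move=> y i N oi; apply: (cvgn_dist_le (N := N) (@T_cvg y _)) => M NM.
  have even0 m : (unit_vec i : X).1 m.*2 = 0.
    by rewrite /= /l1_basis_seq; case: eqP => // E; move: oi; rewrite -E odd_double.
  have tE m : term y m (unit_vec i) = weight m * w m y * phi m (unit_vec i).
    by rewrite termE even0 mulr0 add0r.
  under eq_bigr => m _ do rewrite tE.
  rewrite (big_cat_nat (leq0n N) NM) /= [X in X - _]addrC addrK.
  apply: le_trans (ler_norm_sum _ _ _) _.
  have h : 0 <= c / 4 * `|y| by rewrite !mulr_ge0 ?invr_ge0 ?(ltW c0).
  apply: (@le_trans _ _ (\sum_(N <= m < M) 2^-1 ^+ m * (c / 4 * `|y|))).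
    apply: ler_sum => m _; apply: le_trans (weight_le m y _) _.
    apply: (@le_trans _ _ (c / 4 * 2^-1 ^+ m * `|y| * 1)).
      apply: ler_wpM2l; last exact: unit_vec_norm.
      by rewrite !mulr_ge0 ?exprn_ge0 ?invr_ge0 ?(ltW c0).
    by rewrite le_eqVlt; apply/orP; left; apply/eqP; ring.
  rewrite -mulr_suml.
  have := ler_wpM2r h (@sum_exp_half_tail_le R N M); lra.
move=> y B m yB uy wy; have wm := weight_gt0 m.
have B0 : 0 <= B by exact: le_trans (yB 0%N).
exists (fun k => T' ((weight m)^-1 *: y k)); first by move=> k; exists ((weight m)^-1 *: y k).
move=> x; under eq_fun => k do rewrite linearZ dualZ.
have -> : phi m x = (weight m)^-1 * (weight m * phi m x).
  by rewrite mulrA mulVf ?mul1r // gt_eqF.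
apply: (@cvgMr R).
(* The majorant is summable because [x.1] is in l1; nothing more is known about the size of
   [u j (y k)] than boundedness. *)
pose b j := `|x.1 j.*2| * (2 * B) + 2^-1 ^+ j * (c / 4 * B * `|x|).
pose l j := (m == j)%:R * (weight j * phi j x).
apply: (@dominated_series_cvg R (fun k j => term (y k) j x) b l _ _
  (`|x| * (2 * B) + 2 * (c / 4 * B * `|x|))).
- move=> k j; rewrite termE; apply: le_trans (ler_normD _ _) _; apply: lerD.
    rewrite normrM mulrC; apply: ler_wpM2l => //; apply: le_trans (dual_le _ _) _.
    exact: ler_pM.
  apply: le_trans (weight_le j _ _) _.
  have h : 0 <= c / 4 * 2^-1 ^+ j * `|x|.
    by rewrite !mulr_ge0 ?exprn_ge0 ?invr_ge0 ?(ltW c0).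
  have := ler_wpM2l h (yB k); lra.
- move=> N; rewrite big_split /= -!mulr_suml; apply: lerD.
    by apply: ler_wpM2r; [rewrite mulr_ge0|exact: even_sum_le].
  apply: ler_wpM2r; last exact: sum_exp_half_le.
  by rewrite !mulr_ge0 ?invr_ge0 ?(ltW c0).
- move=> j; under eq_fun => k do rewrite termE.
  rewrite (_ : l j = 0 * x.1 j.*2 + weight j * (m == j)%:R * phi j x); last by rewrite /l; ring.
  apply: (@cvgD _ R^o).
    by apply: (@cvgMl R); exact: uy.
  by apply: (@cvgMl R); apply: (@cvgMr R); exact: wy.
- by move=> k; exact: T_cvg.
apply/cvgn_leP => e e0; exists m.+1 => N mN.
rewrite (_ : \sum_(0 <= j < N) l j = weight m * phi m x) ?subrr ?normr0 ?ltW //.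
rewrite -(sum_delta_mul (fun j => weight j * phi j x) mN).
by apply: eq_bigr => j _; exact: mulrC.
Qed.

End Embedding.

(** * Boundedness of weak* convergent sequences *)

Section UniformBoundedness.
Context {R : realType}.

Lemma cvgn_bounded (u : nat -> R) (l : R) : u @ \oo --> l ->
  exists B, forall n, `|u n| <= B.
Proof.
move=> /cvgn_leP/(_ _ ltr01)[N hN].
exists (\sum_(0 <= i < N) `|u i| + (`|l| + 1)) => n.
have s0 : 0 <= \sum_(0 <= i < N) `|u i| by exact: sumr_ge0.
have [nN|/hN h] := ltnP n N.
  by have := le_sum_nonneg (fun i => normr_ge0 (u i)) nN; have := normr_ge0 l; lra.
have := ler_normD (u n - l) l; rewrite subrK; lra.
Qed.

Lemma wstar_cvg_bounded_complete (V : completeNormedModType R) (g : nat -> dual V) (f : dual V) :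
  (forall x, g n x @[n --> \oo] --> f x) -> exists B, forall n, `|g n| <= B.
Proof.
move=> gf.
pose F := [set (g n : V -> R^o) | n in [set: nat]].
have /(_ 1)[B hB] : uniform_bounded F.
  apply: Banach_Steinhauss => [_ [n _ <-]|x].
    split; last exact: dual_linear.
    move=> r; exists (`|g n| * r) => x xr; apply: le_trans (dual_le _ _) _.
    exact: ler_wpM2l.
  by have [B hB] := cvgn_bounded (gf x); exists B => _ [n _ <-]; exact: hB.
exists B => n; apply: dual_norm_le => x x1; apply: (hB (g n)) => //.
by exists n.
Qed.

(** Banach-Steinhaus is applied to the restrictions to the two complete factors. *)
Lemma wstar_cvg_bounded (V W : completeNormedModType R) (g : nat -> dual (V * W)%type)
    (f : dual (V * W)%type) :
  (forall x, g n x @[n --> \oo] --> f x) -> exists B, forall n, `|g n| <= B.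
Proof.
move=> gf.
have part1 (h : dual (V * W)%type) : exists h1 : dual V, forall x, h1 x = h (x, 0).
  apply: (@ex_dual R V (fun x => h (x, 0)) `|h|).
    move=> a x y; rewrite -linearP; congr (h _); congr (_, _).
    by rewrite /= scaler0 addr0.
  move=> x; apply: le_trans (dual_le _ _) _; apply: ler_wpM2l => //.
  by apply/prod_norm_le; rewrite /= normr0.
have part2 (h : dual (V * W)%type) : exists h2 : dual W, forall x, h2 x = h (0, x).
  apply: (@ex_dual R W (fun x => h (0, x)) `|h|).
    move=> a x y; rewrite -linearP; congr (h _); congr (_, _).
    by rewrite /= scaler0 addr0.
  move=> x; apply: le_trans (dual_le _ _) _; apply: ler_wpM2l => //.
  by apply/prod_norm_le; rewrite /= normr0.
have [p1 p1E] := choice part1; have [p2 p2E] := choice part2.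
have [|B1 hB1] := @wstar_cvg_bounded_complete V (p1 \o g) (p1 f).
  by move=> x; rewrite p1E; under eq_fun => n do rewrite /= p1E; exact: gf.
have [|B2 hB2] := @wstar_cvg_bounded_complete W (p2 \o g) (p2 f).
  by move=> x; rewrite p2E; under eq_fun => n do rewrite /= p2E; exact: gf.
exists (B1 + B2) => n; apply: dual_norm_le => x /prod_norm_le[x1 x2].
have -> : g n x = p1 (g n) x.1 + p2 (g n) x.2.
  rewrite p1E p2E -linearD; congr (g n _).
  by case: x {x1 x2} => a b; congr (_, _); rewrite /= ?addr0 ?add0r.
apply: le_trans (ler_normD _ _) _; apply: lerD.
  apply: le_trans (dual_le _ _) _; rewrite -[leRHS]mulr1.
  by apply: ler_pM => //; exact: (hB1 n).
apply: le_trans (dual_le _ _) _; rewrite -[leRHS]mulr1.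
by apply: ler_pM => //; exact: (hB2 n).
Qed.

End UniformBoundedness.

(* Nodes are finite sequences with the last index first: the children of [t] are
   the [k :: t]. The odd coordinates of l1 carry the pairs (node, index), so
   that each node [t] has its own sequence of coordinates [tree_idx t k]. *)
Definition tree_coord (i : nat) : option (seq nat * nat) :=
  if odd i then choice.pickle_inv i./2 else None.

Definition tree_idx (t : seq nat) (k : nat) : nat := (choice.pickle (t, k)).*2.+1.

Lemma odd_tree_idx t k : odd (tree_idx t k).
Proof. by rewrite /tree_idx /= odd_double. Qed.

Lemma tree_coordK t k : tree_coord (tree_idx t k) = Some (t, k).
Proof.
rewrite /tree_coord odd_tree_idx /tree_idx (_ : _./2 = choice.pickle (t, k)).
  exact: choice.pickleK_inv.
exact: uphalf_double.
Qed.

Lemma tree_coordP i t k : tree_coord i = Some (t, k) -> i = tree_idx t k.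
Proof.
rewrite /tree_coord; case: ifP => // oi; have := choice.pickle_invK (T := (seq nat * nat)%type) i./2.
rewrite /oapp; case: choice.pickle_inv => // tk E [tkE].
by rewrite /tree_idx -tkE E -[LHS]odd_double_half oi.
Qed.

(** * Jumps and fans on the tree of coordinates *)

Section TreeFunctionals.
Context {R : realType} {Z : normedModType R}.
Let X : normedModType R := (l1 R * Z)%type.

Lemma dual_eq_coord (f g : dual X) : (forall i, f (unit_vec i) = g (unit_vec i)) ->
  (forall z, f (0, z) = g (0, z)) -> f = g.
Proof.
move=> fg fgz; apply: dual_ext => x.
apply: (@cvgn_unique R _ _ _ (@dual_l1_expand R Z f x)).
rewrite fgz; under eq_fun => N do under eq_bigr => i _ do rewrite fg.
exact: dual_l1_expand.
Qed.

(** The bound on [a] stands inside the existential, so that [linf] is a total function of [a]. *)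
Let linf_ex (a : nat -> R) : exists g : dual X, (forall i, `|a i| <= 1) ->
  [/\ forall x : X, (fun N => \sum_(0 <= i < N) a i * x.1 i) @ \oo --> (g x : R),
      forall i, g (unit_vec i) = a i & forall x, `|g x| <= `|x.1|].
Proof.
have [a1|na] := pselect (forall i, `|a i| <= 1); last by exists 0.
have [g [g1 g2 g3]] := @ex_linf_dual R Z a 1 a1; exists g => _; split=> // x.
by rewrite -[leRHS]mul1r; exact: g3.
Qed.

Definition linf (a : nat -> R) : dual X := projT1 (cid (linf_ex a)).

Lemma linfP a : (forall i, `|a i| <= 1) ->
  [/\ forall x : X, (fun N => \sum_(0 <= i < N) a i * x.1 i) @ \oo --> (linf a x : R),
      forall i, linf a (unit_vec i) = a i & forall x, `|linf a x| <= `|x.1|].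
Proof. by rewrite /linf; case: cid => g h; exact: h. Qed.

Lemma linf_snd a z : (forall i, `|a i| <= 1) -> linf a (0, z) = 0.
Proof.
move=> /linfP[_ _ h]; apply/eqP; rewrite -normr_le0.
by apply: le_trans (h _) _; rewrite normr0.
Qed.

Lemma linf_cvg (a : nat -> nat -> R) (b : nat -> R) (x : X) :
  (forall k i, `|a k i| <= 1) -> (forall i, `|b i| <= 1) ->
  (forall i, (fun k => a k i) @ \oo --> b i) ->
  (fun k => linf (a k) x : R) @ \oo --> (linf b x : R).
Proof.
move=> a1 b1 ab.
apply: (@dominated_series_cvg R (fun k i => a k i * x.1 i) (fun i => `|x.1 i|)
  (fun i => b i * x.1 i) _ _ `|x.1|).
- by move=> k i; rewrite normrM -[leRHS]mul1r; apply: ler_wpM2r.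
- exact: l1_norm_ge.
- by move=> i; apply: (@cvgMl R); exact: ab.
- by move=> k; have [h _ _] := linfP (a1 k); exact: h.
- by have [h _ _] := linfP b1; exact: h.
Qed.

(** The root has no parent, hence the empty segment and a zero jump. *)
Definition initial_segment (s t : seq nat) (k : nat) : bool :=
  if s is j :: t' then (t == t') && (k <= j)%N else false.

Definition jump_coeff (s : seq nat) (i : nat) : R :=
  if tree_coord i is Some (t, k) then (initial_segment s t k)%:R else 0.

Definition fan_coeff (s : seq nat) (i : nat) : R :=
  if tree_coord i is Some (t, k) then (t == s)%:R else 0.

Lemma bool_norm_le1 (b : bool) : `|b%:R : R| <= 1.
Proof. by rewrite normr_nat lern1 leq_b1. Qed.

Lemma jump_coeff_le s i : `|jump_coeff s i| <= 1.
Proof.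
rewrite /jump_coeff; case: tree_coord => [[t k]|]; last by rewrite normr0.
exact: bool_norm_le1.
Qed.

Lemma fan_coeff_le s i : `|fan_coeff s i| <= 1.
Proof.
rewrite /fan_coeff; case: tree_coord => [[t k]|]; last by rewrite normr0.
exact: bool_norm_le1.
Qed.

Definition jump s : dual X := linf (jump_coeff s).
Definition fan s : dual X := linf (fan_coeff s).

Definition at_tree (f : dual X) (t : seq nat) (k : nat) : R := f (unit_vec (tree_idx t k)).
Definition diff_tree (f : dual X) (t : seq nat) (j : nat) : R :=
  at_tree f t j - at_tree f t j.+1.

Lemma at_jump j t' t k : at_tree (jump (j :: t')) t k = ((t == t') && (k <= j)%N)%:R.
Proof.
rewrite /at_tree /jump; have [_ -> _] := linfP (jump_coeff_le (j :: t')).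
by rewrite /jump_coeff tree_coordK.
Qed.

Lemma at_fan s t k : at_tree (fan s) t k = (t == s)%:R.
Proof.
rewrite /at_tree /fan; have [_ -> _] := linfP (fan_coeff_le s).
by rewrite /fan_coeff tree_coordK.
Qed.

(** The jumps of the children of [s] are the indicators of the initial segments of its fan, which
    exhaust it. *)
Lemma jump_cvg_fan s x : (fun k => jump (k :: s) x : R) @ \oo --> (fan s x : R).
Proof.
apply: linf_cvg => [k i|i|i]; [exact: jump_coeff_le|exact: fan_coeff_le|].
apply/cvgn_leP => e e0; rewrite /jump_coeff /fan_coeff /initial_segment.
case: tree_coord => [[t k]|]; last by exists 0%N => n _; rewrite subrr normr0 ltW.
by exists k => n kn; rewrite kn andbT subrr normr0 ltW.
Qed.

(** With the next lemma, a single coordinate of the tree is a jump or a difference of two jumps, so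
    the coordinates enter a closure together with the jumps. *)
Lemma coord_jump0 t : coord (tree_idx t 0) = jump [:: 0%N & t].
Proof.
apply: dual_eq_coord => [i|z]; rewrite coordE; last first.
  by rewrite linf_snd //; exact: jump_coeff_le.
have [_ -> _] := linfP (jump_coeff_le [:: 0%N & t]).
rewrite /= /l1_basis_seq /jump_coeff.
case E : (tree_coord i) => [[t' k]|].
  rewrite (tree_coordP E) (_ : (tree_idx t 0 == tree_idx t' k) = (t' == t) && (k <= 0)%N) //.
  apply/eqP/andP => [/(congr1 tree_coord)|[/eqP -> ]].
    by rewrite !tree_coordK => -[-> <-].
  by rewrite leqn0 => /eqP ->.
by case: eqP => // iE; rewrite -iE tree_coordK in E.
Qed.

Lemma coord_jumpS t k : coord (tree_idx t k.+1) = jump (k.+1 :: t) - jump (k :: t).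
Proof.
apply: dual_eq_coord => [i|z]; rewrite coordE dualB; last first.
  by rewrite !linf_snd ?subr0 // => i; exact: jump_coeff_le.
have [_ -> _] := linfP (jump_coeff_le (k.+1 :: t)).
have [_ -> _] := linfP (jump_coeff_le (k :: t)).
rewrite /= /l1_basis_seq /jump_coeff.
case E : (tree_coord i) => [[t' l]|]; last first.
  by case: eqP => [iE|_]; [rewrite -iE tree_coordK in E|rewrite subrr].
rewrite (tree_coordP E).
have -> : (tree_idx t k.+1 == tree_idx t' l) = (t' == t) && (l == k.+1).
  apply/eqP/andP => [/(congr1 tree_coord)|[/eqP -> /eqP ->//]].
  by rewrite !tree_coordK => -[-> <-].
rewrite /initial_segment; case: eqP => _ /=; last by rewrite subrr.
rewrite (leq_eqVlt l) ltnS; case: eqVneq => [->|_] /=; first by rewrite ltnn subr0.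
by rewrite subrr.
Qed.

End TreeFunctionals.

(** * Lower and upper bounds for the order on a labelled tree *)

Section LabelledTree.
Context {R : realType} {Z : completeNormedModType R} (W : wellOrder) (top : W).
Let X : normedModType R := (l1 R * Z)%type.
Variable fund : W -> nat -> W.
Hypothesis fund_lt : forall l, (exists b, wo_lt b l) -> forall k, wo_lt (fund l k) l.
Hypothesis fund_min : forall l, (forall b, ~ wo_lt b l) -> forall k, fund l k = l.
Hypothesis fund_cofinal : forall l b, wo_lt b l ->
  exists K, forall k, (K <= k)%N -> wo_le b (fund l k).

Fixpoint lab (s : seq nat) : W := if s is k :: t then fund (lab t) k else top.

Variable M : set (dual X).
Hypothesis M0 : M 0.
Hypothesis ML : forall a f g, M f -> M g -> M (a *: f + g).

Section Invariant.
Variable C : R.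
Hypothesis C1 : 1 <= C.
Hypothesis M_diff : forall (f : dual X) t j, M f -> `|diff_tree f t j| <= C * 2^-1 ^+ j * `|f|.
Hypothesis M_lim : forall (f : dual X) t j, M f -> (exists b, wo_lt b (lab (j :: t))) ->
  (fun k => at_tree f (j :: t) k) @ \oo --> 2 ^+ j * diff_tree f t j.

Let at_tree_le (f : dual X) t k : `|at_tree f t k| <= `|f|.
Proof.
by apply: le_trans (dual_le _ _) _; rewrite -[leRHS]mulr1; apply: ler_wpM2l => //; exact: unit_vec_norm.
Qed.

Let at_tree_cvg (g : nat -> dual X) (f : dual X) t k :
  (forall x, g n x @[n --> \oo] --> f x) ->
  (fun n => at_tree (g n) t k) @ \oo --> at_tree f t k.
Proof. by move=> gf; exact: gf. Qed.

Let diff_tree_cvg (g : nat -> dual X) (f : dual X) t k :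
  (forall x, g n x @[n --> \oo] --> f x) ->
  (fun n => diff_tree (g n) t k) @ \oo --> diff_tree f t k.
Proof. by move=> gf; apply: (@cvgB _ R^o); exact: gf. Qed.

Let diff_le_of_lim (f : dual X) t j :
  (fun k => at_tree f (j :: t) k) @ \oo --> 2 ^+ j * diff_tree f t j ->
  `|diff_tree f t j| <= C * 2^-1 ^+ j * `|f|.
Proof.
move=> fl; have h : `|2 ^+ j * diff_tree f t j| <= `|f|.
  rewrite -[_ * _]subr0; apply: (@cvgn_dist_le R R^o _ _ _ _ 0 fl) => n _.
  by rewrite subr0; exact: at_tree_le.
have p0 := exp_half_gt0 (R := R) j.
have -> : diff_tree f t j = 2^-1 ^+ j * (2 ^+ j * diff_tree f t j).
  by rewrite exprVn mulrA mulVf ?mul1r // expf_neq0 // pnatr_eq0.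
rewrite normrM (gtr0_norm p0).
have h1 := ler_wpM2l (ltW p0) h; apply: le_trans h1 _.
rewrite -mulrA -[leLHS]mul1r; apply: ler_wpM2r => //.
by apply: mulr_ge0 => //; exact: ltW.
Qed.

(* By induction on [a]. If [f] is the limit of [g i] in a closure of order
   [b < a], then the jumps of [g i] at the late children of [j :: t] are small
   uniformly in [i], so the limits along the fan of [j :: t] are uniform. *)
Lemma wsc_lt_invariant a f t j : wsc_lt M a f -> wo_le a (lab (j :: t)) ->
  `|diff_tree f t j| <= C * 2^-1 ^+ j * `|f| /\
  ((exists b, wo_lt b (lab (j :: t))) ->
   (fun k => at_tree f (j :: t) k) @ \oo --> 2 ^+ j * diff_tree f t j).
Proof.
elim/(well_founded_ind (@wo_lt_wf W)): a => a IH in f t j *.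
move=> /wsc_ltP[[_ Mf] _|[b ba [g gb gf]] al].
  by split; [exact: M_diff|exact: M_lim].
(* The bound on the jump follows from the limit, since the values along the fan are at most the norm
   of [f]. *)
suff lim_f : (fun k => at_tree f (j :: t) k) @ \oo --> 2 ^+ j * diff_tree f t j.
  by split => // ; exact: diff_le_of_lim.
have bl : wo_lt b (lab (j :: t)) by exact: wo_lt_le_trans ba al.
(* From [K0] on the children of [j :: t] have labels at least [b], so the induction hypothesis at
   [b] applies to them. *)
have [K0 hK0] := fund_cofinal bl.
have [B gB] := wstar_cvg_bounded gf.
have B0 : 0 <= B by exact: le_trans (gB 0%N).
have C0 : 0 <= C by exact: le_trans ler01 C1.
have child i k : (K0 <= k)%N -> `|diff_tree (g i) (j :: t) k| <= C * B * 2^-1 ^+ k.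
  move=> kK; have [h _] := IH b ba (g i) (j :: t) k (gb i) (hK0 k kK).
  apply: le_trans h _; rewrite mulrAC; apply: ler_wpM2r; first exact: ltW (exp_half_gt0 k).
  apply: ler_wpM2l; first exact: C0.
  exact: gB.
have lim_g i : (fun k => at_tree (g i) (j :: t) k) @ \oo --> 2 ^+ j * diff_tree (g i) t j.
  by have [_ h] := IH b ba (g i) t j (gb i) (wo_lt_le bl); apply: h; exists b.
(* Consecutive values along the fan differ by the jumps at the children; telescoping gives a rate
   that does not depend on [i], and this permits the exchange of the two limits. *)
have unif i k : (K0 <= k)%N ->
    `|2 ^+ j * diff_tree (g i) t j - at_tree (g i) (j :: t) k| <= 2 * (C * B) * 2^-1 ^+ k.
  move=> kK; apply: (@cvgn_dist_le R R^o _ _ _ _ k (lim_g i)) => m km.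
  have -> : at_tree (g i) (j :: t) m - at_tree (g i) (j :: t) k =
      - \sum_(k <= l < m) diff_tree (g i) (j :: t) l.
    rewrite -[LHS](telescope_sumr (fun l => at_tree (g i) (j :: t) l) km) -sumrN.
    by apply: eq_bigr => l _; rewrite /diff_tree opprB.
  rewrite normrN; apply: le_trans (ler_norm_sum _ _ _) _.
  apply: (@le_trans _ _ (\sum_(k <= l < m) C * B * 2^-1 ^+ l)).
    rewrite !big_nat; apply: ler_sum => l /andP[kl _]; apply: child.
    exact: leq_trans kK kl.
  rewrite -mulr_sumr (mulrC 2) -[leRHS]mulrA; apply: ler_wpM2l; first exact: mulr_ge0.
  exact: sum_exp_half_tail_le.
apply/cvgn_leP => e e0; have [K1 hK1] := exp_half_small (2 * (C * B)) e0.
exists (maxn K0 K1) => k; rewrite geq_max => /andP[k0 /hK1 k1].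
apply: le_trans k1; rewrite distrC -[X in `|X|]subr0.
apply: (@cvgn_dist_le R R^o (fun i => 2 ^+ j * diff_tree (g i) t j - at_tree (g i) (j :: t) k)
  _ _ _ 0) => [|i _]; last by rewrite subr0; exact: unif.
by apply: (@cvgB _ R^o); [apply: (@cvgMr R); exact: diff_tree_cvg|exact: at_tree_cvg].
Qed.

(** Along the root sequence [f] takes the values 0 and 1 alternately, so its jumps have modulus 1.
    The members of a sequence from a closure of order below [top] are bounded and have jumps at most
    [C * B * 2^-1 ^+ k] at late [k], and this bound survives the limit. *)
Lemma alternating_not_in_closure : (exists b, wo_lt b top) ->
  exists f, ~ wsc_lt M top f.
Proof.
move=> [b0 b0_top].
pose a i : R := if tree_coord i is Some (t, k) then ((t == [::]) && odd k)%:R else 0.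
have a1 i : `|a i| <= 1.
  rewrite /a; case: tree_coord => [[t k]|]; last by rewrite normr0.
  exact: bool_norm_le1.
pose f := @linf R Z a.
have f_at k : at_tree f [::] k = (odd k)%:R.
  rewrite /at_tree /f; have [_ -> _] := @linfP R Z _ a1.
  by rewrite /a tree_coordK.
have f_diff k : `|diff_tree f [::] k| = 1.
  rewrite /diff_tree !f_at /=; case: (odd k) => /=; first by rewrite subr0 normr1.
  by rewrite sub0r normrN1.
exists f => /wsc_ltP[[nb _]|[b bt [g gb gf]]]; first exact: nb b0_top.
have [B gB] := wstar_cvg_bounded gf.
have C0 : 0 <= C by exact: le_trans ler01 C1.
have [K0 hK0] := fund_cofinal bt.
have half : 0 < 2^-1 :> R by rewrite invr_gt0.
have [K1 hK1] := exp_half_small (C * B) half.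
pose k := maxn K0 K1.
have : `|diff_tree f [::] k| <= 2^-1.
  apply: le_trans (hK1 k (leq_maxr _ _)); rewrite -[X in `|X|]subr0.
  apply: (@cvgn_dist_le R R^o (fun i => diff_tree (g i) [::] k) _ _ _ 0).
    exact: diff_tree_cvg.
  move=> i _; rewrite subr0.
  have [h _] := wsc_lt_invariant (gb i) (hK0 k (leq_maxl _ _) : wo_le b (lab [:: k])).
  apply: le_trans h _; rewrite mulrAC; apply: ler_wpM2r; first exact: ltW (exp_half_gt0 k).
  apply: ler_wpM2l; first exact: C0.
  exact: gB.
rewrite f_diff; lra.
Qed.

End Invariant.

(* A node whose label is least has children with the same label; they are
   harmless, since [node] treats every such node as a leaf. *)
Definition leaf (s : seq nat) : bool := `[< forall b, ~ wo_lt b (lab s) >].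

Definition node (s : seq nat) : dual X :=
  2^-1 ^+ head 0%N s *: jump s + (if leaf s then 0 else fan s).

Hypothesis M_node : forall s, s <> [::] -> wstar_seq_closure M (node s).

Let exp2K n (x : R) : 2 ^+ n * (2^-1 ^+ n * x) = x.
Proof. by rewrite exprVn mulrA mulfV ?mul1r // expf_neq0 // pnatr_eq0. Qed.

(* [2 ^ j (node s - jump (k :: s))] is [jump s] plus a multiple of the part of the
   fan of [s] beyond [k], which tends to 0 weak*. *)
Lemma jump_in_closure s : s <> [::] -> wstar_seq_closure (wsc_lt M (lab s)) (jump s).
Proof.
move: {2}(lab s) (erefl (lab s)) => l; elim/(well_founded_ind (@wo_lt_wf W)): l s.
move=> l IH [|j t] // ls _; set s := j :: t in ls *.
(* At a leaf there is no fan to cut, and [node s] is already a multiple of the jump. *)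
have [lf|nlf] := boolP (leaf s).
  apply: (wstar_seq_closure_sub (@wsc_lt_base R X M W (lab s))).
  have -> : jump s = 2 ^+ j *: node s + 0.
    apply: dual_ext => x; rewrite addr0 dualZ /node lf addr0 dualZ /=.
    by rewrite exp2K.
  apply: wstar_seq_closure_lin; first exact: ML.
    exact: M_node.
  exact: wstar_seq_closure_incl M0.
have [b bl] : exists b, wo_lt b (lab s).
  apply: contrapT => nb; move/negP: nlf; apply; apply/asboolP => b bl.
  by apply: nb; exists b.
(* A child has a smaller label, and the closure in which its jump appears is one step beyond that
   label, hence still within the stage of [lab s]. *)
have jk k : wsc_lt M (lab s) (jump (k :: s)).
  have lt_k : wo_lt (lab (k :: s)) (lab s) by apply: fund_lt; exists b.
  apply: (wsc_lt_step lt_k); apply: (IH (lab (k :: s))) => //.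
  by rewrite -ls.
have nodeM : wsc_lt M (lab s) (node s).
  apply: (wsc_lt_step bl); apply: (wstar_seq_closure_sub (@wsc_lt_base R X M W b)).
  exact: M_node.
have lin := @wsc_lt_lin R X M ML W (lab s).
exists (fun k => 2 ^+ j *: (-1 *: jump (k :: s) + node s) + 0).
  by move=> k; apply: (lin _ _ _ (lin _ _ _ (jk k) nodeM)); exact: wsc_lt_base M0.
move=> x; under eq_fun => k do rewrite addr0 dualZ dualD dualZ mulN1r.
have -> : jump s x = 2 ^+ j * (- fan s x + node s x).
  rewrite /node (negbTE nlf) dualD dualZ /= addrCA addNr addr0.
  by rewrite exp2K.
apply: (@cvgMr R); apply: (@cvgD _ R^o); last exact: cvg_cst.
by apply: (@cvgN _ R^o); exact: jump_cvg_fan.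
Qed.

Lemma tree_coord_in_closure t k : (exists b, wo_lt b top) ->
  wsc_lt M top (coord (tree_idx t k)).
Proof.
move=> btop.
(* Labels become stationary below a leaf, so the decrease from [top] is gained at the first step and
   merely kept afterwards. *)
have lab_lt u : u <> [::] -> wo_lt (lab u) top.
  elim: u => [|i [|i' u] IH] // _; first exact: fund_lt.
  have [[c cl]|nc] := pselect (exists c, wo_lt c (lab (i' :: u))); last first.
    have -> : lab [:: i, i' & u] = lab (i' :: u).
      by apply: fund_min => c cl; apply: nc; exists c.
    exact: IH.
  by apply: wo_lt_trans (IH _) => //; apply: fund_lt; exists c.
have jump_in s : s <> [::] -> wsc_lt M top (jump s).
  move=> s0; apply: (wsc_lt_step (lab_lt _ s0)); exact: jump_in_closure.
case: k => [|k]; first by rewrite coord_jump0; exact: jump_in.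
rewrite coord_jumpS addrC -scaleN1r; apply: (wsc_lt_lin ML); exact: jump_in.
Qed.

End LabelledTree.

(** * The functionals of the construction and the invariant on the range *)

Section EmbeddingOfGivenOrder.
Context {R : realType} {Z : completeNormedModType R}.
Let X : normedModType R := (l1 R * Z)%type.

Lemma norming_dense_seq (V : normedModType R) (U : submodClosed (dual V)) :
  separable_set [set` U] -> norming [set` U] ->
  exists (u : nat -> dual V) (c : R), [/\ 0 < c, forall m, [set` U] (u m),
    forall m, `|u m| <= 2 & forall y, y != 0 -> exists m, c * `|y| <= `|u m y|].
Proof.
move=> sepU [c c0 hc].
have U0 : [set` U] 0 by exact: rpred0.
have [d [dU dd]] := separable_dense_seq sepU (ex_intro _ 0 U0).
(* Elements of norm above 2 are replaced by 0. None of those used is lost: they lie within 1 of a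
   unit vector. Of the value 3/4 a quarter is spent on the approximation, whence [c / 2]. *)
exists (fun m => if `|d m| <= 2 then d m else 0), (c / 2); split.
- by rewrite divr_gt0.
- by move=> m; case: ifP => // _; exact: dU.
- by move=> m; case: ifP => // _; rewrite normr0.
move=> y; rewrite -normr_gt0 => y0; have cy : 0 < c * `|y| by exact: mulr_gt0.
have [f [Uf f1 fy]] : exists f, [/\ [set` U] f, `|f| = 1 & 3 / 4 * (c * `|y|) < `|f y|].
  apply: contrapT => no; have := hc y; apply/negP; rewrite -ltNge.
  set S := [set _ | _ in _]; have [S0|S0] := pselect (S !=set0).
    apply: (@le_lt_trans _ _ (3 / 4 * (c * `|y|))); last by lra.
    apply: ge_sup => // _ [f [Uf f1] <-]; rewrite leNgt; apply/negP => h.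
    by apply: no; exists f.
  by rewrite (_ : S = set0) ?sup0 // -subset0 => t St; apply: S0; exists t.
have e0 : 0 < Num.min 1 (c / 4) by rewrite lt_min ltr01 divr_gt0.
have [m hm] := dd f Uf _ e0.
move: hm; rewrite le_min => /andP[h1 h2]; exists m.
have dm2 : `|d m| <= 2 by have := ler_normD (d m - f) f; rewrite subrK f1; lra.
rewrite dm2.
have h3 : `|d m y - f y| <= c / 4 * `|y|.
  by rewrite -dualB; apply: le_trans (dual_le _ _) _; exact: ler_wpM2r.
have := lerB_dist (f y) (d m y); rewrite distrC; lra.
Qed.

Lemma weight_mul_le (V : normedModType R) (w : nat -> dual V) (phi : nat -> dual X) (c : R) m y :
  0 < c -> `|weight w phi c m * w m y| <= c / 4 * `|y|.
Proof.
move=> c0; have w0 := weight_gt0 w phi c0 m; rewrite normrM (gtr0_norm w0).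
have hw : 0 < 1 + `|w m| by have := normr_ge0 (w m); lra.
have hp : 1 <= 1 + `|phi m| by have := normr_ge0 (phi m); lra.
have h1 : `|w m y| <= (1 + `|w m|) * `|y|.
  by apply: le_trans (dual_le _ _) _; apply: ler_wpM2r => //; rewrite lerDr.
apply: le_trans (ler_wpM2l (ltW w0) h1) _; rewrite mulrA; apply: ler_wpM2r => //.
have -> : weight w phi c m * (1 + `|w m|) = c / 4 * 2^-1 ^+ m / (1 + `|phi m|).
  by rewrite /weight; field; apply/andP; split; apply/eqP; lra.
rewrite ler_pdivrMr; last lra.
have : 2^-1 ^+ m <= 1 :> R by apply: exprn_ile1; lra.
have := exp_half_gt0 (R := R) m; nra.
Qed.

Section Construction.
Context {W : wellOrder} (top : W) (fund : W -> nat -> W).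
Variable b : nat -> dual Z.

Let bsnd_ex n : exists f : dual X, forall x : X, f x = b n x.2.
Proof.
apply: (@ex_dual R X (fun x => b n x.2) `|b n|) => [a x y|x].
  by rewrite linearP.
apply: le_trans (dual_le _ _) _; apply: ler_wpM2l => //; exact: prod_snd_le.
Qed.

Definition snd_dual n : dual X := projT1 (cid (bsnd_ex n)).

Lemma snd_dualE n (x : X) : snd_dual n x = b n x.2.
Proof. by rewrite /snd_dual; case: cid. Qed.

(** Besides the nodes, the family supplies the coordinates outside the tree and functionals on [Z]
    that are weak* sequentially dense; these enter at the first closure. *)
Definition phi_of (q : nat + nat + seq nat) : dual X :=
  match q with
  | inl (inl i) => if tree_coord i is Some _ then 0 else coord i
  | inl (inr n) => snd_dual n
  | inr [::] => 0
  | inr s => node top fund s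
  end.

Definition phi (m : nat) : dual X :=
  if choice.pickle_inv m is Some q then phi_of q else 0.

Lemma phi_pickle q : phi (choice.pickle q) = phi_of q.
Proof. by rewrite /phi choice.pickleK_inv. Qed.

Let rank (s : seq nat) : nat := choice.pickle (inr s : nat + nat + seq nat).

(** Only the nodes are seen by the coordinates of the tree, so they alone enter the computations of
    jumps and limits along fans. *)
Lemma phiP m : (exists s : seq nat, s <> [::] /\ m = rank s) \/
  (forall t k, at_tree (phi m) t k = 0) /\ forall s : seq nat, s <> [::] -> m <> rank s.
Proof.
rewrite /phi; have := choice.pickle_invK (T := (nat + nat + seq nat)%type) m.
rewrite /oapp; case E : choice.pickle_inv => [q|]; last first.
  move=> _; right; split=> // s _ ms; move: E.
  by rewrite ms /rank choice.pickleK_inv.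
move=> qm; have other : (forall s : seq nat, s <> [::] -> q <> inr s) ->
    forall s : seq nat, s <> [::] -> m <> rank s.
  move=> h s s0 ms; move: E; rewrite ms /rank choice.pickleK_inv => -[qs].
  exact: (h s s0 (esym qs)).
case: q qm other {E} => [[i|n]|[|j t]] qm other.
- right; split; last exact: other.
  move=> t k; rewrite /at_tree /=; case E : (tree_coord i) => //.
  rewrite coordE /= /l1_basis_seq; case: eqP => // iE.
  by rewrite iE tree_coordK in E.
- right; split; last exact: other.
  by move=> t k; rewrite /at_tree /= snd_dualE /= linear0.
- right; split=> //; apply: other => s s0 [sE]; exact: s0.
- by left; exists (j :: t).
Qed.

Lemma rank_inj s s' : rank s = rank s' -> s = s'.
Proof. by move=> /(pcan_inj choice.pickleK) []. Qed.

Lemma phi_node j t : phi (rank (j :: t)) = node top fund (j :: t).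
Proof. by rewrite phi_pickle. Qed.

Lemma at_node j t t' k : at_tree (node top fund (j :: t) : dual X) t' k =
  2^-1 ^+ j * ((t' == t) && (k <= j)%N)%:R +
  (if leaf top fund (j :: t) then 0 else (t' == j :: t)%:R).
Proof.
transitivity (2^-1 ^+ j * at_tree (jump (j :: t) : dual X) t' k +
  at_tree (if leaf top fund (j :: t) then 0 else fan (j :: t) : dual X) t' k) => //.
by rewrite at_jump; congr (_ + _); case: ifP => // _; rewrite at_fan.
Qed.

(** A fan is constant along its sequence and cancels in differences; an initial segment has one
    jump, at its end. So the jump at [(t, j)] isolates the node [j :: t]. *)
Lemma diff_phi m t j : diff_tree (phi m) t j = 2^-1 ^+ j * (rank (j :: t) == m)%:R.
Proof.
have [[[|j' t'] [s0 ->]]|[h1 h2]] := phiP m; first by case: s0.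
  2: {
  rewrite /diff_tree !h1 subrr; case: eqP => [E|_]; last by rewrite mulr0.
  by case: (h2 (j :: t) _ (esym E)). }
rewrite phi_node /diff_tree !at_node.
have -> : (rank (j :: t) == rank (j' :: t')) = (t == t') && (j == j').
  apply/eqP/andP => [/rank_inj[-> ->]//|[/eqP -> /eqP ->]//].
case: (t == t') => /=; last by rewrite !mulr0; case: ifP; rewrite ?subrr.
rewrite opprD addrACA subrr addr0 -mulrBr.
by have [lt|gt|->] := ltngtP j j'; rewrite ?subrr ?subr0 ?mulr0.
Qed.

(** Apart from the fan of [j :: t] itself, the coordinates of this sequence are met only by the
    jumps of its children, and each of these ends. *)
Lemma at_phi_eventually m j t : ~~ leaf top fund (j :: t) ->
  exists K, forall k, (K <= k)%N ->
    at_tree (phi m) (j :: t) k = (rank (j :: t) == m)%:R.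
Proof.
move=> nl; have [[[|j' t'] [s0 ->]]|[h1 h2]] := phiP m; first by case: s0.
  2: {
  exists 0%N => k _; rewrite h1; case: eqP => // E.
  by case: (h2 (j :: t) _ (esym E)). }
exists j'.+1 => k jk; rewrite phi_node at_node [(k <= j')%N]leqNgt jk andbF mulr0 add0r.
have -> : (rank (j :: t) == rank (j' :: t')) = (j :: t == j' :: t').
  by apply/eqP/eqP => [/rank_inj|->].
case: eqP => [<-|_]; first by rewrite (negbTE nl).
by case: ifP.
Qed.

Section Range.
Context {V : normedModType R} (w : nat -> dual V) (c : R) (T : {linear V -> dual X}).
Hypothesis c0 : 0 < c.
Hypothesis T_ge : forall y, c / 2 * `|y| <= `|T y|.
Hypothesis T_odd : forall y i N, odd i ->
  `|T y (unit_vec i) - \sum_(0 <= m < N) weight w phi c m * w m y * phi m (unit_vec i)|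
    <= c / 2 * 2^-1 ^+ N * `|y|.

Let coef y m : R := weight w phi c m * w m y.

Let at_T y t k N :
  `|at_tree (T y) t k - \sum_(0 <= m < N) coef y m * at_tree (phi m) t k| <=
    c / 2 * `|y| * 2^-1 ^+ N.
Proof. by rewrite mulrAC; apply: T_odd; exact: odd_tree_idx. Qed.

(** The jump at [(t, j)] reads off the coefficient of a single node, because all other terms of the
    series have no jump there. *)
Let diff_T y t j : diff_tree (T y) t j = 2^-1 ^+ j * coef y (rank (j :: t)).
Proof.
apply/eqP; rewrite -subr_eq0 -normr_le0; apply/ler_addgt0Pr => e e0; rewrite add0r.
have [N /(_ _ (leq_maxl N (rank (j :: t)).+1)) hN] := exp_half_small (c * `|y|) e0.
set N' := maxn _ _ in hN; have mN : (rank (j :: t) < N')%N by exact: leq_maxr.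
apply: le_trans hN.
have h1 := at_T y t j N'; have h2 := at_T y t j.+1 N'.
have E : \sum_(0 <= m < N') coef y m * at_tree (phi m) t j -
    \sum_(0 <= m < N') coef y m * at_tree (phi m) t j.+1 =
    2^-1 ^+ j * coef y (rank (j :: t)).
  rewrite -sumrB -(sum_delta_mul (coef y) mN) mulr_sumr; apply: eq_bigr => m _.
  by rewrite -mulrBr -/(diff_tree _ _ _) diff_phi mulrCA.
rewrite -E /diff_tree opprD addrACA -opprD.
by apply: le_trans (ler_normB _ _) _; lra.
Qed.

Lemma range_diff f t j : range T f -> `|diff_tree f t j| <= 1 * 2^-1 ^+ j * `|f|.
Proof.
move=> [y _ <-]; rewrite diff_T mul1r normrM (gtr0_norm (exp_half_gt0 j)).
apply: ler_wpM2l; first exact: ltW (exp_half_gt0 j).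
apply: le_trans (weight_mul_le w phi (rank (j :: t)) y c0) _.
have cy : 0 <= c * `|y| by apply: mulr_ge0 => //; exact: ltW.
by have := T_ge y; lra.
Qed.

(** The tail of the series is uniformly small on odd coordinates, and each of the finitely many
    remaining terms is eventually constant along the fan. The limit is the coefficient of the node,
    which by [diff_T] is the jump times [2 ^+ j]. *)
Lemma range_lim f t j : range T f -> (exists a, wo_lt a (lab top fund (j :: t))) ->
  (fun k => at_tree f (j :: t) k) @ \oo --> 2 ^+ j * diff_tree f t j.
Proof.
move=> [y _ <-] [a al].
have nl : ~~ leaf top fund (j :: t) by apply/negP => /asboolP/(_ a).
rewrite diff_T exprVn mulrA mulfV ?mul1r ?expf_neq0 ?pnatr_eq0 //.
apply/cvgn_leP => e e0.
have [N /(_ _ (leq_maxl N (rank (j :: t)).+1)) hN] := exp_half_small (c / 2 * `|y|) e0.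
set N' := maxn _ _ in hN; have mN : (rank (j :: t) < N')%N by exact: leq_maxr.
have /choice[K KP] := fun m => at_phi_eventually m nl.
exists (\max_(m < N') K m) => k Kk; apply: le_trans hN.
rewrite -(sum_delta_mul (coef y) mN).
have -> : \sum_(0 <= m < N') coef y m * (rank (j :: t) == m)%:R =
    \sum_(0 <= m < N') coef y m * at_tree (phi m) (j :: t) k; last exact: at_T.
apply: eq_big_nat => m /andP[_ mN']; rewrite KP //; apply: leq_trans Kk.
exact: (leq_bigmax (F := fun m : 'I_N' => K m) (Ordinal mN')).
Qed.

End Range.
End Construction.
End EmbeddingOfGivenOrder.

(** * Assembling the embedding of prescribed order *)

Section GivenOrder.
Context {R : realType} {Z : completeNormedModType R}.
Let X : normedModType R := (l1 R * Z)%type.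

Lemma bounded_below_embedding (V E : normedModType R) (T : {linear V -> E}) (c C : R) :
  0 < c -> (forall y, `|T y| <= C * `|y|) -> (forall y, c * `|y| <= `|T y|) ->
  isomorphic_embedding T.
Proof.
move=> c0 TC cT; split.
  apply/linear_bounded_continuous/bounded_funP => r; exists (`|C| * r) => x xr.
  apply: le_trans (TC x) _; apply: le_trans (ler_wpM2r (normr_ge0 _) (ler_norm C)) _.
  exact: ler_wpM2l.
have T_inj x y : T x = T y -> x = y.
  move=> xy; have := cT (x - y); rewrite linearB xy subrr normr0 pmulr_rle0 // normr_le0.
  by rewrite subr_eq0 => /eqP.
have /choice[S SP] : forall f, exists y, range T f -> T y = f.
  by move=> f; have [[y _ yf]|no] := pselect (range T f); [exists y|exists 0].
have ST : cancel T S by move=> y; apply: T_inj; apply: SP; exists y.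
exists S => //; apply/subspace_continuousP => _ [y _ <-]; apply/cvgrPdist_le => e e0.
have ce : 0 < c * e by exact: mulr_gt0.
apply: filterS (nbhsx_ballx (T y) (c * e) ce) => f; rewrite -ball_normE /= => yf [z _ zf].
rewrite /from_subspace -zf !ST -(ler_pM2l c0); apply: le_trans (cT _) _.
by rewrite linearB zf ltW.
Qed.

Lemma embedding_of_given_order (alpha : wellOrder) (V : normedModType R) :
  separable_set [set: Z] -> countable [set: alpha] -> inhabited alpha ->
  has_separable_norming_subspace V ->
  exists T : {linear V -> dual X},
    [/\ exists c C, [/\ 0 < c, forall y, `|T y| <= C * `|y| & forall y, c * `|y| <= `|T y|],
        wsc (range T) alpha <> wsc (range T) (osucc alpha) &
        wsc (range T) (osucc alpha) = [set: dual X]].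
Proof.
move=> sepZ cA [a0] [U [clU sepU normU infU]].
have [u [c [c0 uU u2 u_norming]]] := norming_dense_seq sepU normU.
have [w [G [wG GU]]] := biorthogonal_annihilating clU infU.
have [b bP] := weakstar_dense_sequence sepZ.
have [fund fundP] := fundamental_sequences (countable_osucc cA).
(* The root carries the label [alpha] itself, represented by the top of its successor. *)
pose top : osucc alpha := None.
have top0 : exists l, wo_lt l top by exists (Some a0).
have fund_lt l : (exists l', wo_lt l' l) -> forall k, wo_lt (fund l k) l.
  by move=> /(proj1 (fundP l))[].
have fund_min l : (forall l', ~ wo_lt l' l) -> forall k, fund l k = l.
  exact: (proj2 (fundP l)).
have fund_cofinal l l' : wo_lt l' l -> exists K, forall k, (K <= k)%N -> wo_le l' (fund l k).
  by move=> ll; have [_] := proj1 (fundP l) (ex_intro _ l' ll); exact.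
pose ph := phi top fund b : nat -> dual X.
have [T [TC Tc T_odd T_lim]] := @ex_embedding R Z V u w ph c c0 u2 u_norming.
pose M := range T.
have M0 : M 0 by exists 0 => //; exact: linear0.
have ML a f g : M f -> M g -> M (a *: f + g).
  by move=> [y _ <-] [z _ <-]; exists (a *: y + z) => //; exact: linearP.
have M_ph m : wstar_seq_closure M (ph m).
  (* The two families are interleaved so that one bounded sequence handles both; [G m] vanishes on
     the [u j], which lie in [U]. *)
  pose f i := if odd i then w i./2 else u i./2.
  have [y [yB yG]] := goldstine_sequence (G m) f.
  apply: (T_lim y (`|G m| + 1) m yB) => j.
    have := yG j.*2; rewrite /f odd_double doubleK.
    by rewrite (_ : G m (u j) = 0) //; exact: GU.
  by have := yG j.*2.+1; rewrite /f /= odd_double /= uphalf_double wG.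
have M_node s : s <> [::] -> wstar_seq_closure M (node top fund s : dual X).
  by case: s => // j t _; rewrite -(phi_node top fund b); exact: M_ph.
have M_diff := range_diff c0 Tc T_odd.
have M_cvg := range_lim T_odd.
have in_top f : wstar_seq_closure M f -> wsc_lt M top f.
  move=> Mf; have [l lt] := top0; apply: (wsc_lt_step lt).
  exact: wstar_seq_closure_sub (@wsc_lt_base _ _ M _ l) _ Mf.
have coord_in i : wsc_lt M top (coord i).
  case E : (tree_coord i) => [[t k]|].
    by rewrite (tree_coordP E); exact: (tree_coord_in_closure fund_lt fund_min M0 ML M_node t k top0).
  apply: in_top; have := M_ph (choice.pickle (inl (inl i) : nat + nat + seq nat)%type).
  by rewrite /ph phi_pickle /= E.
have snd_in n : wsc_lt M top (snd_dual b n).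
  apply: in_top; have := M_ph (choice.pickle (inl (inr n) : nat + nat + seq nat)%type).
  by rewrite /ph phi_pickle.
have all_in (psi : dual X) : wstar_seq_closure (wsc_lt M top) psi.
  have [psiZ psiZE] : exists f : dual Z, forall z, f z = psi (0, z).
    apply: (@ex_dual R Z (fun z => psi (0, z)) `|psi|) => [a x y|x].
      rewrite -linearP; congr (psi _); congr (_, _).
      by rewrite /= scaler0 addr0.
    apply: le_trans (dual_le _ _) _; apply: ler_wpM2l => //.
    by apply/prod_norm_le; rewrite /= normr0.
  have [d dP] := bP psiZ.
  (* Partial sums recover the l1 part of [psi], while the part on [Z] is approached along the dense
     sequence; one limit thus suffices beyond order [alpha]. *)
  exists (fun N => \sum_(0 <= i < N) psi (unit_vec i) *: coord i + snd_dual b (d N)).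
    move=> N; rewrite -[X in X + _]scale1r; apply: (wsc_lt_lin ML) => //.
    elim: N => [|N IH]; first by rewrite big_geq //; exact: wsc_lt_base M0.
    by rewrite big_nat_recr //= addrC; exact: (wsc_lt_lin ML).
  move=> x.
  rewrite (_ : (fun N => _) = (fun N => (\sum_(0 <= i < N) psi (unit_vec i) * x.1 i + psi (0, x.2)) +
      (b (d N) x.2 - psiZ x.2))); last first.
    apply/funext => N; rewrite dualD dual_sum snd_dualE psiZE.
    under eq_bigr => i _ do rewrite dualZ coordE.
    by ring.
  rewrite -[psi x]addr0; apply: (@cvgD _ R^o); first exact: dual_l1_expand.
  rewrite -(subrr (psiZ x.2)); apply: (@cvgB _ R^o); [exact: dP|exact: cvg_cst].
have full : wsc M (osucc alpha) = [set: dual X].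
  apply/seteqP; split=> // psi _; apply: wsc_osucc_incl.
  by rewrite wsc_osucc_top; exact: all_in.
exists T; split=> //.
  by exists (c / 2), (2 + c / 2); split; [rewrite divr_gt0| |].
rewrite full wsc_osucc_top => E.
have [f nf] := alternating_not_in_closure fund_cofinal (lexx 1) M_diff M_cvg top0.
by apply: nf; rewrite E.
Qed.

End GivenOrder.

Theorem theorem4 (R : realType) (Z : completeNormedModType R)
    (sepZ : separable_set [set: Z]) :
  (forall (alpha : wellOrder) (Y : completeNormedModType R),
     countable [set: alpha] -> inhabited alpha ->
     has_separable_norming_subspace Y ->
     exists T : {linear Y -> dual (l1 R * Z)%type},
       [/\ isomorphic_embedding T,
           wsc (range T) alpha <> wsc (range T) (osucc alpha) &
           wsc (range T) (osucc alpha) = [set: dual (l1 R * Z)%type]]) /\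
  (forall Y : submodClosed (dual (l1 R * Z)%type),
     total_set [set` Y] -> has_separable_norming_subspace (subspace_type Y)).
Proof.
split=> [alpha Y cA iA nY|Y totY]; last exact: total_has_separable_norming_subspace.
have [T [[c [C [c0 TC cT]]] nwsc wscT]] := embedding_of_given_order sepZ cA iA nY.
by exists T; split=> //; exact: bounded_below_embedding c0 TC cT.
Qed.
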